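(* Let $\theta$ be a Cartan involution of $\mathfrak{g}$ commuting with $\sigma$, let $\mathfrak{a}$ be a $\theta$-invariant maximally split Cartan subspace of $\mathfrak{q}$, and let $R$ be the restricted root system with respect to $\mathfrak{a}$. Let $r$ be the rank and $l$ the split rank of $G/H$. According to the type of $(R,\theta)$, the set of all real restricted roots of $R$ is the following (sums $\alpha_a+\cdots+\alpha_b$ and $2\alpha_a+\cdots+2\alpha_b$ are $0$ if $a>b$): \begin{itemize} \item AI, EI, EV, EVIII, FI, G: all restricted roots. \item AIII: $\{\pm(\alpha_i+\cdots+\alpha_{r+1-i})\mid 1\le i\le l\}$. \item BI: $\{\pm(\alpha_i+\cdots+\alpha_{j-1})\mid 1\le i<j\le l\}\cup\{\pm(\alpha_i+\cdots+\alpha_r+\alpha_j+\cdots+\alpha_r)\mid 1\le i<j\le l\}\cup\{\pm(\alpha_i+\cdots+\alpha_r)\mid 1\le i\le l\}$. \item BCI: $\{\pm(\alpha_i+\cdots+\alpha_{j-1})\mid 1\le i<j\le l\}\cup\{\pm(\alpha_i+\cdots+\alpha_r+\alpha_j+\cdots+\alpha_r)\mid 1\le i<j\le l\}\cup\{\pm(\alpha_i+\cdots+\alpha_r)\mid 1\le i\le l\}\cup\{\pm2(\alpha_i+\cdots+\alpha_r)\mid 1\le i\le l\}$. \item BCIII: $\{\pm(\alpha_{2i-1}+2\alpha_{2i}+\cdots+2\alpha_r)\mid 1\le i\le l\}$. \item CI: $\{\pm(\alpha_i+\cdots+\alpha_{j-1})\mid 1\le i<j\le l\}\cup\{\pm(\alpha_i+\cdots+\alpha_{j-1}+2\alpha_j+\cdots+2\alpha_{r-1}+\alpha_r)\mid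 1\le i<j\le l\}\cup\{\pm(2\alpha_i+\cdots+2\alpha_{r-1}+\alpha_r)\mid 1\le i\le l\}$. \item CIII: $\{\pm(\alpha_{2i-1}+2\alpha_{2i}+\cdots+2\alpha_{r-1}+\alpha_r)\mid 1\le i\le l\}$. \item DI: $\{\pm(\alpha_i+\cdots+\alpha_{j-1})\mid 1\le i<j\le l\}\cup\{\pm(\alpha_i+\cdots+\alpha_{r-2}+\alpha_j+\cdots+\alpha_r)\mid 1\le i<j\le l\}$. \item DIII: $\{\pm(\alpha_{2i-1}+\cdots+\alpha_{r-2}+\alpha_{2i}+\cdots+\alpha_r)\mid 1\le i\le l\}$. \item EII: $\pm$ the roots $\alpha_2$, $\alpha_4$, $\alpha_3+\alpha_4+\alpha_5$, $\alpha_2+\alpha_4$, $\alpha_2+\alpha_3+\alpha_4+\alpha_5$, $\alpha_2+\alpha_3+2\alpha_4+\alpha_5$, $\alpha_1+\alpha_3+\alpha_4+\alpha_5+\alpha_6$, $\alpha_1+\alpha_2+\alpha_3+\alpha_4+\alpha_5+\alpha_6$, $\alpha_1+\alpha_2+\alpha_3+2\alpha_4+\alpha_5+\alpha_6$, $\alpha_1+\alpha_2+2\alpha_3+2\alpha_4+2\alpha_5+\alpha_6$, $\alpha_1+\alpha_2+2\alpha_3+3\alpha_4+2\alpha_5+\alpha_6$, $\alpha_1+2\alpha_2+2\alpha_3+3\alpha_4+2\alpha_5+\alpha_6$. \item EIII: $\pm(\alpha_1+\alpha_3+\alpha_4+\alpha_5+\alpha_6)$, $\pm(\alpha_1+2\alpha_2+2\alpha_3+3\alpha_4+2\alpha_5+\alpha_6)$.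 \item EVI: $\pm$ the roots $\alpha_1$, $\alpha_3$, $\alpha_1+\alpha_3$, $\alpha_2+\alpha_3+2\alpha_4+\alpha_5$, $\alpha_1+\alpha_2+\alpha_3+2\alpha_4+\alpha_5$, $\alpha_1+\alpha_2+2\alpha_3+2\alpha_4+\alpha_5$, $\alpha_1+\alpha_2+2\alpha_3+2\alpha_4+2\alpha_5+2\alpha_6+\alpha_7$, $\alpha_1+\alpha_2+\alpha_3+2\alpha_4+2\alpha_5+2\alpha_6+\alpha_7$, $2\alpha_1+2\alpha_2+3\alpha_3+4\alpha_4+3\alpha_5+2\alpha_6+\alpha_7$, $\alpha_1+2\alpha_2+2\alpha_3+4\alpha_4+3\alpha_5+2\alpha_6+\alpha_7$, $\alpha_1+2\alpha_2+3\alpha_3+4\alpha_4+3\alpha_5+2\alpha_6+\alpha_7$, $\alpha_2+\alpha_3+2\alpha_4+2\alpha_5+2\alpha_6+\alpha_7$. \item EVII: $\pm\alpha_7$, $\pm(\alpha_2+\alpha_3+2\alpha_4+2\alpha_5+2\alpha_6+\alpha_7)$, $\pm(2\alpha_1+2\alpha_2+3\alpha_3+4\alpha_4+3\alpha_5+2\alpha_6+\alpha_7)$. \item EIX: $\pm$ the roots $\alpha_7$, $\alpha_8$, $\alpha_7+\alpha_8$, $\alpha_2+\alpha_3+2\alpha_4+2\alpha_5+2\alpha_6+\alpha_7$, $\alpha_2+\alpha_3+2\alpha_4+2\alpha_5+2\alpha_6+\alpha_7+\alpha_8$, $\alpha_2+\alpha_3+2\alpha_4+2\alpha_5+2\alpha_6+2\alpha_7+\alpha_8$,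 $2\alpha_1+2\alpha_2+3\alpha_3+4\alpha_4+3\alpha_5+2\alpha_6+\alpha_7$, $2\alpha_1+2\alpha_2+3\alpha_3+4\alpha_4+3\alpha_5+2\alpha_6+2\alpha_7+\alpha_8$, $2\alpha_1+2\alpha_2+3\alpha_3+4\alpha_4+3\alpha_5+2\alpha_6+\alpha_7+\alpha_8$, $2\alpha_1+3\alpha_2+4\alpha_3+6\alpha_4+5\alpha_5+4\alpha_6+2\alpha_7+\alpha_8$, $2\alpha_1+3\alpha_2+4\alpha_3+6\alpha_4+5\alpha_5+4\alpha_6+3\alpha_7+\alpha_8$, $2\alpha_1+3\alpha_2+4\alpha_3+6\alpha_4+5\alpha_5+4\alpha_6+3\alpha_7+2\alpha_8$. \item FII: $\pm(\alpha_1+2\alpha_2+3\alpha_3+2\alpha_4)$. \item FIII: $\pm(\alpha_1+\alpha_2+\alpha_3)$, $\pm(\alpha_2+2\alpha_3+2\alpha_4)$, $\pm(\alpha_1+2\alpha_2+3\alpha_3+2\alpha_4)$, $\pm(2\alpha_1+3\alpha_2+4\alpha_3+2\alpha_4)$. \item AII, EIV, A$+$A, B$+$B, C$+$C, D$+$D, BC$+$BC, EI$+$EI, EV$+$EV, EVIII$+$EVIII, FI$+$FI, G$+$G: the empty set. \end{itemize}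
   Context: **Setting.** $G$ is a connected semisimple noncompact real Lie group, $\sigma$ an involution of $G$, $H$ a closed subgroup with $(G_\sigma)_0\subset H\subset G_\sigma$ ($G_\sigma$ the fixed point group, $(G_\sigma)_0$ its identity component). $\mathfrak{g}=\operatorname{Lie}(G)$, $\mathfrak{h}=\operatorname{Lie}(H)=\{X\in\mathfrak g\mid \sigma(X)=X\}$, $\mathfrak{q}=\{X\in\mathfrak{g}\mid\sigma(X)=-X\}$ (the induced involution of $\mathfrak g$ is also called $\sigma$). A Cartan subspace of $\mathfrak{q}$ is a maximal abelian subspace consisting of semisimple elements ($\operatorname{ad}$-diagonalizable over $\mathbb{C}$). The types below are those attached to irreducible symmetric pairs $(\mathfrak{g},\mathfrak{h})$; a general semisimple pair is treated factor by factor. **Restricted roots.** For a Cartan subspace $\mathfrak{a}$ and $\alpha\in(\mathfrak{a}^{\mathbb{C}})^*$ put $\mathfrak{q}^{\mathbb{C}}_\alpha=\{Y\in\mathfrak{q}^{\mathbb{C}}\mid\operatorname{ad}(A)^2Y=\alpha(A)^2Y\ \forall A\in\mathfrak{a}^{\mathbb{C}}\}$; the restricted root system is $R=\{\alpha\in(\mathfrak{a}^{\mathbb{C}})^*\setminus\{0\}\mid\mathfrak{q}^{\mathbb{C}}_\alpha\ne\{0\}\}$ (a root system, possibly non-reduced). A restricted root is real if it takes real values on $\mathfrak{a}$; for $\theta$-invariant $\mathfrak{a}$ this is equivalent to $\theta(\alpha)=-\alpha$, where $(\theta\alpha)(A)=\alpha(\theta A)$. The rank of $G/H$ is $\dim\mathfrak{a}$.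 **Maximally split.** Let $\mathfrak{g}=\mathfrak{k}+\mathfrak{p}$ be the Cartan decomposition for $\theta$. A $\theta$-invariant Cartan subspace $\mathfrak{a}$ is maximally split if $\mathfrak{p}\cap\mathfrak{a}$ is a maximal abelian subspace of $\mathfrak{p}\cap\mathfrak{q}$; the split rank of $G/H$ is then $\dim(\mathfrak{p}\cap\mathfrak{a})$. **Satake diagram.** Roots are real-valued on $\mathfrak{a}_{\mathbb{R}}=\sqrt{-1}(\mathfrak{k}\cap\mathfrak{a})+\mathfrak{p}\cap\mathfrak{a}$. Take the lexicographic order on $(\mathfrak{a}_{\mathbb{R}})^*$ with respect to a basis of $\mathfrak{a}_{\mathbb{R}}$ whose first $l$ members are a basis of $\mathfrak{p}\cap\mathfrak{a}$ and the remaining ones a basis of $\sqrt{-1}(\mathfrak{k}\cap\mathfrak{a})$; let $\Psi(R)$ be the corresponding fundamental system (simple roots), $R_0=\{\alpha\in R\mid\theta(\alpha)=\alpha\}$, $\Psi(R_0)=\Psi(R)\cap R_0$. There is a permutation $p$ of order at most $2$ of $\Psi(R)\setminus\Psi(R_0)$ with $-\theta(\alpha)\equiv p\alpha$ modulo $\operatorname{Span}_{\mathbb{Z}}\Psi(R_0)$. The Satake diagram of $(R,\theta)$ is the Dynkin diagram of $\Psi(R)$ with the elements of $\Psi(R_0)$ black, the others white, and an arrow joining $\alpha\neq p\alpha$. **Numbering of simple roots.** $A_r$: chain $\alpha_1-\cdots-\alpha_r$. $B_r$: chain, $\alpha_r$ the short root. $BC_r$: simple roots as for $B_r$, with $2\alpha_r$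 also a root. $C_r$: chain, $\alpha_r$ the long root. $D_r$: $\alpha_{r-1}$ and $\alpha_r$ both attached to $\alpha_{r-2}$. $E_6,E_7,E_8$: chain $\alpha_1-\alpha_3-\alpha_4-\alpha_5-\alpha_6(-\alpha_7-\alpha_8)$ with $\alpha_2$ attached to $\alpha_4$. $F_4$: $\alpha_1-\alpha_2\Rightarrow\alpha_3-\alpha_4$ with $\alpha_1,\alpha_2$ long. **Types (Satake diagram of $(R,\theta)$; $r$ = rank, $l$ = split rank).** AI: $A_r$, all white, no arrows. AII: $A_r$ with $r=2l+1$, $\alpha_1,\alpha_3,\dots,\alpha_r$ black, $\alpha_2,\alpha_4,\dots,\alpha_{2l}$ white, no arrows. AIII: $A_r$ with $2l\le r+1$, black roots $\alpha_{l+1},\dots,\alpha_{r-l}$, arrows $\alpha_i\leftrightarrow\alpha_{r+1-i}$ ($1\le i\le l$, $i\ne r+1-i$). BI, BCI, CI: $B_r$, $BC_r$, $C_r$ respectively, $\alpha_1,\dots,\alpha_l$ white, $\alpha_{l+1},\dots,\alpha_r$ black, no arrows. BCIII, CIII: $BC_r$, $C_r$ respectively with $2l\le r$, $\alpha_2,\alpha_4,\dots,\alpha_{2l}$ white, all others black, no arrows. DI: $D_r$; if $r=l$ all white, no arrows; if $r=l+1$ all white with $\alpha_{r-1}\leftrightarrow\alpha_r$; if $r>l+1$, $\alpha_1,\dots,\alpha_l$ white, the rest black, no arrows. DIII: $D_r$; if $r=2l$, $\alpha_1,\alpha_3,\dots,\alpha_{r-1}$ black, the rest white, no arrows; if $r=2l+1$,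 $\alpha_1,\alpha_3,\dots,\alpha_{r-2}$ black, the rest white, $\alpha_{r-1}\leftrightarrow\alpha_r$. EI, EV, EVIII, FI, G: $E_6,E_7,E_8,F_4,G_2$, all white, no arrows. EII: $E_6$, all white, $\alpha_1\leftrightarrow\alpha_6$, $\alpha_3\leftrightarrow\alpha_5$. EIII: $E_6$, $\alpha_3,\alpha_4,\alpha_5$ black, $\alpha_1\leftrightarrow\alpha_6$. EIV: $E_6$, $\alpha_2,\alpha_3,\alpha_4,\alpha_5$ black, no arrows. EVI: $E_7$, $\alpha_2,\alpha_5,\alpha_7$ black, no arrows. EVII: $E_7$, $\alpha_2,\alpha_3,\alpha_4,\alpha_5$ black, no arrows. EIX: $E_8$, $\alpha_2,\alpha_3,\alpha_4,\alpha_5$ black, no arrows. FII: $F_4$, $\alpha_1,\alpha_2,\alpha_3$ black. FIII: $F_4$, $\alpha_2,\alpha_3$ black, no arrows. Y$+$Y (A$+$A, B$+$B, C$+$C, D$+$D, BC$+$BC, EI$+$EI, EV$+$EV, EVIII$+$EVIII, FI$+$FI, G$+$G): $R$ has two isomorphic irreducible components of the indicated Cartan type (EI, EV, EVIII, FI meaning $E_6,E_7,E_8,F_4$), all simple roots white, with arrows joining corresponding simple roots of the two components. *)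

(* Defs.v *)
From HB Require Import structures.
From mathcomp Require Import all_boot all_order all_algebra.
From mathcomp Require Import complex.
From mathcomp Require Import all_classical all_reals.

Set Implicit Arguments.
Unset Strict Implicit.
Unset Printing Implicit Defensive.

Import Order.TTheory GRing.Theory Num.Theory.

Local Open Scope ring_scope.

(* The pair [(x, y)] stands for [x + i y]. *)
Definition cplx (R : rcfType) (V : vectType R) : Type := (V * V)%type.

Section Complexification.
Variables (R : rcfType) (V : vectType R).

HB.instance Definition _ := GRing.Zmodule.copy (cplx V) (V * V)%type.

Definition cplx_scale (c : R[i]) (z : cplx V) : cplx V :=
  (complex.Re c *: z.1 - complex.Im c *: z.2,
   complex.Re c *: z.2 + complex.Im c *: z.1).

Fact cplx_scaleA (c d : R[i]) (z : cplx V) :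
  cplx_scale c (cplx_scale d z) = cplx_scale (c * d) z.
Proof.
case: c d z => [c1 c2] [d1 d2] [x y]; rewrite /cplx_scale /=; congr pair;
  rewrite !scalerBr !scalerDr !scalerBl !scalerDl !scalerA ?opprD;
  exact: (AC (2*2) ((1*4)*(2*3))).
Qed.

Fact cplx_scale1 : left_id 1 cplx_scale.
Proof.
by case=> x y; rewrite /cplx_scale /= !scale1r !scale0r subr0 addr0.
Qed.

Fact cplx_scaleDr : right_distributive cplx_scale +%R.
Proof.
move=> c [x y] [x' y']; rewrite /cplx_scale /=; congr pair;
  by rewrite /= !scalerDr ?opprD addrACA.
Qed.

Fact cplx_scaleDl (z : cplx V) : {morph cplx_scale^~ z : c d / c + d}.
Proof.
case: z => [x y] [c1 c2] [d1 d2]; rewrite /cplx_scale /=; congr pair;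
  by rewrite /= !scalerDl ?opprD addrACA.
Qed.

HB.instance Definition _ := GRing.Zmodule_isLmodule.Build R[i] (cplx V)
  cplx_scaleA cplx_scale1 cplx_scaleDr cplx_scaleDl.

Fact cplx_vect_axiom : Vector.axiom (\dim {:V}) (cplx V).
Proof.
pose b := vbasis {:V}.
pose f (z : cplx V) : 'rV[R[i]]_(\dim {:V}) :=
  \row_j (coord b j z.1 +i* coord b j z.2)%C.
pose h (u : 'rV[R[i]]_(\dim {:V})) : cplx V :=
  (\sum_j complex.Re (u 0 j) *: b`_j, \sum_j complex.Im (u 0 j) *: b`_j).
exists f.
  move=> c [x y] [x' y']; apply/rowP => j; rewrite !mxE /=.
  case: c => c1 c2 /=; apply/eqP; rewrite eq_complex /=.
  by rewrite !linearD !linearN /= !linearZ /= !eqxx.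
exists h => [[x y]|u].
  rewrite /h /f; congr pair;
    by rewrite [RHS](coord_vbasis (memvf _)); apply: eq_bigr => j _; rewrite mxE.
apply/rowP => j; rewrite mxE /=.
rewrite !coord_sum_free ?(basis_free (vbasisP _)) //.
by case: (u 0 j).
Qed.

HB.instance Definition _ :=
  Lmodule_hasFinDim.Build R[i] (cplx V) cplx_vect_axiom.

Definition to_cplx (x : V) : cplx V := (x, 0).

End Complexification.

Definition cplx_map (R : rcfType) (V W : vectType R) (f : V -> W)
  (z : cplx V) : cplx W := (f z.1, f z.2).

HB.mixin Record isLieAlgebra (K : fieldType) (g : Type) of Vector K g := {
  lie : g -> g -> g;
  lie_linearl : forall y, linear (lie^~ y);
  lie_linearr : forall x, linear (lie x);
  liexx : forall x, lie x x = 0;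
  lie_jacobi : forall x y z,
    lie x (lie y z) + lie y (lie z x) + lie z (lie x y) = 0 }.

#[short(type="lieAlgType")]
HB.structure Definition LieAlgebra (K : fieldType) :=
  { g of isLieAlgebra K g & Vector K g }.

Section CplxLie.
Variables (R : rcfType) (g : lieAlgType R).

Definition cplx_lie (z w : cplx g) : cplx g :=
  (lie z.1 w.1 - lie z.2 w.2, lie z.1 w.2 + lie z.2 w.1).

Let lD1 (x x' y : g) : lie (x + x') y = lie x y + lie x' y.
Proof. by have := lie_linearl y 1 x x'; rewrite !scale1r. Qed.
Let lD2 (x y y' : g) : lie x (y + y') = lie x y + lie x y'.
Proof. by have := lie_linearr x 1 y y'; rewrite !scale1r. Qed.
Let l01 (y : g) : lie 0 y = 0.
Proof. by apply: (addrI (lie 0 y)); rewrite -lD1 !addr0. Qed.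
Let l02 (x : g) : lie x 0 = 0.
Proof. by apply: (addrI (lie x 0)); rewrite -lD2 !addr0. Qed.
Let lZ1 c (x y : g) : lie (c *: x) y = c *: lie x y.
Proof. by have := lie_linearl y c x 0; rewrite l01 !addr0. Qed.
Let lZ2 c (x y : g) : lie x (c *: y) = c *: lie x y.
Proof. by have := lie_linearr x c y 0; rewrite l02 !addr0. Qed.
Let lN1 (x y : g) : lie (- x) y = - lie x y.
Proof. by rewrite -scaleN1r lZ1 scaleN1r. Qed.
Let lN2 (x y : g) : lie x (- y) = - lie x y.
Proof. by rewrite -scaleN1r lZ2 scaleN1r. Qed.

Fact cplx_lie_linearl (w : cplx g) : linear (cplx_lie^~ w).
Proof.
case: w => y1 y2 [c1 c2] [x1 x2] [x1' x2']; rewrite /cplx_lie; congr pair;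
  rewrite /= !(lD1, lN1, lZ1) ?scalerBr ?scalerDr ?opprD ?scalerDr ?opprD;
  exact: (AC (3*3) ((1*4)*(5*2)*(3*6))).
Qed.

Fact cplx_lie_linearr (z : cplx g) : linear (cplx_lie z).
Proof.
case: z => x1 x2 [c1 c2] [y1 y2] [y1' y2']; rewrite /cplx_lie; congr pair;
  rewrite /= !(lD2, lN2, lZ2) ?scalerBr ?scalerDr ?opprD ?scalerDr ?opprD;
  exact: (AC (3*3) ((1*4)*(2*5)*(3*6))).
Qed.

Fact cplx_liexx (z : cplx g) : cplx_lie z z = 0.
Proof.
case: z => x y; rewrite /cplx_lie /= !liexx subr0; congr pair.
by have := liexx (x + y); rewrite lD1 !lD2 !liexx add0r addr0.
Qed.

Fact cplx_lie_jacobi (x y z : cplx g) :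
  cplx_lie x (cplx_lie y z) + cplx_lie y (cplx_lie z x)
  + cplx_lie z (cplx_lie x y) = 0.
Proof.
case: x y z => [x1 x2] [y1 y2] [z1 z2]; rewrite /cplx_lie; congr pair => /=.
  transitivity
    ((lie x1 (lie y1 z1) + lie y1 (lie z1 x1) + lie z1 (lie x1 y1))
     - (lie x1 (lie y2 z2) + lie y2 (lie z2 x1) + lie z2 (lie x1 y2))
     - (lie x2 (lie y1 z2) + lie y1 (lie z2 x2) + lie z2 (lie x2 y1))
     - (lie x2 (lie y2 z1) + lie y2 (lie z1 x2) + lie z1 (lie x2 y2))).
    rewrite !(lD2, lN2) !opprD.
    exact: (AC ((2*2)*(2*2)*(2*2))
               ((1*5*9)*(2*8*11)*(3*6*12)*(4*7*10))).
  by rewrite !lie_jacobi !subr0.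
transitivity
  ((lie x1 (lie y1 z2) + lie y1 (lie z2 x1) + lie z2 (lie x1 y1))
   + (lie x1 (lie y2 z1) + lie y2 (lie z1 x1) + lie z1 (lie x1 y2))
   + (lie x2 (lie y1 z1) + lie y1 (lie z1 x2) + lie z1 (lie x2 y1))
   - (lie x2 (lie y2 z2) + lie y2 (lie z2 x2) + lie z2 (lie x2 y2))).
  rewrite !(lD2, lN2) !opprD.
  exact: (AC ((2*2)*(2*2)*(2*2))
             ((1*6*11)*(2*7*9)*(3*5*10)*(4*8*12))).
by rewrite !lie_jacobi !addr0 subr0.
Qed.

HB.instance Definition _ := isLieAlgebra.Build R[i] (cplx g)
  cplx_lie_linearl cplx_lie_linearr cplx_liexx cplx_lie_jacobi.

End CplxLie.

Section LieNotions.
Variables (K : fieldType) (g : lieAlgType K).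
Implicit Types (U W : {vspace g}) (X Y : g).

Definition killing X Y : K :=
  \sum_(i < \dim {:g})
    coord (vbasis {:g}) i (lie X (lie Y (vbasis {:g})`_i)).

Definition lie_ideal U : Prop := forall X Y, Y \in U -> lie X Y \in U.

Definition derived_subspace U : {vspace g} :=
  <<[seq lie X Y | X <- vbasis U, Y <- vbasis U]>>%VS.

Definition lie_solvable U : Prop :=
  exists n, iter n derived_subspace U = 0%VS.

Definition lie_semisimple : Prop :=
  forall U, lie_ideal U -> lie_solvable U -> U = 0%VS.

Definition lie_abelian U : Prop := {in U &, forall X Y, lie X Y = 0}.

Definition max_abelian_in W U : Prop :=
  [/\ (U <= W)%VS, lie_abelian U &
      forall U', (U <= U')%VS -> (U' <= W)%VS -> lie_abelian U' -> U' = U].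

Definition lie_involution (s : 'End(g)) : Prop :=
  (s \o s)%VF = \1%VF /\ (forall X Y, s (lie X Y) = lie (s X) (s Y)).

Definition plus_space (s : 'End(g)) : {vspace g} := lker (s - \1%VF).
Definition minus_space (s : 'End(g)) : {vspace g} := lker (s + \1%VF).

End LieNotions.

Arguments lie_semisimple {K} g.

(* A symmetric pair of groups (G, H) enters only through the real Lie algebra [g]
   of G and the involution [sigma] of [g] whose fixed subspace is Lie(H). *)
Section SymmetricPair.
Variables (R : realType) (g : lieAlgType R).

(* A connected semisimple Lie group is compact if and only if the Killing form
   of its Lie algebra is negative definite. *)
Definition lie_compact : Prop := forall X : g, X != 0 -> killing X X < 0.

(* [ad X] is diagonalizable over the complex numbers. *)
Definition lie_semisimple_elt (X : g) : Prop :=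
  exists2 b : seq (cplx g), basis_of fullv b &
    forall v, v \in b -> exists c : R[i], lie (to_cplx X) v = c *: v.

Definition cartan_involution (theta : 'End(g)) : Prop :=
  lie_involution theta /\ (forall X, X != 0 -> 0 < - killing X (theta X)).

Definition cartan_subspace (sigma : 'End(g)) (a : {vspace g}) : Prop :=
  max_abelian_in (minus_space sigma) a /\
  (forall X, X \in a -> lie_semisimple_elt X).

Local Notation dual a := 'Hom(cplx (subvs_of a), R[i]^o).

Section Roots.
Variables (sigma theta : 'End(g)) (a : {vspace g}).
Implicit Types (alpha beta : dual a).

Definition cplx_incl (A : cplx (subvs_of a)) : cplx g := cplx_map vsval A.

Definition maximally_split : Prop :=
  max_abelian_in (minus_space theta :&: minus_space sigma)
                 (minus_space theta :&: a).

Definition root_space alpha : set (cplx g) :=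
  [set Y : cplx g | [/\ Y.1 \in minus_space sigma, Y.2 \in minus_space sigma &
     forall A, lie (cplx_incl A) (lie (cplx_incl A) Y) = alpha A ^+ 2 *: Y]].

Definition restricted_roots : set (dual a) :=
  [set alpha | alpha != 0 /\ exists2 Y, Y != 0 & root_space alpha Y].

Definition real_valued alpha : Prop :=
  forall X : subvs_of a, (alpha (to_cplx X) : R[i]) \is Num.real.

(* Complex bilinear form on the dual transported from the (complex) Killing
   form: [riesz alpha] represents [alpha] through the Killing form. *)
Definition killing_flat (A : cplx (subvs_of a)) : dual a :=
  linfun (fun B => killing (cplx_incl A) (cplx_incl B) : R[i]^o).
Definition riesz alpha : cplx (subvs_of a) :=
  ((linfun killing_flat)^-1)%VF alpha.
Definition dual_killing alpha beta : R[i] := beta (riesz alpha).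

Definition theta_act alpha : dual a :=
  linfun (fun A => alpha (cplx_map (fun X => vsproj a (theta (vsval X))) A)).

(* The basis of the real form [a_R] made of a basis [bp] of the p-part of [a]
   followed by [sqrt(-1)] times a basis [bk] of the k-part of [a]. *)
Definition aR_basis (bp bk : seq g) : seq (cplx (subvs_of a)) :=
  [seq to_cplx (vsproj a X) | X <- bp] ++
  [seq ('i)%C *: to_cplx (vsproj a X) | X <- bk].

(* The first nonzero term is positive.  In the order of [R[i]], [0 < c] means
   that [c] is real and positive. *)
Fixpoint lex_pos (s : seq R[i]) : bool :=
  if s is c :: s' then (0 < c) || (c == 0) && lex_pos s' else false.

Variables (bp bk : seq g).

Definition positive_roots : set (dual a) :=
  [set alpha | restricted_roots alpha /\
               lex_pos [seq alpha e | e <- aR_basis bp bk]].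

Definition simple_roots : set (dual a) :=
  [set alpha | positive_roots alpha /\
     ~ (exists beta gamma, [/\ positive_roots beta, positive_roots gamma &
                              alpha = beta + gamma])].

Definition black_simple : set (dual a) :=
  [set alpha | simple_roots alpha /\ theta_act alpha = alpha].

Definition white_simple : set (dual a) := simple_roots `\` black_simple.

Definition int_span (S : set (dual a)) : set (dual a) :=
  [set alpha | exists s : seq (int * dual a),
     (forall x, x \in s -> S x.2) /\ alpha = \sum_(x <- s) x.2 *~ x.1].

(* [beta] is the image of [alpha] under the permutation [p] of the white simple
   roots; [p] is determined by this congruence. *)
Definition satake_perm alpha beta : Prop :=
  [/\ white_simple alpha, white_simple beta &
      int_span black_simple (- theta_act alpha - beta)].

End Roots.
End SymmetricPair.

Arguments restricted_roots {R g} sigma a.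

Notation cplx_dual R a := 'Hom(cplx (subvs_of a), R[i]^o).

(* Vertices are numbered from 1.  [longer i j] is only meaningful on multiple
   bonds: the root [i] is longer than the root [j].  [doubled i]: twice the
   root [i] is a root. *)
Record dynkin := Dynkin {
  bond : nat -> nat -> nat;
  longer : rel nat;
  doubled : pred nat }.

Record satake := Satake {
  satake_dynkin : dynkin;
  black : pred nat;
  arrow : rel nat }.

Local Open Scope nat_scope.

Definition edges (s : seq (nat * nat)) : rel nat :=
  fun i j => ((i, j) \in s) || ((j, i) \in s).

Definition chain : rel nat := fun i j => (j == i.+1) || (i == j.+1).

Inductive cartan_family := FamA | FamB | FamC | FamD | FamBC
  | FamE6 | FamE7 | FamE8 | FamF4 | FamG2.

Definition rank_ok (X : cartan_family) (r : nat) : bool :=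
  match X with
  | FamA | FamB | FamC | FamBC => 0 < r
  | FamD => 2 < r
  | FamE6 => r == 6
  | FamE7 => r == 7
  | FamE8 => r == 8
  | FamF4 => r == 4
  | FamG2 => r == 2
  end.

(* FamBC is FamB with twice the last simple root being a root.  In FamG2 the
   root 1 is the short one. *)
Definition dynkin_of (X : cartan_family) (r : nat) : dynkin :=
  let none2 : rel nat := fun _ _ => false in
  let none1 : pred nat := fun _ => false in
  let chain2 i j := chain i j * (if (i == r) || (j == r) then 2 else 1) in
  let edgesE := edges [:: (1, 3); (3, 4); (4, 5); (5, 6); (6, 7); (7, 8); (2, 4)] in
  match X with
  | FamA => Dynkin chain none2 none1
  | FamB => Dynkin chain2 (fun _ j => j == r) none1
  | FamBC => Dynkin chain2 (fun _ j => j == r) (fun i => i == r)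
  | FamC => Dynkin chain2 (fun i _ => i == r) none1
  | FamD => Dynkin (fun i j => if (i < r) && (j < r) then chain i j
                               else edges [:: (r - 2, r)] i j) none2 none1
  | FamE6 | FamE7 | FamE8 => Dynkin edgesE none2 none1
  | FamF4 => Dynkin (fun i j => edges [:: (1, 2); (3, 4)] i j
                                + 2 * edges [:: (2, 3)] i j)
                    (fun i _ => i == 2) none1
  | FamG2 => Dynkin (fun i j => 3 * edges [:: (1, 2)] i j)
                    (fun i _ => i == 2) none1
  end.

(* Disjoint union of two copies of [d], on [1 .. m] and [m+1 .. 2m]. *)
Definition dynkin_twice (m : nat) (d : dynkin) : dynkin :=
  let pos i := if i <= m then i else i - m in
  Dynkin (fun i j => if (i <= m) == (j <= m) then bond d (pos i) (pos j) else 0)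
         (fun i j => ((i <= m) == (j <= m)) && longer d (pos i) (pos j))
         (fun i => doubled d (pos i)).

(* [Twice X] is the type written X+X. *)
Inductive satake_type :=
  | AI | AII | AIII | BI | BCI | BCIII | CI | CIII | DI | DIII
  | EI | EII | EIII | EIV | EV | EVI | EVII | EVIII | EIX | FI | FII | FIII | G
  | Twice of cartan_family.

Definition family (T : satake_type) : cartan_family :=
  match T with
  | AI | AII | AIII => FamA
  | BI => FamB
  | BCI | BCIII => FamBC
  | CI | CIII => FamC
  | DI | DIII => FamD
  | EI | EII | EIII | EIV => FamE6
  | EV | EVI | EVII => FamE7
  | EVIII | EIX => FamE8
  | FI | FII | FIII => FamF4
  | G => FamG2
  | Twice X => X
  end.

(* [r] is the rank, [l] the split rank. *)
Definition type_ok (T : satake_type) (r l : nat) : bool :=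
  match T with
  | Twice X => rank_ok X r./2 && ~~ odd r
  | AII => rank_ok FamA r && (r == 2 * l + 1)
  | AIII => rank_ok FamA r && (2 * l <= r + 1)
  | BCIII | CIII => rank_ok (family T) r && (2 * l <= r)
  | DIII => rank_ok FamD r && ((r == 2 * l) || (r == 2 * l + 1))
  | _ => rank_ok (family T) r
  end.

Definition satake_of (T : satake_type) (r l : nat) : satake :=
  let d := dynkin_of (family T) r in
  let noarrow : rel nat := fun _ _ => false in
  let fromlist (s : seq nat) : pred nat := fun i => i \in s in
  match T with
  | AI | EI | EV | EVIII | FI | G => Satake d (fromlist [::]) noarrow
  | AII => Satake d odd noarrow
  | AIII => Satake d (fun i => l + 1 <= i <= r - l)
      (fun i j => [&& (i <= l) || (j <= l), i + j == r + 1 & i != j])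
  | BI | BCI | CI => Satake d (fun i => l < i) noarrow
  | BCIII | CIII => Satake d (fun i => ~~ (~~ odd i && (i <= 2 * l))) noarrow
  | DI => if r <= l + 1 then
            Satake d (fromlist [::])
              (fun i j => (r == l + 1) && edges [:: (r - 1, r)] i j)
          else Satake d (fun i => l < i) noarrow
  | DIII => if r == 2 * l then Satake d odd noarrow
            else Satake d (fun i => odd i && (i <= r - 2)) (edges [:: (r - 1, r)])
  | EII => Satake d (fromlist [::]) (edges [:: (1, 6); (3, 5)])
  | EIII => Satake d (fromlist [:: 3; 4; 5]) (edges [:: (1, 6)])
  | EIV => Satake d (fromlist [:: 2; 3; 4; 5]) noarrow
  | EVI => Satake d (fromlist [:: 2; 5; 7]) noarrow
  | EVII => Satake d (fromlist [:: 2; 3; 4; 5]) noarrow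
  | EIX => Satake d (fromlist [:: 2; 3; 4; 5]) noarrow
  | FII => Satake d (fromlist [:: 1; 2; 3]) noarrow
  | FIII => Satake d (fromlist [:: 2; 3]) noarrow
  | Twice X => let m := r./2 in
      Satake (dynkin_twice m (dynkin_of X m)) (fromlist [::])
        (fun i j => (j == i + m) || (i == j + m))
  end.

Section SatakeMatch.
Local Open Scope ring_scope.
Variables (R : realType) (g : lieAlgType R) (sigma theta : 'End(g)).
Variables (a : {vspace g}) (bp bk : seq g).

(* [alpha 1, ..., alpha n] is a numbering of the simple roots under which their
   Dynkin diagram is [d]: the number of bonds between two roots is the product
   of the two Cartan integers. *)
Definition has_dynkin (n : nat) (d : dynkin) (alpha : nat -> cplx_dual R a) :
    Prop :=
  let vert i := (1 <= i <= n)%N in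
  let form := @dual_killing R g a in
  [/\ {in vert &, injective alpha},
      (forall beta, simple_roots sigma bp bk beta <->
                    exists2 i, vert i & beta = alpha i),
      {in vert &, forall i j, i != j ->
         4 * form (alpha i) (alpha j) ^+ 2
           / (form (alpha i) (alpha i) * form (alpha j) (alpha j))
         = (bond d i j)%:R},
      {in vert &, forall i j, (1 < bond d i j)%N ->
         (form (alpha j) (alpha j) < form (alpha i) (alpha i)) = longer d i j} &
      {in vert, forall i,
         restricted_roots sigma a (alpha i *+ 2) <-> doubled d i}].

Definition has_satake (n : nat) (D : satake) (alpha : nat -> cplx_dual R a) :
    Prop :=
  let vert i := (1 <= i <= n)%N in
  [/\ has_dynkin n (satake_dynkin D) alpha,
      {in vert, forall i,
         black_simple sigma theta bp bk (alpha i) <-> black D i} &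
      {in vert &, forall i j,
         (alpha i <> alpha j /\
          satake_perm sigma theta bp bk (alpha i) (alpha j)) <-> arrow D i j}].

End SatakeMatch.

Section RealRootTable.
Local Open Scope ring_scope.
Variables (V : zmodType) (alpha : nat -> V).

(* [alpha i + ... + alpha j], which is 0 if [i > j]. *)
Definition seg (i j : nat) : V := \sum_(i <= k < j.+1) alpha k.

(* The linear combination of [alpha 1, alpha 2, ...] with coefficients [c]. *)
Definition lincomb (c : seq nat) : V :=
  \sum_(k < size c) alpha k.+1 *+ nth 0%N c k.

Definition pm (S : set V) : set V := [set x | S x \/ S (- x)].

Definition fam1 (l : nat) (f : nat -> V) : set V :=
  [set x | exists2 i, (1 <= i <= l)%N & x = f i].

Definition fam2 (l : nat) (f : nat -> nat -> V) : set V :=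
  [set x | exists i j, [/\ (1 <= i)%N, (i < j)%N, (j <= l)%N & x = f i j]].

Definition lincombs (cs : seq (seq nat)) : set V :=
  [set x | exists2 c, c \in cs & x = lincomb c].

Definition real_root_table (T : satake_type) (r l : nat) (Rts : set V) :
    set V :=
  match T with
  | AI | EI | EV | EVIII | FI | G => Rts
  | AIII => pm (fam1 l (fun i => seg i (r + 1 - i)))
  | BI =>
      pm (fam2 l (fun i j => seg i (j - 1)))
      `|` pm (fam2 l (fun i j => seg i r + seg j r))
      `|` pm (fam1 l (fun i => seg i r))
  | BCI =>
      pm (fam2 l (fun i j => seg i (j - 1)))
      `|` pm (fam2 l (fun i j => seg i r + seg j r))
      `|` pm (fam1 l (fun i => seg i r))
      `|` pm (fam1 l (fun i => seg i r *+ 2))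
  | BCIII =>
      pm (fam1 l (fun i => alpha (2 * i - 1)%N + seg (2 * i) r *+ 2))
  | CI =>
      pm (fam2 l (fun i j => seg i (j - 1)))
      `|` pm (fam2 l (fun i j =>
                seg i (j - 1) + seg j (r - 1) *+ 2 + alpha r))
      `|` pm (fam1 l (fun i => seg i (r - 1) *+ 2 + alpha r))
  | CIII =>
      pm (fam1 l (fun i =>
            alpha (2 * i - 1)%N + seg (2 * i) (r - 1) *+ 2 + alpha r))
  | DI =>
      pm (fam2 l (fun i j => seg i (j - 1)))
      `|` pm (fam2 l (fun i j => seg i (r - 2) + seg j r))
  | DIII =>
      pm (fam1 l (fun i => seg (2 * i - 1) (r - 2) + seg (2 * i) r))
  | EII => pm (lincombs
      [:: [:: 0; 1; 0; 0; 0; 0]; [:: 0; 0; 0; 1; 0; 0];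
          [:: 0; 0; 1; 1; 1; 0]; [:: 0; 1; 0; 1; 0; 0];
          [:: 0; 1; 1; 1; 1; 0]; [:: 0; 1; 1; 2; 1; 0];
          [:: 1; 0; 1; 1; 1; 1]; [:: 1; 1; 1; 1; 1; 1];
          [:: 1; 1; 1; 2; 1; 1]; [:: 1; 1; 2; 2; 2; 1];
          [:: 1; 1; 2; 3; 2; 1]; [:: 1; 2; 2; 3; 2; 1]]%N)
  | EIII => pm (lincombs
      [:: [:: 1; 0; 1; 1; 1; 1]; [:: 1; 2; 2; 3; 2; 1]]%N)
  | EVI => pm (lincombs
      [:: [:: 1; 0; 0; 0; 0; 0; 0]; [:: 0; 0; 1; 0; 0; 0; 0];
          [:: 1; 0; 1; 0; 0; 0; 0]; [:: 0; 1; 1; 2; 1; 0; 0];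
          [:: 1; 1; 1; 2; 1; 0; 0]; [:: 1; 1; 2; 2; 1; 0; 0];
          [:: 1; 1; 2; 2; 2; 2; 1]; [:: 1; 1; 1; 2; 2; 2; 1];
          [:: 2; 2; 3; 4; 3; 2; 1]; [:: 1; 2; 2; 4; 3; 2; 1];
          [:: 1; 2; 3; 4; 3; 2; 1]; [:: 0; 1; 1; 2; 2; 2; 1]]%N)
  | EVII => pm (lincombs
      [:: [:: 0; 0; 0; 0; 0; 0; 1]; [:: 0; 1; 1; 2; 2; 2; 1];
          [:: 2; 2; 3; 4; 3; 2; 1]]%N)
  | EIX => pm (lincombs
      [:: [:: 0; 0; 0; 0; 0; 0; 1; 0]; [:: 0; 0; 0; 0; 0; 0; 0; 1];
          [:: 0; 0; 0; 0; 0; 0; 1; 1]; [:: 0; 1; 1; 2; 2; 2; 1; 0];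
          [:: 0; 1; 1; 2; 2; 2; 1; 1]; [:: 0; 1; 1; 2; 2; 2; 2; 1];
          [:: 2; 2; 3; 4; 3; 2; 1; 0]; [:: 2; 2; 3; 4; 3; 2; 2; 1];
          [:: 2; 2; 3; 4; 3; 2; 1; 1]; [:: 2; 3; 4; 6; 5; 4; 2; 1];
          [:: 2; 3; 4; 6; 5; 4; 3; 1]; [:: 2; 3; 4; 6; 5; 4; 3; 2]]%N)
  | FII => pm (lincombs [:: [:: 1; 2; 3; 2]]%N)
  | FIII => pm (lincombs
      [:: [:: 1; 1; 1; 0]; [:: 0; 1; 2; 2]; [:: 1; 2; 3; 2];
          [:: 2; 3; 4; 2]]%N)
  | AII | EIV | Twice _ => set0
  end.

End RealRootTable.

(* Main.v *)
(* Let [tau] be the conjugation of the complexified algebra whose real form is the dual one,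
   in which [a_R] is split.  A root vector [u] fixed by [tau] spans an sl_2 together with
   [sigma u], because the Killing form takes a nonzero real value on these two vectors;
   sl_2 theory then gives the integrality and the reflections of the restricted roots.
   A root is real iff [theta] maps it to its opposite.  In the lexicographic order [- theta]
   preserves the positive roots that are not fixed by [theta], so modulo the black simple
   roots it acts on the white ones by a nonnegative integral matrix of square 1, which is a
   permutation [p].  Hence a root is real iff it is orthogonal to the black simple roots and
   its coefficients are constant along the arrows.
   The roots are determined by the Dynkin diagram: two sets of coefficient vectors that are
   stable under the simple reflections and contain the same multiples of simple roots are
   equal, by descent on the height.  So they are those of the standard model, described in
   the coordinates e_i for the classical types and by enumeration for the exceptional ones. *)

From HB Require Import structures.
Require Import Defs.
From mathcomp Require Import all_boot all_order all_algebra.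
From mathcomp Require Import complex.
From mathcomp Require Import all_classical all_reals.
From mathcomp Require Import zify ring lra.

Set Implicit Arguments.
Unset Strict Implicit.
Unset Printing Implicit Defensive.

Import Order.TTheory GRing.Theory Num.Theory.

Import passmx.

Local Open Scope ring_scope.
Local Open Scope classical_set_scope.

(** * Lie algebra with a nondegenerate Killing form and two commuting involutions *)

(** Restricted roots are defined by ad(A)^2 on q, which is not closed under the bracket. The work is
    therefore moved to weights of ad on the whole complexified algebra; sigma exchanges the weights
    alpha and -alpha, so the nonzero weights are exactly the restricted roots. Weight spaces may
    have any dimension, so reflections are obtained from sl_2 strings, and the coroot lies in a by
    maximality: it is negated by sigma and commutes with a. The diagram records only bond numbers
    and which root is longer. The Cartan integers are recovered from these data and from the fact
    that no root has coefficients of mixed sign. Descent asks that a nonzero nonnegative vector pair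
    positively with some simple root of its support; the given form supplies this, being positive on
    functionals real on a_R, so no Cartan matrix is tested for definiteness. The harder half of the
    criterion for real roots is sufficiency: -theta(x) - x then has only black coefficients and is
    orthogonal to every black simple root, hence vanishes by positivity. *)

Lemma linfunE (K : fieldType) (V W : vectType K) (f : V -> W) :
  linear f -> linfun f =1 f.
Proof.
move=> f_lin; exact: (lfunE (HB.pack_for {linear V -> W} f
  (GRing.isLinear.Build K V W *:%R f f_lin))).
Qed.

(** * Traces of endomorphisms *)

Section LinearTrace.
Variables (K : fieldType) (V : vectType K).
Implicit Types f g : 'End(V).

Definition lftrace f : K :=
  \sum_(i < \dim {:V}) coord (vbasis {:V}) i (f (vbasis {:V})`_i).

(** Any expansion with linear coefficients computes the trace, even a redundant one: expand both
    ways and exchange the sums. It allows the Killing form of the complexification to be computed on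
    a real basis. *)
Lemma lftraceE n (b : 'I_n -> V) (c : 'I_n -> {linear V -> K^o}) f :
  (forall v, v = \sum_i c i v *: b i) -> lftrace f = \sum_i c i (f (b i)).
Proof.
move=> bE; rewrite /lftrace.
transitivity (\sum_(i < \dim {:V}) \sum_j c j (f (vbasis {:V})`_i)
   * coord (vbasis {:V}) i (b j)).
  apply: eq_bigr => i _; rewrite {1}[f _]bE linear_sum /=.
  by apply: eq_bigr => j _; rewrite linearZ.
rewrite exchange_big /=; apply: eq_bigr => j _.
rewrite {2}(coord_vbasis (memvf (b j))) !linear_sum /=.
by apply: eq_bigr => i _; rewrite !linearZ /= mulrC.
Qed.

Lemma lftraceD f g : lftrace (f + g) = lftrace f + lftrace g.
Proof.
by rewrite -big_split; apply: eq_bigr => i _; rewrite add_lfunE linearD.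
Qed.

Lemma lftraceZ k f : lftrace (k *: f) = k * lftrace f.
Proof.
by rewrite mulr_sumr; apply: eq_bigr => i _; rewrite scale_lfunE linearZ.
Qed.

Lemma lftraceN f : lftrace (- f) = - lftrace f.
Proof. by rewrite -scaleN1r lftraceZ mulN1r. Qed.

Lemma lftraceC f g : lftrace (f \o g)%VF = lftrace (g \o f)%VF.
Proof.
have expand (h k : 'End(V)) : lftrace (h \o k)%VF = \sum_(i < \dim {:V}) \sum_(j < \dim {:V})
   coord (vbasis {:V}) j (k (vbasis {:V})`_i)
   * coord (vbasis {:V}) i (h (vbasis {:V})`_j).
  apply: eq_bigr => i _; rewrite comp_lfunE.
  rewrite {1}(coord_vbasis (memvf (k _))) !linear_sum /=.
  by apply: eq_bigr => j _; rewrite !linearZ.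
rewrite !expand exchange_big /=; apply: eq_bigr => i _; apply: eq_bigr => j _.
by rewrite mulrC.
Qed.

End LinearTrace.

(** * Identities for the bracket, ad, the Killing form and involutions *)

Section LieBasics.
Variables (K : fieldType) (g : lieAlgType K).
Implicit Types x y z : g.

HB.instance Definition _ x :=
  GRing.isLinear.Build K g g _ (@lie K g x) (@lie_linearr K g x).

Lemma lieDr x y z : lie x (y + z) = lie x y + lie x z.
Proof. exact: linearD. Qed.
Lemma lieNr x y : lie x (- y) = - lie x y.
Proof. exact: linearN. Qed.
Lemma lieBr x y z : lie x (y - z) = lie x y - lie x z.
Proof. exact: linearB. Qed.
Lemma lieZr x k y : lie x (k *: y) = k *: lie x y.
Proof. exact: linearZ. Qed.
Lemma lie0r x : lie x 0 = 0.
Proof. exact: linear0. Qed.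

Lemma lieDl x y z : lie (x + y) z = lie x z + lie y z.
Proof. by have := @lie_linearl K g z 1 x y; rewrite !scale1r. Qed.

Lemma lieC x y : lie x y = - lie y x.
Proof.
apply/eqP; rewrite -addr_eq0; apply/eqP.
by have := liexx (x + y); rewrite lieDl !lieDr !liexx add0r addr0.
Qed.

Lemma lieZl k x y : lie (k *: x) y = k *: lie x y.
Proof. by rewrite lieC lieZr -scalerN -lieC. Qed.
Lemma lieNl x y : lie (- x) y = - lie x y.
Proof. by rewrite lieC lieNr -lieC. Qed.
Lemma lie0l x : lie 0 x = 0.
Proof. by rewrite lieC lie0r oppr0. Qed.

Lemma lie_derivation x y z : lie x (lie y z) = lie (lie x y) z + lie y (lie x z).
Proof.
have := lie_jacobi x y z; rewrite [lie z (lie x y)]lieC [lie z x]lieC lieNr.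
by move/eqP; rewrite subr_eq0 => /eqP <-; rewrite addrNK.
Qed.

Definition ad x : 'End(g) := linfun (lie x).

Lemma adE x y : ad x y = lie x y.
Proof. by rewrite lfunE. Qed.

Lemma killingE x y : killing x y = lftrace (ad x \o ad y)%VF.
Proof. by apply: eq_bigr => i _; rewrite comp_lfunE !adE. Qed.

Lemma adD x y : ad (x + y) = ad x + ad y.
Proof. by apply/lfunP => z; rewrite add_lfunE !adE lieDl. Qed.
Lemma adZ k x : ad (k *: x) = k *: ad x.
Proof. by apply/lfunP => z; rewrite scale_lfunE !adE lieZl. Qed.
Lemma adN x : ad (- x) = - ad x.
Proof. by rewrite -scaleN1r adZ scaleN1r. Qed.

Lemma ad_lie x y : ad (lie x y) = ((ad x \o ad y) - (ad y \o ad x))%VF.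
Proof.
by apply/lfunP => z; rewrite add_lfunE opp_lfunE !comp_lfunE !adE lie_derivation addrK.
Qed.

Lemma ad_commute x y : lie x y = 0 -> (ad x \o ad y)%VF = (ad y \o ad x)%VF.
Proof.
move=> xy; apply/eqP; rewrite -subr_eq0 -ad_lie xy.
by apply/eqP/lfunP => z; rewrite adE zero_lfunE lie0l.
Qed.

Lemma killingC x y : killing x y = killing y x.
Proof. by rewrite !killingE lftraceC. Qed.
Lemma killingDl x y z : killing (x + y) z = killing x z + killing y z.
Proof. by rewrite !killingE adD comp_lfunDl lftraceD. Qed.
Lemma killingZl k x y : killing (k *: x) y = k * killing x y.
Proof. by rewrite !killingE adZ -comp_lfunZl lftraceZ. Qed.
Lemma killingNl x y : killing (- x) y = - killing x y.
Proof. by rewrite !killingE adN comp_lfunNl lftraceN. Qed.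
Lemma killingDr x y z : killing x (y + z) = killing x y + killing x z.
Proof. by rewrite killingC killingDl !(killingC x). Qed.
Lemma killingZr k x y : killing x (k *: y) = k * killing x y.
Proof. by rewrite killingC killingZl (killingC x). Qed.
Lemma killingNr x y : killing x (- y) = - killing x y.
Proof. by rewrite killingC killingNl (killingC x). Qed.
Lemma killing0l x : killing 0 x = 0.
Proof. by rewrite -(scale0r (0 : g)) killingZl mul0r. Qed.
Lemma killing0r x : killing x 0 = 0.
Proof. by rewrite killingC killing0l. Qed.

Lemma killing_invariant x y z : killing (lie x y) z = killing x (lie y z).
Proof.
rewrite !killingE !ad_lie comp_lfunDl comp_lfunDr !(comp_lfunNl, comp_lfunNr).
rewrite !lftraceD !lftraceN !comp_lfunA; congr (_ - _).
by rewrite -[in LHS]comp_lfunA lftraceC.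
Qed.

Section Involution.
Variable s : 'End(g).
Hypothesis s_inv : lie_involution s.

Lemma involK x : s (s x) = x.
Proof. by rewrite -comp_lfunE (proj1 s_inv) id_lfunE. Qed.

Lemma invol_lie x y : s (lie x y) = lie (s x) (s y).
Proof. exact: (proj2 s_inv). Qed.

Lemma killing_invol x y : killing (s x) (s y) = killing x y.
Proof.
have adS z : ad (s z) = (s \o ad z \o s)%VF.
  by apply/lfunP => w; rewrite !comp_lfunE !adE invol_lie involK.
rewrite !killingE !adS -!comp_lfunA lftraceC -!comp_lfunA.
by rewrite (proj1 s_inv) comp_lfun1r [(s \o (s \o _))%VF]comp_lfunA (proj1 s_inv)
  comp_lfun1l.
Qed.

Lemma mem_plus x : (x \in plus_space s) = (s x == x).
Proof. by apply/eqlfunP/eqP; rewrite id_lfunE. Qed.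

Lemma mem_minus x : (x \in minus_space s) = (s x == - x).
Proof. by rewrite memv_ker add_lfunE id_lfunE addr_eq0. Qed.

End Involution.
End LieBasics.

(** * Simultaneous diagonalization of commuting endomorphisms *)

Section Codiagonalization.
Variables (K : fieldType) (V : vectType K).

Lemma codiagonalizable_lfun m (F : 'I_m -> 'End(V)) :
  (forall i j, (F i \o F j)%VF = (F j \o F i)%VF) ->
  (forall i, exists2 b, basis_of fullv b &
     forall v, v \in b -> exists c, F i v = c *: v) ->
  exists2 b, basis_of fullv b &
    forall v, v \in b -> forall i, exists c, F i v = c *: v.
Proof.
move=> FC FD; pose e := vbasis {:V}; have eP : basis_of fullv e := vbasisP _.
pose As := [seq mxof e e (F i) | i <- enum 'I_m].
have AsC : {in As &, forall A B, comm_mx A B}.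
  by move=> _ _ /mapP[i _ ->] /mapP[j _ ->]; rewrite /comm_mx -!mxof_comp // FC.
have AsD : {in As, forall A, diagonalizable A}.
  move=> _ /mapP[k _ ->]; have [b bP bF] := FD k.
  apply/codiagonalizable1/codiagonalizablePfull.
  (* The rows of [P] are the coordinates of an eigenbasis of [F k], so [P] conjugates the matrix of
     [F k] to a diagonal one. *)
  pose P := \matrix_(i < size b) rVof e b`_i.
  have rowPE i : row i P = rVof e b`_i by rewrite rowK.
  have Pfull : row_full P.
    rewrite -sub1mx; apply/row_subP => i.
    rewrite -[row i _](vecofK eP).
    rewrite (coord_basis (X := in_tuple b) bP (memvf (vecof e (row i 1%:M)))).
    rewrite linear_sum /=; apply: summx_sub => j _.
    by rewrite linearZ /= scalemx_sub // -rowPE row_sub.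
  exists (size b); exists P; rewrite //= andbT; apply/diagonalizable_forPex.
  have bE (i : 'I_(size b)) : exists c, F k b`_i = c *: b`_i.
    by apply: bF; rewrite mem_nth.
  have [c cE] := choice bE.
  exists (\row_i c i); apply/simmxW.
    by rewrite /row_free (eqP Pfull) (size_basis (X := in_tuple b) bP).
  apply/row_matrixP => i; rewrite row_mul rowPE mul_mxof rVofK // cE linearZ.
  by rewrite row_mul row_diag_mx mxE -scalemxAl -rowE rowPE.
have [P Punit /allP/= PA] : codiagonalizable As by apply/codiagonalizableP.
exists [seq vecof e (row i P) | i <- enum 'I_(\dim {:V})].
  rewrite basisEdim size_map size_enum_ord leqnn andbT.
  apply/subvP => v _; rewrite -(rVofK eP v) -[rVof e v](mulmxKV Punit).
  rewrite mulmx_sum_row linear_sum /=; apply: memv_suml => i _.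
  rewrite linearZ memvZ // memv_span //.
  by apply/mapP; exists i; rewrite ?mem_enum.
move=> _ /mapP[i _ ->] k.
have /PA/diagonalizable_forPex[D /(simmxP Punit)/(congr1 (row i))] :
  mxof e e (F k) \in As by apply: map_f; rewrite mem_enum.
rewrite !row_mul mul_mxof row_diag_mx -scalemxAl -rowE => PfE.
by exists (D 0 i); apply: (can_inj (rVofK eP)); rewrite PfE linearZ /= vecofK.
Qed.

End Codiagonalization.

(** * Killing form of the complexification *)

Section ComplexKilling.
Variables (R : rcfType) (g : lieAlgType R).

Lemma cplx_lieE (z w : cplx g) :
  lie z w = (lie z.1 w.1 - lie z.2 w.2, lie z.1 w.2 + lie z.2 w.1).
Proof. by []. Qed.

Lemma cplx_scaleE (c : R[i]) (z : cplx g) :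
  c *: z = (complex.Re c *: z.1 - complex.Im c *: z.2,
            complex.Re c *: z.2 + complex.Im c *: z.1).
Proof. by []. Qed.

(** A real basis of g is also a complex basis of the complexification, so both traces are taken on
    the same vectors and the Killing form is the complex bilinear extension of the real one. *)
Lemma cplx_killing (z w : cplx g) :
  killing z w = ((killing z.1 w.1 - killing z.2 w.2)
                 +i* (killing z.1 w.2 + killing z.2 w.1))%C.
Proof.
pose b := vbasis {:g}.
pose c i (u : cplx g) : R[i]^o := (coord b i u.1 +i* coord b i u.2)%C.
have c_linear i : linear (c i).
  move=> [k1 k2] [x y] [x' y']; apply/eqP; rewrite eq_complex /c /=.
  by rewrite !linearD !linearN /= !linearZ /= !eqxx.
pose cl i := HB.pack_for {linear cplx g -> R[i]^o} (c i)
  (GRing.isLinear.Build R[i] (cplx g) R[i]^o *:%R (c i) (c_linear i)).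
rewrite killingE (@lftraceE _ _ _ (fun i => to_cplx b`_i) cl); last first.
  move=> [x y]; rewrite /cl /= /c /=.
  have sumE n (F : 'I_n -> cplx g) :
    \sum_i F i = (\sum_i (F i).1, \sum_i (F i).2).
    by elim/big_rec3: _ => // i s a b' _ ->.
  rewrite sumE; congr pair; rewrite [LHS](coord_vbasis (memvf _));
    by apply: eq_bigr => i _ /=; rewrite scaler0 (subr0, add0r).
have ReIm (u : R[i]) : u = (complex.Re u +i* complex.Im u)%C by case: u.
rewrite [LHS]ReIm; congr (_ +i* _)%C.
  rewrite (raddf_sum (@complex.Re R)) -sumrB; apply: eq_bigr => i _ /=.
  by rewrite comp_lfunE !adE !cplx_lieE /= !lie0r subr0 add0r linearB.
rewrite (raddf_sum (@complex.Im R)) -big_split; apply: eq_bigr => i _ /=.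
by rewrite comp_lfunE !adE !cplx_lieE /= !lie0r subr0 add0r linearD.
Qed.

End ComplexKilling.

(** * Weight strings of sl_2 *)

Section Sl2.
Variables (K : numFieldType) (L : lieAlgType K).

(** In characteristic 0 an arithmetic progression with nonzero step has distinct terms, so it leaves
    every finite list. This is what makes weight strings break off. *)
Lemma finite_orbit (s : seq K) (c d : K) (P : pred nat) :
  d != 0 -> (forall k, P k -> c + d *+ k \in s) -> exists k, ~~ P k.
Proof.
move=> d0 Ps; apply: contrapT => /forallNP P'.
have {P'}PT k : P k by apply: contrapT => /negP; exact: P'.
pose t := [seq c + d *+ k | k <- iota 0 (size s).+1].
have tU : uniq t.
  rewrite map_inj_uniq ?iota_uniq // => i j /addrI /eqP.
  rewrite -[d *+ i]mulr_natr -[d *+ j]mulr_natr -subr_eq0 -mulrBr mulf_eq0 (negPf d0) subr_eq0 eqr_nat.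
  by move/eqP.
have /(uniq_leq_size tU) : {subset t <= s} by move=> _ /mapP[k _ ->]; apply/Ps/PT.
by rewrite size_map size_iota ltnn.
Qed.

Variables (e f h : L) (s : seq K).
Hypothesis eigenvalue_h : forall c v, v != 0 -> lie h v = c *: v -> c \in s.

Lemma iter_weight (x : L) (d c : K) (v : L) k :
  lie h x = d *: x -> lie h v = c *: v ->
  lie h (iter k (lie x) v) = (c + d *+ k) *: iter k (lie x) v.
Proof.
move=> hx hv; elim: k => [|k IHk]; first by rewrite mulr0n addr0.
rewrite [iter k.+1 _ _]iterS lie_derivation hx IHk lieZl lieZr -scalerDl.
by congr (_ *: _); rewrite mulrS addrCA.
Qed.

Lemma iter_last (x : L) (d c : K) (v : L) :
  d != 0 -> lie h x = d *: x -> lie h v = c *: v -> v != 0 ->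
  exists2 k, (forall j, (j <= k)%N -> iter j (lie x) v != 0)
           & iter k.+1 (lie x) v = 0.
Proof.
move=> d0 hx hv v0.
have [k] : exists k, ~~ (iter k (lie x) v != 0).
  apply: (@finite_orbit s c d) => // k /eigenvalue_h; apply.
  exact: iter_weight.
rewrite negbK => kP; have ex : exists k, iter k (lie x) v == 0 by exists k.
case: (ex_minnP ex) => -[/= /eqP|n /= n0 nmin]; first by move/eqP: v0.
exists n; last exact/eqP.
by move=> j jn; apply/negP => /nmin; rewrite ltnNge jn.
Qed.

Hypotheses (hE : lie e f = h) (hef : lie h e = 2 *: e) (hff : lie h f = - 2 *: f).

(** Raise [v] as long as possible to a top vector w = e^k v, of weight c + 2k, and let f^m w be the
    last nonzero lowering. The identity e f^(j+1) w = (j+1)(c + 2k - j) f^j w at j = m forces c + 2k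
    = m. *)
Lemma sl2_lowering (v : L) (c : K) : v != 0 -> lie h v = c *: v ->
  exists k m : nat, c = m%:R - 2 * k%:R /\
    (forall j, (j <= m)%N -> iter j (lie f) (iter k (lie e) v) != 0).
Proof.
move=> v0 hv; have two0 : (2 : K) != 0 by rewrite pnatr_eq0.
have [k kP kE] := iter_last two0 hef hv v0.
set w := iter k (lie e) v in kP *.
have w0 : w != 0 by apply: kP.
have hw := iter_weight k hef hv; rewrite -/w in hw.
have ntwo0 : - (2 : K) != 0 by rewrite oppr_eq0.
have [m mP mE] := iter_last ntwo0 hff hw w0.
have ef j : lie e (iter j.+1 (lie f) w)
    = (j.+1%:R * (c + 2 *+ k - j%:R)) *: iter j (lie f) w.
  elim: j => [|j IHj].
    by rewrite /= lie_derivation hE hw /w -iterS kE lie0r addr0 mul1r subr0.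
  rewrite iterS lie_derivation hE IHj (iter_weight _ hff hw) lieZr -scalerDl.
  by congr (_ *: _); ring.
exists k, m; split=> //.
have /eqP := ef m; rewrite mE lie0r eq_sym scaler_eq0 (negPf (mP m _)) // orbF.
rewrite mulf_eq0 pnatr_eq0 /= subr_eq0 => /eqP <-.
by rewrite mulr_natr addrK.
Qed.
End Sl2.

Lemma sl2_reflection (K : numFieldType) (L : lieAlgType K) (e f h : L) (s : seq K)
    (v : L) (c : K) :
  (forall c v, v != 0 -> lie h v = c *: v -> c \in s) ->
  lie e f = h -> lie h e = 2 *: e -> lie h f = - 2 *: f ->
  v != 0 -> lie h v = c *: v ->
  exists2 m : int, c = m%:~R & exists i j : nat, i%:Z - j%:Z = - m /\
    (iter i (lie e) (iter j (lie f) v) != 0 \/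
     iter j (lie f) (iter i (lie e) v) != 0).
Proof.
move=> hs hE he hf v0 hv.
have [k [m [cE nz]]] := sl2_lowering hs hE he hf v0 hv.
exists (m%:Z - 2 * k%:Z); first by rewrite cE rmorphB rmorphM.
(* If k <= m, going up to the top and then down m - k times shifts the weight by twice -(m - 2k),
   and none of these vectors vanishes. *)
have [km|mk] := leqP k m.
  by exists k, (m - k)%N; split; [lia|right; apply: nz; lia].
(* Here c = m - 2k is negative. For the mirror triple (f, e, -h) the weight of [v] is positive, so
   m' > 2k' and the subtraction m' - k' does not truncate. *)
have hs' c' v' : v' != 0 -> lie (- h) v' = c' *: v' -> c' \in [seq - x | x <- s].
  move=> v'0; rewrite lieNl => /eqP; rewrite eqr_oppLR -scaleNr => /eqP.
  by move=> /(hs _ _ v'0) /(map_f -%R); rewrite opprK.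
have hE' : lie f e = - h by rewrite lieC hE.
have hf' : lie (- h) f = 2 *: f by rewrite lieNl hf scaleNr opprK.
have he' : lie (- h) e = - 2 *: e by rewrite lieNl he scaleNr.
have hv' : lie (- h) v = - c *: v by rewrite lieNl hv scaleNr.
have [k' [m' [cE' nz']]] := sl2_lowering hs' hE' hf' he' v0 hv'.
have E : (m'%:Z - 2 * k'%:Z) = - (m%:Z - 2 * k%:Z).
  apply: (@intr_inj K); rewrite rmorphN !rmorphB !rmorphM /=.
  by rewrite -[RHS]/(- (m%:R - 2 * k%:R)) -cE cE'.
exists (m' - k')%N, k'; split; first by lia.
by left; apply: nz'; lia.
Qed.

Section ComplexifiedPair.
Variables (R : realType) (g : lieAlgType R).
Implicit Types (f : 'End(g)) (z w : cplx g).

Lemma cplx_map_linear (V W : vectType R) (h : {linear V -> W}) :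
  linear (@cplx_map R V W h).
Proof.
move=> [c1 c2] [x y] [x' y']; rewrite /cplx_map /=; congr pair => /=.
  by rewrite linearD linearB !linearZ.
by rewrite !linearD !linearZ.
Qed.

HB.instance Definition _ (V W : vectType R) (h : {linear V -> W}) :=
  GRing.isLinear.Build R[i] (cplx V) (cplx W) _ (@cplx_map R V W h)
    (cplx_map_linear h).

Definition cplx_end f : 'End(cplx g) := linfun (cplx_map f).

Lemma cplx_endE f z : cplx_end f z = (f z.1, f z.2).
Proof. by rewrite lfunE. Qed.

Lemma cplx_end_invol f : lie_involution f -> lie_involution (cplx_end f).
Proof.
move=> fP; split=> [|z w].
  apply/lfunP => z; rewrite comp_lfunE id_lfunE !cplx_endE !involK //.
  by case: z.
rewrite !cplx_endE !cplx_lieE /= (linearB f) (linearD f) /=.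
by rewrite !(invol_lie fP).
Qed.

Lemma to_cplxD (V : vectType R) (x y : V) : to_cplx (x + y) = to_cplx x + to_cplx y.
Proof. by rewrite /to_cplx; congr pair; rewrite /= addr0. Qed.

Lemma to_cplxZ (V : vectType R) (k : R) (x : V) :
  to_cplx (k *: x) = (k%:C)%C *: to_cplx x.
Proof. by rewrite /to_cplx; congr pair; rewrite /= !(scaler0, scale0r, subr0, addr0). Qed.

Lemma to_cplxN (V : vectType R) (x : V) : to_cplx (- x) = - to_cplx x.
Proof. by rewrite /to_cplx; congr pair; rewrite /= oppr0. Qed.

Lemma cplx_split (V : vectType R) (z : cplx V) :
  z = to_cplx z.1 + ('i)%C *: to_cplx z.2.
Proof.
case: z => x y; congr pair => /=.
  by rewrite scale0r scaler0 subr0 addr0.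
by rewrite scaler0 scale1r !add0r.
Qed.

Lemma lie_to_cplx (x y : g) : lie (to_cplx x) (to_cplx y) = to_cplx (lie x y).
Proof. by rewrite cplx_lieE /= !(lie0r, lie0l, subr0, addr0). Qed.

End ComplexifiedPair.

(** * Weights of a Cartan subspace, and restricted roots as a root system *)

Section CartanSubspace.
Variables (R : realType) (g : lieAlgType R) (sigma theta : 'End(g)).
Variable a : {vspace g}.
Hypothesis sigma_inv : lie_involution sigma.
Hypothesis theta_cartan : cartan_involution theta.
Hypothesis sigma_theta : (sigma \o theta)%VF = (theta \o sigma)%VF.
Hypothesis a_cartan : cartan_subspace sigma a.
Hypothesis theta_a : (theta @: a)%VS = a.

Local Notation C := (R[i]).
Local Notation dual := (cplx_dual R a).
Local Notation aC := (cplx (subvs_of a)).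
Local Notation incl := (@cplx_incl R g a).
Local Notation Roots := (restricted_roots sigma a).
Local Notation form := (@dual_killing R g a).
Implicit Types (x y : g) (X Y : subvs_of a) (A : aC) (z v : cplx g).
Implicit Types (alpha beta lambda : dual).

Let theta_inv : lie_involution theta := proj1 theta_cartan.

Let inner x y := - killing x (theta y).

Let innerC x y : inner x y = inner y x.
Proof. by rewrite /inner killingC -(killing_invol theta_inv) involK. Qed.

Let inner_gt0 x : x != 0 -> 0 < inner x x.
Proof. exact: (proj2 theta_cartan). Qed.

Let inner_ge0 x : 0 <= inner x x.
Proof.
have [->|/inner_gt0/ltW//] := eqVneq x 0.
by rewrite /inner killing0l oppr0.
Qed.

Let innerDl x y w : inner (x + y) w = inner x w + inner y w.
Proof. by rewrite /inner killingDl opprD. Qed.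
Let innerZl k x y : inner (k *: x) y = k * inner x y.
Proof. by rewrite /inner killingZl mulrN. Qed.
Let innerNl x y : inner (- x) y = - inner x y.
Proof. by rewrite /inner killingNl. Qed.
Let inner_ad x y w : inner (lie x y) w = - inner y (lie (theta x) w).
Proof.
rewrite /inner (invol_lie theta_inv) involK // opprK.
by rewrite lieC killingNl killing_invariant opprK.
Qed.

Let inner_eq0 x y : inner x x + inner y y = 0 -> x = 0 /\ y = 0.
Proof.
move=> xy0; split; apply: contrapT => /eqP /inner_gt0 h.
  by have := inner_ge0 y; lra.
by have := inner_ge0 x; lra.
Qed.

Let a_abelian x y : x \in a -> y \in a -> lie x y = 0.
Proof. by case: a_cartan => -[_ aA _] _; exact: aA. Qed.

Let a_minus x : x \in a -> sigma x = - x.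
Proof.
case: a_cartan => -[/subvP aS _ _] _ /aS.
by rewrite mem_minus => /eqP.
Qed.

Let a_theta x : x \in a -> theta x \in a.
Proof. by move=> xa; rewrite -theta_a memv_img. Qed.

Let a_maximal x : sigma x = - x -> (forall y, y \in a -> lie y x = 0) -> x \in a.
Proof.
move=> sx xC; have [[aS aA amax] _] := a_cartan.
suff <- : (a + <[x]>)%VS = a by rewrite memvE addvSr.
apply: amax; first exact: addvSl.
  by rewrite subv_add aS -memvE mem_minus sx eqxx.
move=> _ _ /memv_addP[y ya [_ /vlineP[k ->] ->]] /memv_addP[w wa [_ /vlineP[l ->] ->]].
rewrite lieDl !lieDr !lieZl !lieZr liexx a_abelian // xC // lieC xC //.
by rewrite oppr0 !scaler0 !addr0.
Qed.

Definition th X : subvs_of a := vsproj a (theta (vsval X)).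

Lemma vsval_th X : vsval (th X) = theta (vsval X).
Proof. by rewrite vsprojK // a_theta // subvsP. Qed.

Lemma thK X : th (th X) = X.
Proof. by apply: subvs_inj; rewrite !vsval_th involK. Qed.

Lemma th_linear : linear th.
Proof. by move=> k X Y; rewrite /th !linearP. Qed.

HB.instance Definition _ := GRing.isLinear.Build R (subvs_of a) (subvs_of a) _ th
  th_linear.

Let inclE A : incl A = (vsval A.1, vsval A.2).
Proof. by []. Qed.

Lemma incl_linear : linear incl.
Proof. exact: cplx_map_linear. Qed.

HB.instance Definition _ := GRing.isLinear.Build C aC (cplx g) _ incl incl_linear.

Lemma dual_split alpha A : alpha A = alpha (to_cplx A.1) + 'i%C * alpha (to_cplx A.2).
Proof. by rewrite {1}(cplx_split A) linearD linearZ. Qed.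

Lemma dual_eq alpha beta :
  (forall X, alpha (to_cplx X) = beta (to_cplx X)) -> alpha = beta.
Proof. by move=> ab; apply/lfunP => A; rewrite [LHS]dual_split [RHS]dual_split !ab. Qed.

Lemma theta_actE alpha A : theta_act theta alpha A = alpha (cplx_map th A).
Proof.
rewrite /theta_act -/th linfunE // => k B D.
by rewrite cplx_map_linear linearP.
Qed.

Lemma incl_to_cplx X : incl (to_cplx X) = to_cplx (vsval X).
Proof. by rewrite inclE. Qed.

(** Weight vectors for ad on all of the complexified algebra, not only on its q-part: unlike the
    eigenvectors of ad^2 they can be multiplied by the bracket. *)
Definition root_vector alpha v : Prop := forall A, lie (incl A) v = alpha A *: v.

Lemma root_vectorP alpha v :
  (forall X, lie (to_cplx (vsval X)) v = alpha (to_cplx X) *: v) ->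
  root_vector alpha v.
Proof.
move=> av A; rewrite [alpha A]dual_split {1}(cplx_split A).
rewrite linearD linearZ /= !incl_to_cplx lieDl lieZl !av scalerDl.
by rewrite scalerA.
Qed.

Lemma root_vector_parts alpha v X (c := alpha (to_cplx X)) : root_vector alpha v ->
  lie (vsval X) v.1 = complex.Re c *: v.1 - complex.Im c *: v.2 /\
  lie (vsval X) v.2 = complex.Re c *: v.2 + complex.Im c *: v.1.
Proof.
move=> /(_ (to_cplx X)); rewrite incl_to_cplx cplx_lieE cplx_scaleE /=.
by rewrite !lie0l subr0 addr0 => -[-> ->].
Qed.

(** The operators ad x for x in a basis of a commute and are diagonalizable over the complex
    numbers, so they share an eigenbasis. *)
Lemma weight_basis : exists2 b : seq (cplx g), basis_of fullv b &
  forall v, v \in b -> exists alpha, root_vector alpha v.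
Proof.
have a_i (i : 'I_(\dim a)) : (vbasis a)`_i \in a.
  by apply: vbasis_mem; rewrite mem_nth ?size_tuple.
pose F (i : 'I_(\dim a)) : 'End(cplx g) := ad (to_cplx (vbasis a)`_i).
have [i j|i|b bP bF] := @codiagonalizable_lfun _ _ _ F.
- by apply: ad_commute; rewrite lie_to_cplx a_abelian.
- have [b bP bx] := proj2 a_cartan _ (a_i i).
  by exists b => // v /bx[c cE]; exists c; rewrite adE.
exists b => // v vb; have v0 := basis_not0 bP vb.
have ex X : exists c : C, lie (to_cplx (vsval X)) v = c *: v.
  have /choice[c cE] := bF v vb.
  rewrite (coord_vbasis (subvsP X)).
  exists (\sum_i ((coord (vbasis a) i (vsval X))%:C)%C * c i).
  rewrite scaler_suml; elim/big_rec2: _ => [|i y z _ <-]; first by rewrite lie0l.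
  by rewrite to_cplxD lieDl to_cplxZ lieZl -adE cE scalerA.
pose i := Ordinal (etrans (index_mem v b) vb).
(* [phi] is the coordinate along [v]. The eigenvalue at A is phi([A, v]), which makes the weight
   linear in A by construction. *)
pose phi : 'Hom(cplx g, C^o) := linfun (coord (in_tuple b) i : {linear cplx g -> C^o}).
have phiv : phi v = 1.
  rewrite lfunE /=; have -> : v = (in_tuple b)`_i by rewrite /= nth_index.
  by rewrite coord_free ?eqxx // (basis_free bP).
exists (phi \o (- ad v) \o linfun incl)%VF; apply: root_vectorP => X.
have inclf A : linfun incl A = incl A by rewrite lfunE.
have [c cE] := ex X; rewrite !comp_lfunE opp_lfunE inclf adE -lieC.
by rewrite incl_to_cplx cE linearZ /= phiv [_ *: (1 : C^o)]mulr1.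
Qed.

Lemma weight_decomposition : exists n (b : 'I_n -> cplx g) (w : 'I_n -> dual),
  [/\ forall i, b i != 0, forall i, root_vector (w i) (b i),
      forall z, exists c, z = \sum_i c i *: b i &
      forall c, \sum_i c i *: b i = 0 -> forall i, c i = 0].
Proof.
have [b bP bw] := weight_basis.
have /choice[w wP] : forall i : 'I_(size b), exists alpha, root_vector alpha b`_i.
  by move=> i; apply: bw; exact: mem_nth.
exists (size b), (fun i => b`_i), w; split=> // [i|z|].
- by rewrite (basis_not0 bP) // mem_nth.
- exists (fun i => coord (in_tuple b) i z).
  by rewrite {1}(coord_basis (X := in_tuple b) bP (memvf z)).
- exact: (elimT (@freeP _ _ _ (in_tuple b)) (basis_free bP)).
Qed.

(** This says alpha(theta X) = - conj(alpha(X)): real values on the p-part of a and imaginary ones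
    on the k-part, that is, real values on a_R, without decomposing X. *)
Definition aR_real alpha : Prop := forall X,
  complex.Re (alpha (to_cplx (th X))) = - complex.Re (alpha (to_cplx X)) /\
  complex.Im (alpha (to_cplx (th X))) = complex.Im (alpha (to_cplx X)).

(** For the inner product -K(x, theta y) the adjoint of ad X is -ad(theta X). A common eigenvector
    of both therefore has conjugate eigenvalues up to sign. *)
Lemma root_vector_aR_real alpha v : v != 0 -> root_vector alpha v -> aR_real alpha.
Proof.
move=> v0 av X; set c := alpha (to_cplx X); set d := alpha (to_cplx (th X)).
have [x1 x2] := root_vector_parts X av.
have [] := root_vector_parts (th X) av; rewrite vsval_th -/c -/d => t1 t2.
have E (i j : g) : inner (lie (vsval X) i) j = - inner (lie (theta (vsval X)) j) i.
  by rewrite inner_ad innerC.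
(* Sums and differences of these four identities give the real and imaginary parts of the claim,
   multiplied by the squared norm p + q of [v]. *)
have := (E v.1 v.1, E v.2 v.2, E v.1 v.2, E v.2 v.1) => -[[[]]].
rewrite x1 x2 t1 t2 -/c -/d !(innerDl, innerNl, innerZl) (innerC v.2 v.1).
set p := inner v.1 v.1; set q := inner v.2 v.2; set s := inner v.1 v.2.
move=> e1 e2 e3 e4.
have N0 : p + q != 0.
  apply/eqP => /inner_eq0[v1 v2]; move/eqP: v0; apply.
  by case: v {av x1 x2 t1 t2 p q s e1 e2 e3 e4} v1 v2 => y z /= -> ->.
split; apply: (mulIf N0).
  have -> : complex.Re d * (p + q) = complex.Re d * p + complex.Re d * q by ring.
  lra.
have -> : complex.Im d * (p + q) = complex.Im d * p + complex.Im d * q by ring.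
lra.
Qed.

Lemma root_vector_sigma alpha v :
  root_vector alpha v -> root_vector (- alpha) (cplx_end sigma v).
Proof.
move=> av A; have sI := cplx_end_invol sigma_inv.
have -> : incl A = cplx_end sigma (- incl A).
  rewrite cplx_endE inclE /=; congr pair;
    by rewrite linearN /= a_minus ?subvsP ?opprK.
by rewrite -(invol_lie sI) lieNl av opp_lfunE scaleNr -!scaleNr linearZ.
Qed.

Lemma root_vector_theta alpha v :
  root_vector alpha v -> root_vector (theta_act theta alpha) (cplx_end theta v).
Proof.
move=> av A; have tI := cplx_end_invol theta_inv.
have -> : incl A = cplx_end theta (incl (cplx_map th A)).
  by rewrite cplx_endE !inclE /= !vsval_th !involK.
by rewrite -(invol_lie tI) av theta_actE linearZ.
Qed.

Let eqNr0 (c : C) : - c = c -> c = 0.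
Proof. by move/esym/eqP; rewrite -addr_eq0 -mulr2n mulrn_eq0 => /eqP. Qed.

(** A vector space is not the union of two proper subspaces: if A excludes one sign and B the other,
    then A + B gives a contradiction. *)
Lemma dual_sqr_eq alpha beta :
  (forall A, beta A ^+ 2 = alpha A ^+ 2) -> beta = alpha \/ beta = - alpha.
Proof.
move=> sq; apply: contrapT => /not_orP[ne nne].
have [A Ane] : exists A, beta A != alpha A by apply/lfunPn/eqP.
have [B Bne] : exists B, beta B != (- alpha) B by apply/lfunPn/eqP.
rewrite opp_lfunE in Bne.
have /eqP := sq A; rewrite eqf_sqr (negPf Ane) /= => /eqP bA.
have /eqP := sq B; rewrite eqf_sqr (negPf Bne) orbF => /eqP bB.
have /eqP := sq (A + B); rewrite eqf_sqr !linearD /= bA bB => /orP[] /eqP E.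
  have aA : alpha A = 0 by apply: eqNr0; apply: addIr E.
  by rewrite bA aA oppr0 eqxx in Ane.
have aB : alpha B = 0.
  by apply: eqNr0; move: E; rewrite ?opprD => /addrI.
by rewrite bB aB oppr0 eqxx in Bne.
Qed.

(** A vector of q with ad(A)^2 = alpha(A)^2 has a component of weight alpha or -alpha, and sigma
    corrects the sign. Conversely a weight vector v gives v - sigma(v) in q. *)
Lemma restricted_rootsP alpha :
  Roots alpha <-> alpha != 0 /\ exists2 v, v != 0 & root_vector alpha v.
Proof.
split=> [[a0 [Y Y0 [_ _ YE]]]|[a0 [v v0 av]]]; split=> //.
  have [n [b [w [b0 bw bgen bfree]]]] := weight_decomposition.
  have [c cE] := bgen Y.
  have [j cj] : exists j, c j != 0.
    apply: contrapT => /forallNP c0; move/eqP: Y0; apply.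
    rewrite cE big1 // => j _; have := c0 j.
    by move/negP; rewrite negbK => /eqP ->; rewrite scale0r.
  have lieE A z c' : z = \sum_i c' i *: b i ->
      lie (incl A) z = \sum_i (c' i * w i A) *: b i.
    move=> ->; rewrite linear_sum; apply: eq_bigr => i _ /=.
    by rewrite lieZr bw scalerA.
  have [wE|wE] : w j = alpha \/ w j = - alpha.
    apply: dual_sqr_eq => A; apply/eqP; rewrite -subr_eq0; apply/eqP.
    apply: (mulfI cj); rewrite mulr0.
    apply: (bfree (fun i => c i * (w i A ^+ 2 - alpha A ^+ 2))).
    have := YE A; rewrite (lieE A _ _ (lieE A _ _ cE)) cE scaler_sumr.
    move/eqP; rewrite -subr_eq0 -sumrB => /eqP E; rewrite -[RHS]E; apply: eq_bigr => i _.
    by rewrite scalerA -scalerBl; congr (_ *: _); ring.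
  - by exists (b j); rewrite // -wE.
  - exists (cplx_end sigma (b j)).
      apply: contraNneq (b0 j) => sb0.
      by rewrite -(involK (cplx_end_invol sigma_inv) (b j)) sb0 linear0.
    by rewrite -[alpha]opprK -wE; apply: root_vector_sigma.
have sI := cplx_end_invol sigma_inv.
have sv := root_vector_sigma av.
(* It is nonzero because sigma(v) has weight -alpha, which differs from alpha. *)
exists (v - cplx_end sigma v).
  apply: contraNneq a0 => /eqP; rewrite subr_eq0 => /eqP vE.
  apply/eqP/lfunP => A; rewrite zero_lfunE.
  have := sv A; rewrite -vE av => /eqP; rewrite -subr_eq0 -scalerBl scaler_eq0.
  by rewrite (negPf v0) orbF opp_lfunE opprK -mulr2n mulrn_eq0 => /eqP.
split=> [||A]; rewrite ?mem_minus.
- by rewrite cplx_endE /= linearB /= involK // opprB.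
- by rewrite cplx_endE /= linearB /= involK // opprB.
rewrite !lieBr av sv !lieZr av sv opp_lfunE.
by rewrite !scalerA scalerBr mulrN mulNr opprK expr2.
Qed.

Lemma root_vectors_finite : exists s : seq dual,
  forall alpha v, v != 0 -> root_vector alpha v -> alpha \in s.
Proof.
have [n [b [w [b0 bw bgen bfree]]]] := weight_decomposition.
exists [seq w i | i <- enum 'I_n] => alpha v v0 av.
have [c cE] := bgen v.
have [j cj] : exists j, c j != 0.
  apply: contrapT => /forallNP c0; move/eqP: v0; apply.
  rewrite cE big1 // => j _; have := c0 j.
  by move/negP; rewrite negbK => /eqP ->; rewrite scale0r.
apply/mapP; exists j; rewrite ?mem_enum //; apply/lfunP => A.
apply/eqP; rewrite -subr_eq0; apply/eqP; apply: (mulfI cj); rewrite mulr0.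
apply: (bfree (fun i => c i * (alpha A - w i A))).
have := av A; rewrite cE linear_sum scaler_sumr /= => /eqP.
rewrite -subr_eq0 -sumrB => /eqP E; apply/eqP; rewrite -oppr_eq0 -sumrN.
apply/eqP; rewrite -[RHS]E; apply: eq_bigr => i _; rewrite lieZr bw !scalerA -scalerBl -scaleNr.
by congr (_ *: _); ring.
Qed.

Lemma restricted_roots_finite : exists s : seq dual, forall alpha, Roots alpha -> alpha \in s.
Proof.
have [s sP] := root_vectors_finite.
by exists s => alpha /restricted_rootsP[_ [v v0 av]]; apply: sP v0 av.
Qed.

(** Since theta preserves a, each part of A can be tested against its own image under theta, where
    the Killing form is definite. *)
Lemma killing_incl_eq0 A : (forall B, killing (incl A) (incl B) = 0) -> A = 0.
Proof.
move=> A0.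
have kz x : x \in a -> killing x (theta x) = 0 -> x = 0.
  move=> xa /eqP xx; apply: contrapT => /eqP /inner_gt0.
  by rewrite /inner (eqP xx) oppr0 ltxx.
have val0 X : killing (vsval X) (vsval (th X)) = 0 -> X = 0.
  rewrite vsval_th => /(kz _ (subvsP X)) X0; apply: subvs_inj.
  by rewrite X0 linear0.
have E X : killing (vsval A.1) (vsval X) = 0 /\ killing (vsval A.2) (vsval X) = 0.
  have := A0 (to_cplx X); rewrite incl_to_cplx cplx_killing !inclE /=.
  by rewrite !killing0r subr0 add0r => -[-> ->].
have A1 := val0 _ (proj1 (E (th A.1))).
have A2 := val0 _ (proj2 (E (th A.2))).
by case: A A1 A2 {A0 E} => A1 A2 /= -> ->.
Qed.

(** If all roots vanish at A then ad A = 0, so A is orthogonal to a for the Killing form. *)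
Lemma restricted_roots_separate A : (forall alpha, Roots alpha -> alpha A = 0) -> A = 0.
Proof.
move=> A0; have [n [b [w [b0 bw bgen _]]]] := weight_decomposition.
have w0 i : w i A = 0.
  have [->|wi0] := eqVneq (w i) 0; first by rewrite zero_lfunE.
  by apply/A0/restricted_rootsP; split=> //; exists (b i).
have adA : ad (incl A) = 0.
  apply/lfunP => z; rewrite adE zero_lfunE; have [c ->] := bgen z.
  by rewrite linear_sum big1 // => i _ /=; rewrite lieZr bw w0 scale0r scaler0.
apply: killing_incl_eq0 => B; rewrite killingE adA comp_lfun0l.
by rewrite -(scale0r (0 : 'End(cplx g))) lftraceZ mul0r.
Qed.

Lemma killing_flatE A B : killing_flat A B = killing (incl A) (incl B).
Proof.
have lin : linear (fun B => killing (incl A) (incl B) : C^o).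
  by move=> k B1 B2; rewrite linearP killingDr killingZr.
by rewrite linfunE.
Qed.

Lemma killing_flat_linear : linear (@killing_flat R g a).
Proof.
move=> k A B; apply/lfunP => D.
rewrite add_lfunE scale_lfunE !killing_flatE linearP.
by rewrite killingDl killingZl.
Qed.

(** The inverse in [riesz] is a right inverse only on the image. The map [killing_flat] is injective
    by nondegeneracy, hence onto, as both spaces have the same dimension. *)
Lemma rieszP alpha B : killing (incl (riesz alpha)) (incl B) = alpha B.
Proof.
rewrite /riesz; set F := linfun _.
have FE A : F A = killing_flat A by exact: linfunE killing_flat_linear A.
have kerF : lker F == 0%VS.
  apply/lker0P => A A' /eqP; rewrite -subr_eq0 -linearB => /eqP FAA.
  apply/eqP; rewrite -subr_eq0; apply/eqP/killing_incl_eq0 => D.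
  by rewrite -killing_flatE -FE FAA zero_lfunE.
have limF : limg F = fullv.
  apply/eqP; rewrite eqEdim subvf limg_dim_eq ?(eqP kerF) ?capv0 //.
  by rewrite !dimvf /=; apply: eq_leq; rewrite -[RHS]muln1.
have := limg_lfunVK (f := F) (x := alpha); rewrite limF => /(_ (memvf _)).
by move=> /lfunP/(_ B); rewrite FE killing_flatE.
Qed.

Lemma riesz_unique alpha A :
  (forall B, killing (incl A) (incl B) = alpha B) -> riesz alpha = A.
Proof.
move=> AE; apply/eqP; rewrite -subr_eq0; apply/eqP/killing_incl_eq0 => B.
by rewrite linearB killingDl killingNl rieszP AE subrr.
Qed.

Lemma formC alpha beta : form alpha beta = form beta alpha.
Proof. by rewrite /dual_killing -!rieszP killingC. Qed.
Lemma formDr alpha beta lambda : form alpha (beta + lambda) = form alpha beta + form alpha lambda.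
Proof. by rewrite /dual_killing add_lfunE. Qed.
Lemma formZr k alpha beta : form alpha (k *: beta) = k * form alpha beta.
Proof. by rewrite /dual_killing scale_lfunE. Qed.
Let killing_theta x y : killing x (theta y) = killing (theta x) y.
Proof. by rewrite -(killing_invol theta_inv) involK. Qed.

(** The vector H representing [alpha] lies in a_R: its real part is in p and its imaginary part in
    k. There the complex Killing form is a sum of two squared norms. *)
Lemma form_gt0 alpha : aR_real alpha -> alpha != 0 -> 0 < form alpha alpha.
Proof.
move=> aR a0; set H := riesz alpha.
(* The right-hand side represents the functional - conj(alpha(theta X)) on real X, which is [alpha]
   itself; uniqueness gives the equality. *)
have HE : H = (- th H.1, th H.2).
  apply: riesz_unique => -[X Y].
  have E Z : killing (incl (- th H.1, th H.2)) (incl (to_cplx Z)) = alpha (to_cplx Z).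
    have [Re Im] := aR Z; have := rieszP alpha (to_cplx (th Z)).
    rewrite -/H !incl_to_cplx !cplx_killing !inclE /= !killing0r !subr0 !add0r.
    rewrite !vsval_th !killing_theta.
    move=> /eqP; rewrite eq_complex /= Re Im => /andP[/eqP h1 /eqP h2].
    rewrite killingNl.
    by apply/eqP; rewrite eq_complex /= h1 h2 opprK !eqxx.
  rewrite [RHS]dual_split -!E {1}(cplx_split (X, Y)) /= linearD linearZ /=.
  by rewrite killingDr killingZr.
have E1 : theta (vsval H.1) = - vsval H.1.
  by rewrite -vsval_th {2}HE /= linearN opprK.
have E2 : theta (vsval H.2) = vsval H.2 by rewrite -vsval_th {2}HE.
have cross : killing (vsval H.1) (vsval H.2) = 0.
  have := killing_invol theta_inv (vsval H.1) (vsval H.2).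
  by rewrite E1 E2 killingNl; lra.
have cross2 : killing (vsval H.1) (vsval H.2) + killing (vsval H.2) (vsval H.1) = 0.
  by rewrite (killingC (vsval H.2)) cross addr0.
have p1 : killing (vsval H.1) (vsval H.1) = inner (vsval H.1) (vsval H.1).
  by rewrite /inner E1 killingNr opprK.
have p2 : - killing (vsval H.2) (vsval H.2) = inner (vsval H.2) (vsval H.2).
  by rewrite /inner E2.
have fE : form alpha alpha
    = ((inner (vsval H.1) (vsval H.1) + inner (vsval H.2) (vsval H.2))%:C)%C.
  rewrite /dual_killing -rieszP -/H cplx_killing !inclE -p1 -p2.
  by congr (_ +i* _)%C; exact: cross2.
rewrite fE ltcR.
rewrite lt0r addr_ge0 ?inner_ge0 // andbT; apply: contraNneq a0 => /inner_eq0[v1 v2].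
have H0 : H = 0.
  rewrite [H]surjective_pairing; congr pair; apply: subvs_inj;
    by rewrite ?v1 ?v2 linear0.
by apply/eqP/lfunP => B; rewrite -rieszP -/H H0 linear0 killing0l zero_lfunE.
Qed.

Let sigma_theta_fun x : sigma (theta x) = theta (sigma x).
Proof. by rewrite -!comp_lfunE sigma_theta. Qed.

Let tau v : cplx g := (sigma (theta v.1), - sigma (theta v.2)).

(** The map sigma theta sends the weight lambda to - lambda o theta, and conjugation turns this into
    lambda again by [aR_real]. *)
Let root_vector_tau lambda v : v != 0 ->
  root_vector lambda v -> root_vector lambda (tau v).
Proof.
move=> v0 lv; have lr := root_vector_aR_real v0 lv; apply: root_vectorP => X.
have st y : lie (vsval X) (sigma (theta y)) = - sigma (theta (lie (vsval (th X)) y)).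
  rewrite (invol_lie theta_inv) (invol_lie sigma_inv) vsval_th involK //.
  by rewrite (a_minus (subvsP X)) lieNl opprK.
have [Re Im] := lr X; have [p1 p2] := root_vector_parts (th X) lv.
rewrite cplx_lieE cplx_scaleE /= !lie0l subr0 addr0 lieNr !st p1 p2 Re Im.
have stD (k l : R) x y : sigma (theta (k *: x + l *: y))
    = k *: sigma (theta x) + l *: sigma (theta y).
  by rewrite -!comp_lfunE linearD !linearZ.
rewrite -scaleNr !stD; congr pair.
  by rewrite !scaleNr scalerN opprD !opprK.
by rewrite opprK scaleNr scalerN.
Qed.

(** [tau] is a conjugate linear involution of the root space, so v + tau(v) is fixed. If this sum
    vanishes then tau(v) = -v, and i v is fixed. *)
Let exists_tau_fixed lambda : Roots lambda ->
  exists u, [/\ u != 0, root_vector lambda u & tau u = u].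
Proof.
move=> /restricted_rootsP[_ [v v0 lv]].
have st y : sigma (theta (sigma (theta y))) = y.
  by rewrite -sigma_theta_fun !involK.
have [tv|tv] := eqVneq (v + tau v) 0.
  exists ('i%C *: v); split.
  - by rewrite scaler_eq0 (negPf v0) orbF eq_complex /= oner_eq0 andbF.
  - by move=> A; rewrite lieZr lv !scalerA mulrC.
  - have [t1 t2] : v.1 + sigma (theta v.1) = 0 /\ v.2 - sigma (theta v.2) = 0.
      by move: tv => [-> ->].
    rewrite cplx_scaleE /tau /= !scale0r !scale1r sub0r add0r.
    rewrite !linearN /=; congr pair.
      by congr (- _); apply/esym/eqP; rewrite -subr_eq0 t2.
    by apply/esym/eqP; rewrite -addr_eq0 t1.
exists (v + tau v); split=> // [A|].
  by rewrite lieDr lv (root_vector_tau v0 lv) scalerDr.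
have stD x y : sigma (theta (x + y)) = sigma (theta x) + sigma (theta y).
  by rewrite -!comp_lfunE linearD.
have stN y : sigma (theta (- y)) = - sigma (theta y).
  by rewrite -!comp_lfunE linearN.
rewrite /tau /=; congr pair; rewrite stD ?stN st; first exact: addrC.
by rewrite opprD opprK addrC.
Qed.

Lemma eigenvalues_incl_finite A : exists s : seq C,
  forall c z, z != 0 -> lie (incl A) z = c *: z -> c \in s.
Proof.
have [n [b [w [b0 bw bgen bfree]]]] := weight_decomposition.
exists [seq w i A | i <- enum 'I_n] => k z z0 kz.
have [c cE] := bgen z.
have [j cj] : exists j, c j != 0.
  apply: contrapT => /forallNP c0; move/eqP: z0; apply.
  rewrite cE big1 // => j _; have := c0 j.
  by move/negP; rewrite negbK => /eqP ->; rewrite scale0r.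
apply/mapP; exists j; rewrite ?mem_enum //.
apply/eqP; rewrite -subr_eq0; apply/eqP; apply: (mulfI cj); rewrite mulr0.
apply: (bfree (fun i => c i * (k - w i A))).
move: kz; rewrite cE linear_sum scaler_sumr /= => /eqP.
rewrite -subr_eq0 -sumrB => /eqP E; apply/eqP; rewrite -oppr_eq0 -sumrN.
apply/eqP; rewrite -[RHS]E; apply: eq_bigr => i _.
rewrite lieZr bw !scalerA -scalerBl -scaleNr.
by congr (_ *: _); ring.
Qed.

Lemma root_vector_lie alpha beta v w : root_vector alpha v -> root_vector beta w ->
  root_vector (alpha + beta) (lie v w).
Proof.
move=> av bw A; rewrite lie_derivation av bw lieZl lieZr -scalerDl.
by rewrite add_lfunE.
Qed.

Lemma root_vector_iter alpha beta v w k : root_vector alpha v -> root_vector beta w ->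
  root_vector (beta + alpha *+ k) (iter k (lie v) w).
Proof.
move=> av bw; elim: k => [|k IHk]; first by rewrite mulr0n addr0.
by rewrite mulrS addrCA; apply: root_vector_lie.
Qed.

Lemma root_form_gt0 lambda : Roots lambda -> 0 < form lambda lambda.
Proof.
move=> /restricted_rootsP[l0 [v v0 lv]]; apply: form_gt0 => //.
exact: root_vector_aR_real lv.
Qed.

(* The triple [u, sigma u, [u, sigma u]] with [u] fixed by the conjugation [tau]
   of the dual real form, in which [a_R] is split. *)
Lemma root_coroot lambda : Roots lambda ->
  exists e f H, [/\ lie e f = incl H, root_vector lambda e, root_vector (- lambda) f,
    lambda H = 2 & forall mu : dual, mu H = 2 * form lambda mu / form lambda lambda].
Proof.
move=> lR; have [u [u0 lu tu]] := exists_tau_fixed lR.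
have sI := cplx_end_invol sigma_inv; have slu := root_vector_sigma lu.
set su := cplx_end sigma u in slu; set h0 := lie u su.
(* [u, sigma u] has weight 0 and is negated by sigma, so its real and imaginary parts lie in q and
   commute with a; maximality puts them in a. *)
have h00 A : lie (incl A) h0 = 0.
  by have := root_vector_lie lu slu A; rewrite subrr zero_lfunE scale0r.
have sh0 : cplx_end sigma h0 = - h0.
  by rewrite (invol_lie sI) /su (involK sI) lieC.
have [s1 s2] : sigma h0.1 = - h0.1 /\ sigma h0.2 = - h0.2.
  by move: sh0; rewrite cplx_endE => -[-> ->].
have h0y y : y \in a -> lie y h0.1 = 0 /\ lie y h0.2 = 0.
  move=> ya; have := h00 (to_cplx (vsproj a y)).
  rewrite incl_to_cplx vsprojK // cplx_lieE; move: (h0) => [x1 x2] /=.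
  by rewrite !lie0l subr0 addr0 => -[].
have h0a : h0.1 \in a /\ h0.2 \in a.
  by split; apply: a_maximal => // y /h0y[].
pose H : aC := (vsproj a h0.1, vsproj a h0.2).
have HE : incl H = h0 by rewrite inclE /= !vsprojK; case: h0a => //; case: (h0).
set c := killing u su.
(* For u fixed by [tau], sigma acts as theta on [u.1] and as -theta on [u.2], so c is minus the sum
   of their squared norms. *)
have c0 : c != 0.
  have [st1 st2] : sigma (theta u.1) = u.1 /\ sigma (theta u.2) = - u.2.
    by case: (u) tu => x y [p1 p2]; split=> //=; rewrite -[in RHS]p2 opprK.
  have e1 : sigma u.1 = theta u.1 by rewrite -{1}st1 involK.
  have e2 : sigma u.2 = - theta u.2.
    by rewrite -[theta u.2](involK sigma_inv) st2 linearN opprK.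
  have cross : killing u.2 (theta u.1) = killing u.1 (theta u.2).
    by rewrite killingC -(killing_invol theta_inv) involK.
  rewrite /c cplx_killing /su cplx_endE /= e1 e2 !killingNr cross addNr opprK.
  apply: contraNneq u0 => -[N0]; have [|v1 v2] := @inner_eq0 u.1 u.2.
    by rewrite /inner -opprD N0 oppr0.
  by case: (u) v1 v2 => x y /= -> ->.
have kH mu : form lambda mu = c^-1 * mu H.
  rewrite /dual_killing (@riesz_unique lambda (c^-1 *: H)) ?linearZ // => B.
  rewrite /= killingZl HE /h0 killing_invariant lieC killingNr slu.
  by rewrite opp_lfunE scaleNr killingNr opprK killingZr -/c mulrC mulfK.
have lH0 : lambda H != 0.
  have := root_form_gt0 lR; rewrite kH; apply: contraTneq => ->.
  by rewrite mulr0 ltxx.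
exists u, ((2 / lambda H) *: su), ((2 / lambda H) *: H); split=> //.
- by rewrite lieZr linearZ /= HE.
- by move=> A; rewrite lieZr slu !scalerA mulrC.
- by rewrite linearZ /= [_ *: _]divfK.
- move=> mu; rewrite !kH linearZ /= /GRing.scale /=.
  by field; rewrite lH0 c0.
Qed.

(** sl_2 theory carries a weight vector of [mu] to a nonzero vector whose weight is [mu] shifted by
    -m copies of [lambda]. *)
Lemma root_reflection lambda mu : Roots lambda -> Roots mu ->
  exists2 m : int, 2 * form lambda mu = m%:~R * form lambda lambda
                 & Roots (mu - lambda *~ m).
Proof.
move=> lR mR; have lgt := root_form_gt0 lR; have l0 := lt0r_neq0 lgt.
have [e [f [H [efE le lf lH muH]]]] := root_coroot lR.
have [mu0 [w w0 mw]] := (restricted_rootsP mu).1 mR.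
have [s sP] := eigenvalues_incl_finite H.
have He : lie (incl H) e = 2 *: e by rewrite le lH.
have Hf : lie (incl H) f = - 2 *: f by rewrite lf opp_lfunE lH.
have [m mE [i [j [ijm nz]]]] := sl2_reflection sP efE He Hf w0 (mw H).
have fE : 2 * form lambda mu = m%:~R * form lambda lambda.
  by rewrite -mE muH divfK.
exists m => //; apply/restricted_rootsP; split.
  (* If mu = m lambda, then (lambda, mu) = m (lambda, lambda), and twice it has the same value, so m
     = 0 and mu = 0. *)
  rewrite subr_eq0; apply: contraNneq mu0 => muE.
  have fl : form lambda mu = m%:~R * form lambda lambda.
    by rewrite muE -scaler_int formZr.
  have /eqP : m%:~R * form lambda lambda = 0.
    have /eqP := fE; rewrite -fl mulr_natl mulr2n -subr_eq0 addrK.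
    by move/eqP.
  by rewrite mulf_eq0 (negPf l0) orbF intr_eq0 => /eqP m0; rewrite muE m0 mulr0z.
have wE : mu - lambda *~ m = mu + lambda *+ i - lambda *+ j.
  rewrite -addrA; congr (_ + _); rewrite -mulrNz -ijm mulrzBr -!pmulrn.
  by [].
case: nz => nz; [exists (iter i (lie e) (iter j (lie f) w))|
                 exists (iter j (lie f) (iter i (lie e) w))] => //.
  rewrite wE addrAC -mulNrn; do 2!apply: root_vector_iter => //.
by rewrite wE -mulNrn; do 2!apply: root_vector_iter => //.
Qed.

Lemma root_opp alpha : Roots alpha -> Roots (- alpha).
Proof.
move=> [a0 [Y Y0 [Y1 Y2 YE]]]; split; first by rewrite oppr_eq0.
by exists Y => //; split=> // A; rewrite opp_lfunE sqrrN.
Qed.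

Lemma root_aR_real alpha : Roots alpha -> aR_real alpha.
Proof.
by move=> /restricted_rootsP[_ [v v0 av]]; apply: root_vector_aR_real v0 av.
Qed.

Lemma theta_actD alpha beta :
  theta_act theta (alpha + beta) = theta_act theta alpha + theta_act theta beta.
Proof. by apply/lfunP => A; rewrite add_lfunE !theta_actE add_lfunE. Qed.

Lemma theta_actK alpha : theta_act theta (theta_act theta alpha) = alpha.
Proof.
by apply: dual_eq => X; rewrite !theta_actE /cplx_map /= !thK.
Qed.

Lemma root_theta alpha : Roots alpha -> Roots (theta_act theta alpha).
Proof.
move=> /restricted_rootsP[a0 [v v0 av]]; apply/restricted_rootsP; split.
  apply: contraNneq a0 => ta0; rewrite -(theta_actK alpha) ta0.
  by apply/eqP/lfunP => A; rewrite theta_actE !zero_lfunE.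
exists (cplx_end theta v); last exact: root_vector_theta.
apply: contraNneq v0 => tv0.
by rewrite -(involK (cplx_end_invol theta_inv) v) tv0 linear0.
Qed.

Lemma form_theta alpha beta :
  form (theta_act theta alpha) (theta_act theta beta) = form alpha beta.
Proof.
have tI := cplx_end_invol theta_inv.
have inclT A : incl (cplx_map th A) = cplx_end theta (incl A).
  by rewrite cplx_endE !inclE /= !vsval_th.
rewrite /dual_killing (@riesz_unique _ (cplx_map th (riesz alpha))).
  by rewrite theta_actE; congr (beta _); case: riesz => X Y; rewrite /cplx_map /= !thK.
move=> B; rewrite inclT -(killing_invol tI) (involK tI) -inclT rieszP.
by rewrite theta_actE.
Qed.

(** Here alpha o theta = - conj(alpha) on a, which equals -alpha exactly when alpha has real values
    on a. *)
Lemma real_valuedP alpha : aR_real alpha ->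
  real_valued alpha <-> theta_act theta alpha = - alpha.
Proof.
move=> ar; have realP (c : C) : (c \is Num.real) = (complex.Im c == 0).
  by case: c => x y; rewrite realE !lecE /= eq_sym -andb_orr le_total andbT.
split=> [areal|tha X].
  apply: dual_eq => X; rewrite theta_actE /cplx_map /= linear0 opp_lfunE.
  have := areal X; rewrite realP => /eqP ImX; have [Re Im] := ar X.
  by apply/eqP; rewrite eq_complex !raddfN /= Re Im ImX oppr0 !eqxx.
have [_ Im] := ar X; rewrite realP.
have := congr1 (fun f : dual => complex.Im (f (to_cplx X) : C)) tha.
rewrite theta_actE /cplx_map /= linear0 Im opp_lfunE /= => E.
by apply/eqP; move: E; rewrite raddfN /=; lra.
Qed.

End CartanSubspace.

(** * Root sets in coordinates over the simple roots *)

Section RootSets.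
Variables (r : nat) (c : nat -> nat -> int) (dbl : pred nat).
Implicit Types (n : nat -> int) (P Q : (nat -> int) -> Prop).

Definition vertex i : bool := (1 <= i <= r)%N.

Definition unitc i : nat -> int := fun k => (k == i)%:Z.

Definition pairing n k : int := \sum_(1 <= j < r.+1) n j * c j k.

Definition reflect_coef k n : nat -> int := fun j => n j - pairing n k * unitc k j.

(* Coefficient functions of a root system in a fixed base with Cartan matrix [c];
   [dbl] marks the simple roots whose double is a root. *)
Record root_set P : Prop := RootSet {
  rs_ext : forall n n', (forall k, vertex k -> n k = n' k) -> P n -> P n';
  rs_refl : forall n k, vertex k -> P n -> P (reflect_coef k n);
  rs_opp : forall n, P n -> P (fun k => - n k);
  rs_simple : forall i, vertex i -> P (unitc i);
  rs_double : forall i, vertex i -> dbl i -> P (fun k => 2 * unitc i k);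
  rs_sign : forall n, P n -> (forall k, vertex k -> 0 <= n k) \/
                             (forall k, vertex k -> n k <= 0);
  rs_neq0 : forall n, P n -> exists2 k, vertex k & n k != 0;
  rs_mult : forall i m, vertex i -> P (fun k => m * unitc i k) -> 0 <= m ->
    m = 1 \/ dbl i /\ m = 2 }.

Hypothesis c_diag : forall k, vertex k -> c k k = 2.
(** The only consequence of positive definiteness that the descent uses. The form of the given root
    system provides it, whatever the Cartan matrix. *)
Hypothesis c_pos : forall n, (forall k, vertex k -> 0 <= n k) ->
  (exists2 k, vertex k & n k != 0) -> exists k, [/\ vertex k, 0 < n k & 0 < pairing n k].

Lemma pairing_ext n n' k : (forall j, vertex j -> n j = n' j) -> pairing n k = pairing n' k.
Proof.
move=> E; rewrite /pairing !big_nat; apply: eq_bigr => j jr.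
by rewrite E // /vertex -[(j <= r)%N]ltnS.
Qed.

Lemma pairingD n n' k : pairing (fun j => n j + n' j) k = pairing n k + pairing n' k.
Proof. by rewrite -big_split; apply: eq_bigr => j _; rewrite mulrDl. Qed.

Lemma pairingZ m n k : pairing (fun j => m * n j) k = m * pairing n k.
Proof. by rewrite mulr_sumr; apply: eq_bigr => j _; rewrite mulrA. Qed.

Lemma pairingN n k : pairing (fun j => - n j) k = - pairing n k.
Proof. by rewrite -sumrN; apply: eq_bigr => j _; rewrite mulNr. Qed.

Lemma pairing_unit i k : vertex i -> pairing (unitc i) k = c i k.
Proof.
move=> ri; rewrite /pairing (bigD1_seq i) ?iota_uniq ?mem_index_iota //=.
rewrite /unitc eqxx mul1r big1 ?addr0 // => j /negPf ->.
by rewrite mul0r.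
Qed.

Lemma reflect_coefK n k j : vertex k -> reflect_coef k (reflect_coef k n) j = n j.
Proof.
move=> rk; have E : pairing (reflect_coef k n) k = - pairing n k.
  rewrite (@pairing_ext _ (fun j => n j + - pairing n k * unitc k j)); last first.
    by move=> i _; rewrite mulNr.
  by rewrite pairingD pairingZ pairing_unit // c_diag //; lia.
by rewrite {1}/reflect_coef E mulNr opprK addrNK.
Qed.

(** A nonnegative root pairing positively with a simple root of its support is lowered by that
    reflection. It stays nonnegative unless the support is a single vertex; such multiples are the
    base case. *)
Lemma root_set_ind P (S : (nat -> int) -> Prop) : root_set P ->
  (forall n n', (forall k, vertex k -> n k = n' k) -> S n -> S n') ->
  (forall n k, vertex k -> S n -> S (reflect_coef k n)) ->
  (forall n, S n -> S (fun k => - n k)) ->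
  (forall i, vertex i -> S (unitc i)) ->
  (forall i, vertex i -> dbl i -> S (fun k => 2 * unitc i k)) ->
  forall n, P n -> S n.
Proof.
move=> Pr Sext Srefl Sopp Sunit Sdbl.
suff main N n : \sum_(1 <= k < r.+1) n k < N%:Z -> P n ->
    (forall k, vertex k -> 0 <= n k) -> S n.
  have bound n : \sum_(1 <= k < r.+1) n k < (`|\sum_(1 <= k < r.+1) n k|.+1)%:Z by lia.
  move=> n Pn; case: (rs_sign Pr Pn) => n0; first exact: (main _ n (bound n) Pn n0).
  apply: (Sext (fun k => - - n k)) => [k _|]; first by rewrite opprK.
  apply/Sopp/(main _ _ (bound _)) => [|k /n0]; first exact: rs_opp.
  by rewrite oppr_ge0.
elim: N n => [|N IHN] n hN Pn n0.
  have : 0 <= \sum_(1 <= k < r.+1) n k.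
    by rewrite big_nat; apply: sumr_ge0 => k kr; apply: n0; rewrite /vertex -ltnS.
  by lia.
have [k [rk nk pk]] := c_pos n0 (rs_neq0 Pr Pn).
(* Reflection in vertex k leaves a positive coefficient at j unchanged, and [rs_sign] then makes all
   coefficients of the reflected root nonnegative. *)
have [[j /and3P[rj jk nj]]|none] := pselect (exists j, [&& vertex j, j != k & 0 < n j]).
  apply: (Sext (reflect_coef k (reflect_coef k n))) => [i _|].
    exact: reflect_coefK.
  apply: Srefl => //; have Pn' := rs_refl Pr rk Pn; apply: IHN => //.
    rewrite /reflect_coef big_split /= sumrN -mulr_sumr.
    rewrite [X in _ * X](_ : _ = 1).
      by move: pk hN; move: (\sum_(_ <= _ < _) _) (pairing n k) => s p; lia.
    rewrite (bigD1_seq k) ?iota_uniq ?mem_index_iota //= /unitc eqxx.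
    by rewrite big1 ?addr0 // => i /negPf ->.
  case: (rs_sign Pr Pn') => // neg; have := neg j rj.
  by rewrite /reflect_coef /unitc (negPf jk) mulr0 subr0 leNgt nj.
have nE i : vertex i -> n k * unitc k i = n i.
  move=> ri; rewrite /unitc; have [->|ik] := eqVneq i k; first by rewrite mulr1.
  apply/eqP; rewrite mulr0 eq_sym; apply: contrapT => /negP ni; apply: none; exists i.
  by rewrite ri ik lt0r ni n0.
have : P (fun i => n k * unitc k i).
  by apply: (rs_ext Pr) Pn => i ri; rewrite nE.
move=> /(rs_mult Pr rk)/(_ (ltW nk))[m1|[dk m2]].
  by apply: Sext (Sunit k rk) => i /nE <-; rewrite m1 mul1r.
by apply: Sext (Sdbl k rk dk) => i /nE <-; rewrite m2.
Qed.

Lemma root_set_unique P Q n : root_set P -> root_set Q -> P n <-> Q n.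
Proof.
move=> Pr Qr; split; apply: root_set_ind => //;
  by [exact: rs_ext | exact: rs_refl | exact: rs_opp | exact: rs_simple | exact: rs_double].
Qed.

Definition real_coef (black : pred nat) (arrow : rel nat) P n : Prop :=
  [/\ P n, forall k, vertex k -> black k -> pairing n k = 0 &
      forall i j, vertex i -> vertex j -> arrow i j -> n i = n j].

End RootSets.

(** The convention is c i j = 2 (alpha_i, alpha_j) / (alpha_j, alpha_j). The bond number is the
    product of c i j and c j i, so on a multiple bond the whole number falls to the entry whose
    first index is the longer root. *)
Definition cartan_int (d : dynkin) (i j : nat) : int :=
  if i == j then 2
  else if (bond d i j <= 1)%N || longer d i j then - (bond d i j)%:Z else -1.

Lemma cartan_int_diag d k : cartan_int d k k = 2.
Proof. by rewrite /cartan_int eqxx. Qed.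

Ltac if_lia :=
  repeat match goal with
  | |- context [if ?b then _ else _] =>
      lazymatch b with context [if _ then _ else _] => fail | _ => case: (boolP b) => ? end
  end; lia.

(** * Pairings for the classical Cartan matrices *)

Section Coordinates.
Variable r : nat.
Implicit Types (n : nat -> int).

(** Extension by zero: the neighbours k - 1 = 0 and k + 1 = r + 1 at the ends of a chain then
    contribute nothing to the formulas. *)
Definition ext0 n k : int := if vertex r k then n k else 0.

Lemma sum_unitc n m : \sum_(1 <= j < r.+1) n j * (j == m)%:Z = ext0 n m.
Proof.
rewrite /ext0; case: ifP => rm.
  rewrite (bigD1_seq m) ?iota_uniq ?mem_index_iota //= eqxx mulr1.
  by rewrite big1 ?addr0 // => j /negPf ->; rewrite mulr0.
rewrite big_nat big1 // => j jr; case: eqP => [jm|_]; last by rewrite mulr0.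
by move: rm; rewrite -jm /vertex -ltnS jr.
Qed.

(** A vertex of a classical diagram has at most three neighbours p, q, s; an absent one is given the
    weight 0. *)
Lemma pairing_sparse c n k p q s (u v w : int) :
  (forall j, vertex r j -> c j k = 2 * (j == k)%:Z - u * (j == p)%:Z
     - v * (j == q)%:Z - w * (j == s)%:Z) ->
  pairing r c n k = 2 * ext0 n k - u * ext0 n p - v * ext0 n q - w * ext0 n s.
Proof.
move=> cE; rewrite -!sum_unitc !mulr_sumr -!sumrB /pairing !big_nat.
by apply: eq_bigr => j jr; rewrite (cE j jr); ring.
Qed.

Lemma ext0_reflect c n k j : vertex r k ->
  ext0 (reflect_coef r c k n) j = ext0 n j - pairing r c n k * (j == k)%:Z.
Proof.
move=> rk; rewrite /ext0 /reflect_coef; case: ifP => // rj.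
by case: eqP => [jk|_]; [rewrite jk rk in rj|rewrite mulr0 subr0].
Qed.

Lemma ext0_opp n k : ext0 (fun j => - n j) k = - ext0 n k.
Proof. by rewrite /ext0; case: ifP; rewrite ?oppr0. Qed.

Lemma ext0_scale m n k : ext0 (fun j => m * n j) k = m * ext0 n k.
Proof. by rewrite /ext0; case: ifP; rewrite ?mulr0. Qed.

Lemma ext0_unit i k : vertex r i -> ext0 (unitc i) k = (k == i)%:Z.
Proof.
by move=> ri; rewrite /ext0 /unitc; case: ifP => // rk; case: eqP => // ki; rewrite ki ri in rk.
Qed.

Lemma ext0E n k : vertex r k -> ext0 n k = n k.
Proof. by rewrite /ext0 => ->. Qed.

Lemma ext0_eq n n' k : (forall j, vertex r j -> n j = n' j) -> ext0 n k = ext0 n' k.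
Proof. by rewrite /ext0 => E; case: ifP => // /E. Qed.

Lemma ext0_out n k : ~~ vertex r k -> ext0 n k = 0.
Proof. by rewrite /ext0 => /negPf ->. Qed.

Local Notation cA := (cartan_int (dynkin_of FamA r)).
Local Notation cB := (cartan_int (dynkin_of FamB r)).
Local Notation cC := (cartan_int (dynkin_of FamC r)).
Local Notation cD := (cartan_int (dynkin_of FamD r)).

Lemma pairingA n k : vertex r k ->
  pairing r cA n k = 2 * ext0 n k - ext0 n k.-1 - ext0 n k.+1.
Proof.
rewrite /vertex => rk; rewrite (@pairing_sparse _ _ _ k.-1 k.+1 0 1 1 0) => [|j rj].
  by if_lia.
by move: rj; rewrite /vertex /cartan_int /= /chain; if_lia.
Qed.

Lemma pairingB n k : vertex r k ->
  pairing r cB n k = 2 * ext0 n k - (if k == r then 2 else 1) * ext0 n k.-1 - ext0 n k.+1.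
Proof.
rewrite /vertex => rk.
rewrite (@pairing_sparse _ _ _ k.-1 k.+1 0 (if k == r then 2 else 1) 1 0) => [|j rj].
  by if_lia.
by move: rj; rewrite /vertex /cartan_int /= /chain; if_lia.
Qed.

Lemma pairingC n k : vertex r k ->
  pairing r cC n k = 2 * ext0 n k - ext0 n k.-1 - (if k.+1 == r then 2 else 1) * ext0 n k.+1.
Proof.
rewrite /vertex => rk.
rewrite (@pairing_sparse _ _ _ k.-1 k.+1 0 1 (if k.+1 == r then 2 else 1) 0) => [|j rj].
  by if_lia.
by move: rj; rewrite /vertex /cartan_int /= /chain; if_lia.
Qed.

Lemma pairingD_family n k : (2 < r)%N -> vertex r k ->
  pairing r cD n k = 2 * ext0 n k - (if k == r then 0 else 1) * ext0 n k.-1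
    - (if k.+1 == r then 0 else 1) * ext0 n k.+1
    - (if k.+2 == r then 1 else 0) * ext0 n r
    - (if k == r then 1 else 0) * ext0 n r.-2.
Proof.
rewrite /vertex => r2 rk.
have [kr|kr] := eqVneq k r.
  rewrite (@pairing_sparse _ _ _ r.-2 k.+1 0 1 1 0) => [|j rj]; first by if_lia.
  by move: rj; rewrite /vertex /cartan_int /= /chain /edges !inE !xpair_eqE; if_lia.
rewrite (@pairing_sparse _ _ _ k.-1 k.+1 r 1 (if k.+1 == r then 0 else 1)
   (if k.+2 == r then 1 else 0)) => [|j rj]; first by if_lia.
by move: rj; rewrite /vertex /cartan_int /= /chain /edges !inE !xpair_eqE; if_lia.
Qed.

End Coordinates.

(** * Simple reflections as signed permutations of the coordinates e_i *)

Definition swap_next k j : nat := if j == k then k.+1 else if j == k.+1 then k else j.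

Definition is_sign (s : int) : Prop := s = 1 \/ s = -1.

(** The vectors +-e_i +- e_j with i != j, and +-m e_i with m in [M]. Types B, BC, C and D are [M] =
    {1}, {1, 2}, {2} and the empty list. *)
Inductive signed_pattern (M : seq int) r (x : nat -> int) : Prop :=
| SignedPair i j s t of vertex r i & vertex r j & i != j & is_sign s & is_sign t &
    (forall k, vertex r k -> x k = s * (k == i)%:Z + t * (k == j)%:Z)
| SignedUnit i s m of vertex r i & is_sign s & m \in M &
    (forall k, vertex r k -> x k = s * m * (k == i)%:Z).

Lemma signed_pattern_act M r (x x' : nat -> int) (e : nat -> int) (tau : nat -> nat) :
  (forall k, vertex r k -> vertex r (tau k)) ->
  (forall k, vertex r k -> tau (tau k) = k) ->
  (forall k, vertex r k -> is_sign (e k)) ->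
  (forall k, vertex r k -> x' k = e k * x (tau k)) ->
  signed_pattern M r x -> signed_pattern M r x'.
Proof.
move=> tauV tauK es xE.
have signM s t : is_sign s -> is_sign t -> is_sign (s * t).
  by move=> [] -> [] ->; [left|right|right|left].
have tauE k i : vertex r k -> vertex r i -> (tau k == i) = (k == tau i).
  by move=> rk ri; apply/eqP/eqP => [<-|->]; rewrite tauK.
have absorb k i s : vertex r i ->
    e k * (s * (k == tau i)%:Z) = e (tau i) * s * (k == tau i)%:Z.
  by move=> ri; case: eqP => [->|_]; rewrite ?mulr0 ?mulr1.
move=> [i j s t ri rj ij ss ts xp|i s m ri ss mM xp].
  apply: (@SignedPair _ _ _ (tau i) (tau j) (e (tau i) * s) (e (tau j) * t));
    rewrite ?tauV //; try by apply: signM => //; apply/es/tauV.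
    by apply: contra_neq ij => E; rewrite -(tauK i) // E tauK.
  by move=> k rk; rewrite xE // xp ?tauV // !tauE // mulrDr !absorb.
apply: (@SignedUnit _ _ _ (tau i) (e (tau i) * s) m); rewrite ?tauV //.
  by apply: signM => //; apply/es/tauV.
by move=> k rk; rewrite xE // xp ?tauV // tauE // absorb // mulrA.
Qed.

Section Classical.
Variable r : nat.
Implicit Types (n : nat -> int).

Local Notation cA := (cartan_int (dynkin_of FamA r)).
Local Notation cB := (cartan_int (dynkin_of FamB r)).
Local Notation cC := (cartan_int (dynkin_of FamC r)).
Local Notation cD := (cartan_int (dynkin_of FamD r)).

(* With simple roots [e_i - e_{i+1}], ending in [e_r], [2 e_r] or [e_{r-1} + e_r]
   for types B, C and D, [coordX n] are the coordinates of [sum_i n_i alpha_i]. *)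
Definition coordB n k := ext0 r n k - ext0 r n k.-1.
Definition coordC n k := (if k == r then 2 else 1) * ext0 r n k - ext0 r n k.-1.
Definition coordD n k :=
  if k == r then ext0 r n r - ext0 r n r.-1
  else if k.+1 == r then ext0 r n k + ext0 r n r - ext0 r n k.-1
  else ext0 r n k - ext0 r n k.-1.

(** Type A shares [coordB] but uses r + 1 coordinates: [ext0] makes the last one - n_r, so they sum
    to zero. *)
Lemma coordA_reflect n k j : vertex r k -> (0 < j)%N ->
  coordB (reflect_coef r cA k n) j = coordB n (swap_next k j).
Proof.
move=> rk j0; rewrite /coordB !ext0_reflect // pairingA // /swap_next.
have [->|jk] := eqVneq j k.
  have -> : (k.-1 == k) = false by move: rk; rewrite /vertex; lia.
  by rewrite mulr1 mulr0 /=; lia.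
have [->|jk1] := eqVneq j k.+1; first by rewrite /= eqxx; lia.
have -> : (j.-1 == k) = false by lia.
by rewrite !mulr0 !subr0.
Qed.

Lemma coordB_reflect n k j : vertex r k -> (0 < j)%N -> (k < r)%N ->
  coordB (reflect_coef r cB k n) j = coordB n (swap_next k j).
Proof.
move=> rk j0 kr; rewrite /coordB !ext0_reflect // pairingB // /swap_next.
rewrite ltn_eqF //.
have [->|jk] := eqVneq j k.
  have -> : (k.-1 == k) = false by move: rk; rewrite /vertex; lia.
  by rewrite mulr1 mulr0 /=; lia.
have [->|jk1] := eqVneq j k.+1; first by rewrite /= eqxx; lia.
have -> : (j.-1 == k) = false by lia.
by rewrite !mulr0 !subr0.
Qed.

Lemma coordB_reflect_last n j : vertex r r -> vertex r j ->
  coordB (reflect_coef r cB r n) j = (if j == r then -1 else 1) * coordB n j.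
Proof.
move=> rr rj; rewrite /coordB !ext0_reflect // pairingB // eqxx.
rewrite (@ext0_out _ _ r.+1) ?/vertex ?ltnn ?andbF //.
have -> : (j.-1 == r) = false by move: rj; rewrite /vertex; lia.
by have [->|jr] := eqVneq j r; lia.
Qed.

Lemma coordC_reflect n k j : vertex r k -> (0 < j)%N -> (k < r)%N ->
  coordC (reflect_coef r cC k n) j = coordC n (swap_next k j).
Proof.
move=> rk j0 kr; rewrite /coordC !ext0_reflect // pairingC // /swap_next.
have [->|jk] := eqVneq j k.
  have -> : (k.-1 == k) = false by move: rk; rewrite /vertex; lia.
  by rewrite (ltn_eqF kr) mulr1 mulr0 /=; case: eqP; lia.
have [->|jk1] := eqVneq j k.+1.
  by rewrite /= eqxx (ltn_eqF kr); case: eqP; lia.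
have -> : (j.-1 == k) = false by lia.
by rewrite !mulr0 !subr0.
Qed.

Lemma coordC_reflect_last n j : vertex r r -> vertex r j ->
  coordC (reflect_coef r cC r n) j = (if j == r then -1 else 1) * coordC n j.
Proof.
move=> rr rj; rewrite /coordC !ext0_reflect // pairingC //.
rewrite (@ext0_out _ _ r.+1) ?/vertex ?ltnn ?andbF //.
have -> : (j.-1 == r) = false by move: rj; rewrite /vertex; lia.
by have [->|jr] := eqVneq j r; lia.
Qed.

Lemma coordD_reflect n k j : (2 < r)%N -> vertex r k -> vertex r j -> (k < r)%N ->
  coordD (reflect_coef r cD k n) j = coordD n (swap_next k j).
Proof.
move=> r2 rk; rewrite /vertex => rj kr.
have p1 : (r.-1 == r) = false by lia.
have kr0 := ltn_eqF kr.
have kk1 : (k.-1 == k) = false by move: rk; rewrite /vertex; lia.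
have kSk : (k.+1 == k) = false by lia.
rewrite /coordD !ext0_reflect // pairingD_family // /swap_next kr0.
have rE : (r == k) = false by rewrite eq_sym.
rewrite rE.
have [->|jk] := eqVneq j k.
  rewrite kr0 kk1 !mulr0 !mulr1; have [E|kS] := eqVneq k.+1 r.
    have -> : (k.+2 == r) = false by lia.
    by rewrite -E /=; lia.
  by have [<-|kS2] := eqVneq k.+2 r; rewrite /=; lia.
have [->|jk1] := eqVneq j k.+1.
  rewrite kr0 /= eqxx !mulr0 !mulr1; have [E|kS] := eqVneq k.+1 r.
    have -> : (k.+2 == r) = false by lia.
    by rewrite -E /= eqxx; lia.
  by have [<-|kS2] := eqVneq k.+2 r; rewrite /=; lia.
have -> : (j.-1 == k) = false by lia.
have [E|jr] := eqVneq j r; last by rewrite !mulr0 !subr0.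
have -> : (r.-1 == k) = false by lia.
by rewrite !mulr0 !subr0.
Qed.

Definition flip_last k j : nat := if j == k then k.-1 else if j == k.-1 then k else j.

(** The reflection in e_{r-1} + e_r exchanges the last two coordinates and negates both. *)
Lemma coordD_reflect_last n j : (2 < r)%N -> vertex r j ->
  coordD (reflect_coef r cD r n) j
    = (if (j == r) || (j.+1 == r) then -1 else 1) * coordD n (flip_last r j).
Proof.
move=> r2; rewrite /vertex => rj.
have rr : vertex r r by rewrite /vertex; lia.
have p1 : (r.-1 == r) = false by lia.
have p2 : (r.-1.+1 == r) = true by lia.
rewrite /coordD !ext0_reflect // pairingD_family // /flip_last eqxx p1.
rewrite (@ext0_out _ _ r.+1) ?/vertex ?ltnn ?andbF //.
have -> : (r.+1 == r) = false by lia.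
have -> : (r.+2 == r) = false by lia.
have [->|jr] := eqVneq j r; first by rewrite ?eqxx ?p1 ?p2 /=; lia.
have [->|jr1] := eqVneq j r.-1.
  have -> : (r.-2 == r) = false by lia.
  by rewrite ?p2 ?p1 ?eqxx /=; lia.
have -> : (j.+1 == r) = false by lia.
have -> : (j.-1 == r) = false by lia.
by rewrite (negPf jr) /=; lia.
Qed.

End Classical.

(** Coordinates are consecutive differences of coefficients, so summation recovers the coefficients.
    The bound [K] allows stopping before the fork of type D. *)
Lemma partial_sum (E : nat -> int) K i j (s t : int) : (0 < i)%N -> (0 < j)%N -> E 0%N = 0 ->
  (forall k, (0 < k <= K)%N -> E k - E k.-1 = s * (k == i)%:Z + t * (k == j)%:Z) ->
  forall k, (k <= K)%N -> E k = s * (i <= k)%N%:Z + t * (j <= k)%N%:Z.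
Proof.
move=> i0 j0 E0 EE; elim=> [|k IHk] kK.
  by rewrite E0 !leqn0 !gtn_eqF // !mulr0.
have := EE k.+1 kK; rewrite /= IHk ?(ltnW kK) // => /eqP.
have stepE m : (m <= k.+1)%N%:Z = (k.+1 == m)%:Z + (m <= k)%N%:Z by lia.
by rewrite subr_eq => /eqP ->; rewrite !stepE; ring.
Qed.

(* The [k]-th partial sum of the sequence [s e_i + t e_j]. *)
Definition psum (i j : nat) (s t : int) (k : nat) : int :=
  s * (i <= k)%N%:Z + t * (j <= k)%N%:Z.

(** * The standard root systems of types A, B, BC, C and D *)

Section ClassicalRootSets.
Variable r : nat.
Implicit Types (n : nat -> int).

Local Notation cA := (cartan_int (dynkin_of FamA r)).
Local Notation cB := (cartan_int (dynkin_of FamB r)).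
Local Notation cC := (cartan_int (dynkin_of FamC r)).
Local Notation cD := (cartan_int (dynkin_of FamD r)).

Definition patternA n : Prop := exists i j,
  [/\ vertex r.+1 i, vertex r.+1 j, i != j &
      forall k, vertex r.+1 k -> coordB r n k = (k == i)%:Z - (k == j)%:Z].

Lemma ext0_0 n : ext0 r n 0 = 0.
Proof. exact: ext0_out. Qed.

Lemma patternA_coef n i j : vertex r.+1 i -> vertex r.+1 j ->
  (forall k, vertex r.+1 k -> coordB r n k = (k == i)%:Z - (k == j)%:Z) ->
  forall k, vertex r k -> n k = (i <= k)%N%:Z - (j <= k)%N%:Z.
Proof.
move=> /andP[i0 ir] /andP[j0 jr] nE k /andP[k0 kr].
rewrite -(@ext0E r) ?/vertex ?k0 // (@partial_sum (ext0 r n) r i j 1 (-1)) ?ext0_0 //.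
  by rewrite mul1r mulN1r.
move=> m /andP[m0 mr]; rewrite -/(coordB r n m) nE ?/vertex ?m0 ?leqW //.
by rewrite mul1r mulN1r.
Qed.

Lemma swap_next_vertex R k j : vertex R j -> vertex R k -> (k < R)%N ->
  vertex R (swap_next k j).
Proof. by rewrite /vertex /swap_next => rj rk kR; if_lia. Qed.

Lemma swap_nextK k : involutive (swap_next k).
Proof. by move=> j; rewrite /swap_next; if_lia. Qed.

Lemma swap_next_eq k i j : (swap_next k j == i) = (j == swap_next k i).
Proof. by apply/eqP/eqP => [<-|->]; rewrite swap_nextK. Qed.

Lemma patternA_root_set : root_set r cA pred0 patternA.
Proof.
split.
- move=> n n' E [i [j [ri rj ij nE]]]; exists i, j; split=> // k rk.
  by rewrite -nE // /coordB !(ext0_eq (r := r) _ E).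
- move=> n k rk [i [j [ri rj ij nE]]].
  have kr : vertex r.+1 k && (k < r.+1)%N by move: rk; rewrite /vertex; lia.
  have sV m : vertex r.+1 m -> vertex r.+1 (swap_next k m).
    by case/andP: kr => rk' kr rm; apply: swap_next_vertex.
  exists (swap_next k i), (swap_next k j); split; rewrite ?sV //.
    by apply: contra_neq ij => /(can_inj (swap_nextK k)).
  move=> m rm; rewrite coordA_reflect //; last by case/andP: rm.
  by rewrite nE ?sV // !swap_next_eq.
- move=> n [i [j [ri rj ij nE]]]; exists j, i; split=> //; first by rewrite eq_sym.
  by move=> k rk; have := nE k rk; rewrite /coordB !ext0_opp; lia.
- move=> i ri; exists i, i.+1; move: (ri); rewrite /vertex => ri'.
  split; rewrite /vertex; try lia.
  move=> k rk; rewrite /coordB !ext0_unit //; congr (_ - _).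
  by congr (Posz (nat_of_bool _)); lia.
- by [].
- move=> n [i [j [ri rj ij /(patternA_coef ri rj) nE]]].
  by have [ij'|ij'] := leqP i j; [left|right] => k /nE ->; lia.
- move=> n [i [j [ri rj ij /(patternA_coef ri rj) nE]]].
  move: ri rj ij; rewrite /vertex => ri rj ij.
  have rm : vertex r (minn i j) by rewrite /vertex; lia.
  by exists (minn i j); rewrite // nE //; lia.
- move=> i m ri [i' [j' [ri' rj' ij /(patternA_coef ri' rj') nE]]] m0; left.
  have := nE i ri; rewrite /unitc eqxx mulr1 => mE.
  have rm : vertex r (minn i' j').
    by move: ri' rj' ij; rewrite /vertex; lia.
  have := nE _ rm; rewrite /unitc; case: eqP => _ E; last by move: ij E; lia.
  by move: ij E; lia.
Qed.

Definition patternB M n : Prop := signed_pattern M r (coordB r n).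
Definition patternC n : Prop := signed_pattern [:: 2] r (coordC r n).
Definition patternD n : Prop := signed_pattern [::] r (coordD r n).

Let signed_pair_multiple (i i' j' : nat) (s t m p : int) :
  is_sign s -> is_sign t -> i' != j' -> 0 <= m ->
  m = s * (i == i')%:Z + t * (i == j')%:Z -> m * p = s -> m = 1.
Proof.
move=> ss st ij m0; have [E|ii] := eqVneq i i'.
  rewrite E (negPf ij) mulr1 mulr0 addr0; case: ss => ->; lia.
have [E|jj] := eqVneq i j'.
  by rewrite mulr1 mulr0 add0r; case: st => ->; lia.
by rewrite !mulr0 addr0 => ->; rewrite mul0r; case: ss => ->.
Qed.

Let ext0_zero n k : ~ (exists2 k, vertex r k & n k != 0) -> ext0 r n k = 0.
Proof.
move=> none; rewrite /ext0; case: ifP => // rk; apply/eqP.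
by apply: contrapT => /negP nk; apply: none; exists k.
Qed.

Let act_id (e : nat -> int) M (x x' : nat -> int) :
  (forall k, vertex r k -> is_sign (e k)) ->
  (forall k, vertex r k -> x' k = e k * x k) ->
  signed_pattern M r x -> signed_pattern M r x'.
Proof. by move=> es xE; apply: (@signed_pattern_act _ _ _ _ e id). Qed.

Let act_swap m M (x x' : nat -> int) : vertex r m -> (m < r)%N ->
  (forall k, vertex r k -> x' k = x (swap_next m k)) ->
  signed_pattern M r x -> signed_pattern M r x'.
Proof.
move=> rm mr xE; apply: (@signed_pattern_act _ _ _ _ (fun=> 1) (swap_next m)).
- by move=> k rk; apply: swap_next_vertex.
- by move=> k _; apply: swap_nextK.
- by left.
- by move=> k rk; rewrite mul1r xE.
Qed.

Let sign1 : is_sign 1. Proof. by left. Qed.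
Let signN1 : is_sign (-1). Proof. by right. Qed.
Hint Resolve sign1 signN1 : core.

Let last_sign (k : nat) : is_sign (if k == r then -1 else 1).
Proof. by case: ifP. Qed.

Let pos_vertex k : vertex r k -> (0 < k)%N.
Proof. by case/andP. Qed.

Lemma patternB_coef n i j s t : vertex r i -> vertex r j ->
  (forall k, vertex r k -> coordB r n k = s * (k == i)%:Z + t * (k == j)%:Z) ->
  forall k, vertex r k -> n k = psum i j s t k.
Proof.
move=> /andP[i0 ir] /andP[j0 jr] nE k /andP[k0 kr].
by rewrite -(@ext0E r) ?/vertex ?k0 // (@partial_sum (ext0 r n) r i j s t) ?ext0_0.
Qed.

Lemma patternC_coef n i j s t : vertex r i -> vertex r j ->
  (forall k, vertex r k -> coordC r n k = s * (k == i)%:Z + t * (k == j)%:Z) ->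
  forall k, vertex r k -> (if k == r then 2 else 1) * n k = psum i j s t k.
Proof.
move=> /andP[i0 ir] /andP[j0 jr] nE k /andP[k0 kr].
pose E k := (if k == r then 2 else 1) * ext0 r n k.
have := @partial_sum E r i j s t i0 j0; rewrite /E ext0_0 mulr0.
rewrite -(@ext0E r n) ?/vertex ?k0 // => -> // m /andP[m0 mr].
rewrite -nE ?/vertex ?m0 // /coordC; have -> : (m.-1 == r) = false by lia.
by rewrite mul1r.
Qed.

(** At the fork the partial sum up to r - 1 is n_{r-1} + n_r, while the last coordinate is n_r -
    n_{r-1}: the last two coefficients are known only through their sum and difference. The sequence
    [E] below is the one whose differences are the first r - 1 coordinates. *)
Lemma patternD_coef n i j s t : (2 < r)%N -> vertex r i -> vertex r j ->
  (forall k, vertex r k -> coordD r n k = s * (k == i)%:Z + t * (k == j)%:Z) ->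
  [/\ forall k, vertex r k -> (k.+1 < r)%N -> n k = psum i j s t k,
      n r + n r.-1 = psum i j s t r.-1 &
      n r - n r.-1 = s * (r == i)%:Z + t * (r == j)%:Z].
Proof.
move=> r2 ri rj nE; have [/andP[i0 ir] /andP[j0 jr]] := (ri, rj).
have rr : vertex r r by rewrite /vertex; lia.
have rr1 : vertex r r.-1 by rewrite /vertex; lia.
pose E k := ext0 r n k + (if k.+1 == r then ext0 r n r else 0).
have E0 : E 0%N = 0 by rewrite /E ext0_0; have -> : (1 == r)%N = false by lia.
have EE k : (0 < k <= r.-1)%N -> E k - E k.-1 = s * (k == i)%:Z + t * (k == j)%:Z.
  move=> kr; rewrite -nE ?/vertex; last by lia.
  rewrite /E /coordD; have -> : (k == r) = false by lia.
  have -> : (k.-1.+1 == r) = false by lia.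
  by case: eqP => _; lia.
have EP := partial_sum i0 j0 E0 EE; split.
- move=> k rk kr; rewrite /psum -(@ext0E r n) // -EP; last by lia.
  rewrite /E; have -> : (k.+1 == r) = false by lia.
  by rewrite addr0.
- rewrite /psum -(@ext0E r n r) // -(@ext0E r n r.-1) // -EP // /E.
  have -> : (r.-1.+1 == r) = true by lia.
  by rewrite addrC.
- by rewrite -nE // /coordD eqxx !ext0E.
Qed.

Let psum_sign i j s t : i != j -> is_sign s -> is_sign t ->
  (forall k, 0 <= psum i j s t k) \/ (forall k, psum i j s t k <= 0).
Proof.
move=> ij ss st; have [ij'|ij'] := leqP i j.
  by case: ss => ->; [left|right] => k; rewrite /psum; case: st => ->; lia.
by case: st => ->; [left|right] => k; rewrite /psum; case: ss => ->; lia.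
Qed.

Definition unit_multiples (bc : bool) : seq int := if bc then [:: 1; 2] else [:: 1].

Lemma patternB_root_set bc :
  root_set r cB (fun i => bc && (i == r)) (patternB (unit_multiples bc)).
Proof.
have M0 m : m \in unit_multiples bc -> m = 1 \/ bc /\ m = 2.
  by case: bc; rewrite !inE; [case/orP|] => /eqP ->; [left|right|left].
have SUc n i s m : vertex r i ->
    (forall k, vertex r k -> coordB r n k = s * m * (k == i)%:Z) ->
    forall k, vertex r k -> n k = s * m * (i <= k)%N%:Z.
  move=> ri nE k rk; rewrite (@patternB_coef n i i (s * m) 0) ?/psum ?mul0r ?addr0 //.
  by move=> k' rk'; rewrite nE // mul0r addr0.
split.
- move=> n n' E; apply: (@act_id (fun=> 1)) => // k rk.
  by rewrite mul1r /coordB !(ext0_eq (r := r) _ E).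
- move=> n k rk; have [kr|kr] := eqVneq k r.
    rewrite kr in rk *; apply: (@act_id (fun k => if k == r then -1 else 1)).
      by move=> j _; exact: last_sign.
    by move=> j rj; exact: coordB_reflect_last.
  have kr' : (k < r)%N by rewrite ltn_neqAle kr; case/andP: rk.
  by apply: (act_swap rk kr') => j rj; rewrite coordB_reflect ?pos_vertex.
- move=> n; apply: (@act_id (fun=> -1)) => // k rk.
  by rewrite /coordB !ext0_opp; lia.
- move=> i ri; have [ir|ir] := eqVneq i r.
    apply: (@SignedUnit _ _ _ i 1 1) => //.
      by case: bc {M0}; rewrite !inE.
    move=> k; rewrite /vertex => rk; rewrite /coordB !ext0_unit //.
    have -> : (k.-1 == i) = false by lia.
    by rewrite subr0 !mul1r.
  move: (ri); rewrite /vertex => ri'.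
  apply: (@SignedPair _ _ _ i i.+1 1 (-1)); rewrite ?/vertex //; try lia.
  move=> k; rewrite /vertex => rk; rewrite /coordB !ext0_unit //.
  have -> : (k.-1 == i) = (k == i.+1) by lia.
  by rewrite mul1r mulN1r.
- move=> i ri /andP[bcT /eqP ir].
  apply: (@SignedUnit _ _ _ i 1 2) => //; first by rewrite /unit_multiples bcT !inE.
  move=> k; rewrite /vertex => rk; rewrite /coordB !ext0_scale !ext0_unit //.
  have -> : (k.-1 == i) = false by lia.
  by rewrite mulr0 subr0 mul1r.
- move=> n [i j s t ri rj ij ss st /(patternB_coef ri rj) nE|i s m ri ss /M0 m0 /(SUc _ _ _ _ ri) nE].
    by have [h|h] := psum_sign ij ss st; [left|right] => k /nE ->.
  have m1 : 0 < m by case: m0 => [|[_]] ->.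
  by case: ss nE => -> nE; [left|right] => k /nE ->; case: (i <= k)%N; lia.
- move=> n nP; have [//|none] := pselect (exists2 k, vertex r k & n k != 0).
  have x0 k : coordB r n k = 0 by rewrite /coordB !ext0_zero.
  case: nP => [i j s t ri rj ij ss st nE|i s m ri ss /M0 m0 nE].
    by have := nE i ri; rewrite x0 eqxx (negPf ij); case: ss => ->; lia.
  by have := nE i ri; rewrite x0 eqxx; case: m0 => [|[_]] ->; case: ss => ->; lia.
(* The multiple m alpha_i has coordinates m at i and -m at i + 1 when that vertex exists. A signed
   pair then forces m = 1, and the pattern 2 e_i is possible only at i = r. *)
- move=> i m ri nP m0; pose x := coordB r (fun k => m * unitc i k).
  have xE k : vertex r k -> x k = m * ((k == i)%:Z - (k == i.+1)%:Z).
    rewrite /vertex => rk; rewrite /x /coordB !ext0_scale !ext0_unit // mulrBr.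
    by have -> : (k.-1 == i) = (k == i.+1) by lia.
  case: nP => [i' j' s t ri' rj' ij ss st nE|i' s m' ri' ss /M0 mM nE].
    left; have := nE i ri; have := nE i' ri'; rewrite -/x !xE // !eqxx.
    rewrite (ltn_eqF (ltnSn i)) (negPf ij) mulr1 subr0 mulr1 mulr0 addr0 => E1 E2.
    exact: signed_pair_multiple ss st ij m0 E2 E1.
  have := nE i ri; have := nE i' ri'; rewrite -/x !xE // !eqxx.
  rewrite (ltn_eqF (ltnSn i)) !mulr1 ?subr0 ?mulr1.
  have [E|E] := eqVneq i i'.
    rewrite mulr1 => _; case: mM => [|[bcT]] m'E mE; rewrite m'E in mE.
      by left; case: ss mE => ->; lia.
    right; split; last by case: ss mE => ->; lia.
    rewrite bcT /=; apply/eqP; apply: contrapT => ir.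
    have ri1 : vertex r i.+1 by move: ri ir; rewrite /vertex; lia.
    have := nE i.+1 ri1; rewrite -/x xE // eqxx -E (gtn_eqF (ltnSn i)) mulr0.
    by case: ss mE => ->; lia.
  by rewrite mulr0 => + m00; rewrite m00 mul0r; case: ss => ->; case: mM => [|[_]] ->; lia.
Qed.
Lemma patternC_root_set : root_set r cC pred0 patternC.
Proof.
have SUc n i s : vertex r i ->
    (forall k, vertex r k -> coordC r n k = s * 2 * (k == i)%:Z) ->
    forall k, vertex r k -> (if k == r then 2 else 1) * n k = s * 2 * (i <= k)%N%:Z.
  move=> ri nE k rk; rewrite (@patternC_coef n i i (s * 2) 0) ?/psum ?mul0r ?addr0 //.
  by move=> k' rk'; rewrite nE // mul0r addr0.
split=> //.
- move=> n n' E; apply: (@act_id (fun=> 1)) => // k rk.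
  by rewrite mul1r /coordC !(ext0_eq (r := r) _ E).
- move=> n k rk; have [kr|kr] := eqVneq k r.
    rewrite kr in rk *; apply: (@act_id (fun k => if k == r then -1 else 1)).
      by move=> j _; exact: last_sign.
    by move=> j rj; exact: coordC_reflect_last.
  have kr' : (k < r)%N by rewrite ltn_neqAle kr; case/andP: rk.
  by apply: (act_swap rk kr') => j rj; rewrite coordC_reflect ?pos_vertex.
- move=> n; apply: (@act_id (fun=> -1)) => // k rk.
  by rewrite /coordC !ext0_opp; lia.
- move=> i ri; have [ir|ir] := eqVneq i r.
    apply: (@SignedUnit _ _ _ i 1 2) => // k; rewrite /vertex => rk.
    rewrite /coordC !ext0_unit // ir; have -> : (k.-1 == r) = false by lia.
    by case: eqP => _; rewrite ?mulr0 ?mulr1 subr0.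
  move: (ri); rewrite /vertex => ri'.
  apply: (@SignedPair _ _ _ i i.+1 1 (-1)); rewrite ?/vertex //; try lia.
  move=> k; rewrite /vertex => rk; rewrite /coordC !ext0_unit //.
  have -> : (k.-1 == i) = (k == i.+1) by lia.
  by have [->|_] := eqVneq k i; rewrite ?(negPf ir) ?mulr0; lia.
- have half k (p : int) (q : int) : (if k == r then 2 else 1) * p = q ->
      (0 <= q -> 0 <= p) /\ (q <= 0 -> p <= 0) by case: eqP => _; lia.
  move=> n [i j s t ri rj ij ss st /(patternC_coef ri rj) nE|i s m ri ss].
    by have [h|h] := psum_sign ij ss st; [left|right] => k /nE /half[p q];
      [apply: p|apply: q].
  rewrite inE => /eqP -> /(SUc _ _ _ ri) nE.
  by case: ss nE => -> nE; [left|right] => k /nE /half[p q];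
    [apply: p|apply: q]; case: (i <= k)%N.
- move=> n nP; have [//|none] := pselect (exists2 k, vertex r k & n k != 0).
  have x0 k : coordC r n k = 0 by rewrite /coordC !ext0_zero // mulr0.
  case: nP => [i j s t ri rj ij ss st nE|i s m ri ss].
    by have := nE i ri; rewrite x0 eqxx (negPf ij); case: ss => ->; lia.
  rewrite inE => /eqP -> nE.
  by have := nE i ri; rewrite x0 eqxx; case: ss => ->; lia.
- move=> i m ri nP m0; left; pose x := coordC r (fun k => m * unitc i k).
  have xE k : vertex r k ->
      x k = m * ((if k == r then 2 else 1) * (k == i)%:Z - (k == i.+1)%:Z).
    rewrite /vertex => rk; rewrite /x /coordC !ext0_scale !ext0_unit //.
    by have -> : (k.-1 == i) = (k == i.+1) by [lia]; rewrite mulrBr; congr (_ - _); rewrite mulrCA.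
  case: nP => [i' j' s t ri' rj' ij ss st nE|i' s m' ri' ss].
    have [ir|ir] := eqVneq i r.
      have := nE i' ri'; have := nE j' rj'; rewrite -/x !xE // !eqxx ir.
      have -> : (i' == r.+1) = false by move: ri'; rewrite /vertex; lia.
      have -> : (j' == r.+1) = false by move: rj'; rewrite /vertex; lia.
      rewrite (negPf ij) [j' == i']eq_sym (negPf ij).
      have [i'r|i'r] := eqVneq i' r; last by case: ss => ->; lia.
      have [j'r|j'r] := eqVneq j' r; last by case: st => ->; lia.
      by rewrite i'r j'r eqxx in ij.
    have := nE i ri; have := nE i' ri'; rewrite -/x !xE // !eqxx (negPf ir).
    rewrite (ltn_eqF (ltnSn i)) (negPf ij) !mulr1 ?subr0 ?mulr1 mulr0 addr0 => E1 E2.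
    exact: signed_pair_multiple ss st ij m0 E2 E1.
  rewrite inE => /eqP -> nE.
  have := nE i ri; have := nE i' ri'; rewrite -/x !xE // !eqxx.
  rewrite (ltn_eqF (ltnSn i)).
  have [E|E] := eqVneq i i'.
    have [ir|ir] := eqVneq i r; first by move=> _; case: ss => ->; lia.
    have ri1 : vertex r i.+1 by move: ri ir; rewrite /vertex; lia.
    have := nE i.+1 ri1; rewrite -/x xE // eqxx -E (gtn_eqF (ltnSn i)) !mulr0.
    by case: ss => ->; lia.
  have [ir|ir] := eqVneq i r => + m00; have {m00}-> : m = 0 by lia.
    by rewrite mul0r; case: ss => ->.
  by rewrite mul0r; case: ss => ->.
Qed.

Lemma patternD_root_set : (2 < r)%N -> root_set r cD pred0 patternD.
Proof.
move=> r2; split=> //.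
- move=> n n' E; apply: (@act_id (fun=> 1)) => // k rk.
  by rewrite mul1r /coordD !(ext0_eq (r := r) _ E).
- move=> n k rk; have [kr|kr] := eqVneq k r.
    rewrite kr in rk *.
    apply: (@signed_pattern_act _ _ _ _
      (fun j => if (j == r) || (j.+1 == r) then -1 else 1) (flip_last r)).
    + by move=> j; rewrite /vertex /flip_last => rj; if_lia.
    + by move=> j; rewrite /vertex /flip_last => rj; if_lia.
    + by move=> j _; case: ifP.
    + by move=> j rj; exact: coordD_reflect_last.
  have kr' : (k < r)%N by rewrite ltn_neqAle kr; case/andP: rk.
  by apply: (act_swap rk kr') => j rj; rewrite coordD_reflect.
- move=> n; apply: (@act_id (fun=> -1)) => // k rk.
  by rewrite /coordD !ext0_opp; if_lia.
- move=> i ri; have rr : vertex r r by rewrite /vertex; lia.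
  have rr1 : vertex r r.-1 by rewrite /vertex; lia.
  move: (ri); rewrite /vertex => ri'; have [ir|ir] := eqVneq i r.
    apply: (@SignedPair _ _ _ r.-1 r 1 1) => //; first by lia.
    move=> k; rewrite /vertex => rk; rewrite /coordD !ext0_unit // ir; if_lia.
  apply: (@SignedPair _ _ _ i i.+1 1 (-1)); rewrite ?/vertex //; try lia.
  by move=> k; rewrite /vertex => rk; rewrite /coordD !ext0_unit //; if_lia.
- move=> n [i j s t ri rj ij ss st /(patternD_coef r2 ri rj)[nE nE1 nE2]|i s m _ _];
    last by rewrite in_nil.
  have split3 (p : pred int) : (forall k, vertex r k -> (k.+1 < r)%N -> p (n k)) ->
      p (n r) -> p (n r.-1) -> forall k, vertex r k -> p (n k).
    move=> h hr hr1 k rk; have [->//|kr] := eqVneq k r.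
    have [->//|kr1] := eqVneq k r.-1; apply: h => //.
    by move: rk kr kr1; rewrite /vertex; lia.
  move: ri rj ij nE1 nE2; rewrite /psum /vertex => ri rj ij nE1 nE2.
  have [ij'|ij'] := leqP i j.
    case: ss nE nE1 nE2 => -> nE nE1 nE2; [left; apply: (split3 (fun z => 0 <= z))|
      right; apply: (split3 (fun z => z <= 0))];
      try (move=> k rk kr; rewrite nE // /psum); case: st nE1 nE2 => -> nE1 nE2; lia.
  case: st nE nE1 nE2 => -> nE nE1 nE2; [left; apply: (split3 (fun z => 0 <= z))|
      right; apply: (split3 (fun z => z <= 0))];
      try (move=> k rk kr; rewrite nE // /psum); case: ss nE1 nE2 => -> nE1 nE2; lia.
- move=> n nP; have [//|none] := pselect (exists2 k, vertex r k & n k != 0).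
  have x0 k : coordD r n k = 0 by rewrite /coordD !ext0_zero //; if_lia.
  case: nP => [i j s t ri rj ij ss st nE|i s m _ _]; last by rewrite in_nil.
  by have := nE i ri; rewrite x0 eqxx (negPf ij); case: ss => ->; lia.
- move=> i m ri; case=> [i' j' s t ri' rj' ij ss st nE|i' s m' _ _];
    last by rewrite in_nil.
  move=> m0; left; pose x := coordD r (fun k => m * unitc i k).
  have [p xE] : exists p, forall k, vertex r k -> x k = m * p k.
    exists (coordD r (unitc i)) => k rk.
    by rewrite /x /coordD !ext0_scale; case: ifP => _; [|case: ifP => _]; ring.
  have xi : x i = m.
    rewrite /x /coordD !ext0_scale !ext0_unit //.
    by move: ri; rewrite /vertex => ri; if_lia.
  have := nE i ri; have := nE i' ri'; rewrite -/x xi xE // eqxx (negPf ij).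
  rewrite mulr1 mulr0 addr0 => E1 E2.
  exact: signed_pair_multiple ss st ij m0 E2 E1.
Qed.

End ClassicalRootSets.

(** * Coefficient functions and the families in the tables *)

Section RootTable.
Variables (V : zmodType) (alpha : nat -> V) (r : nat).
Implicit Types (n : nat -> int).

Definition lincombz n : V := \sum_(1 <= k < r.+1) alpha k *~ n k.

Lemma eq_lincombz n n' : (forall k, vertex r k -> n k = n' k) -> lincombz n = lincombz n'.
Proof. by move=> E; rewrite /lincombz !big_nat; apply: eq_bigr => k kr; rewrite (E k kr). Qed.

Lemma lincombzD n n' : lincombz (fun k => n k + n' k) = lincombz n + lincombz n'.
Proof. by rewrite -big_split; apply: eq_bigr => k _; rewrite mulrzDr. Qed.

Lemma lincombzN n : lincombz (fun k => - n k) = - lincombz n.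
Proof. by rewrite -sumrN; apply: eq_bigr => k _; rewrite mulrNz. Qed.

Lemma lincombz0 : lincombz (fun=> 0) = 0.
Proof. by rewrite /lincombz big1 // => k _; rewrite mulr0z. Qed.

Lemma lincombzMz a n : lincombz (fun k => a * n k) = lincombz n *~ a.
Proof. by rewrite mulrz_suml; apply: eq_bigr => k _; rewrite mulrC mulrzA. Qed.

Lemma lincombz_double n : lincombz (fun k => 2 * n k) = lincombz n *+ 2.
Proof. exact: lincombzMz. Qed.

Definition segc i j : nat -> int := fun k => (i <= k <= j)%N%:Z.

Lemma lincombz_seg i j : (0 < i)%N -> (j <= r)%N -> lincombz (segc i j) = seg alpha i j.
Proof.
move=> i0 jr; rewrite /lincombz /seg.
rewrite [RHS](big_nat_widen _ _ r.+1) ?ltnS // [RHS](big_nat_widenl _ 1) //.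
rewrite [RHS]big_mkcond /=; apply: eq_bigr => k _.
by rewrite /segc ltnS andbC; case: ifP => _; rewrite ?mulr1z ?mulr0z.
Qed.

Lemma lincombz_unit i : vertex r i -> lincombz (unitc i) = alpha i.
Proof.
move=> ri; rewrite /lincombz (bigD1_seq i) ?iota_uniq ?mem_index_iota //=.
by rewrite /unitc eqxx mulr1z big1 ?addr0 // => k /negPf ->; rewrite mulr0z.
Qed.

Definition pm_eq n f : Prop :=
  (forall k, vertex r k -> n k = f k) \/ (forall k, vertex r k -> n k = - f k).

Lemma pm_lincombz n f : pm_eq n f -> lincombz n = lincombz f \/ - lincombz n = lincombz f.
Proof.
move=> [] E; [left|right]; first exact: eq_lincombz.
by rewrite (eq_lincombz E) lincombzN opprK.
Qed.

Lemma pm_fam1 n l (F : nat -> int) (f : nat -> V) i :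
  (1 <= i <= l)%N -> pm_eq n F -> lincombz F = f i ->
  pm (fam1 l f) (lincombz n).
Proof. by move=> il /pm_lincombz[] E fE; [left|right]; exists i; rewrite // E. Qed.

Lemma pm_fam2 n l (F : nat -> int) (f : nat -> nat -> V) i j :
  (1 <= i)%N -> (i < j)%N -> (j <= l)%N ->
  pm_eq n F -> lincombz F = f i j ->
  pm (fam2 l f) (lincombz n).
Proof. by move=> i0 ij jl /pm_lincombz[] E fE; [left|right]; exists i, j; rewrite E. Qed.

Section Members.
Variable Q : (nat -> int) -> Prop.
Hypothesis Q_opp : forall n, Q n -> Q (fun k => - n k).

Lemma fam1_pm l (F : nat -> nat -> int) (f : nat -> V) x :
  (forall i, (1 <= i <= l)%N -> Q (F i) /\ lincombz (F i) = f i) ->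
  pm (fam1 l f) x -> exists2 n, Q n & x = lincombz n.
Proof.
move=> H [] [i /H[QF FE] xE]; first by exists (F i); rewrite // FE.
by exists (fun k => - F i k); [exact: Q_opp|rewrite lincombzN FE -xE opprK].
Qed.

Lemma fam2_pm l (F : nat -> nat -> nat -> int) (f : nat -> nat -> V) x :
  (forall i j, (1 <= i)%N -> (i < j)%N -> (j <= l)%N -> Q (F i j) /\ lincombz (F i j) = f i j) ->
  pm (fam2 l f) x -> exists2 n, Q n & x = lincombz n.
Proof.
move=> H [] [i [j [i0 ij jl xE]]]; have [QF FE] := H i j i0 ij jl.
  by exists (F i j); rewrite // FE.
by exists (fun k => - F i j k); [exact: Q_opp|rewrite lincombzN FE -xE opprK].
Qed.
End Members.

End RootTable.

(** * Reality conditions in the coordinates e_i *)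

Section RealCoefficients.
Variable r : nat.
Implicit Types (n : nat -> int) (x : nat -> int).

Local Notation cA := (cartan_int (dynkin_of FamA r)).
Local Notation cB := (cartan_int (dynkin_of FamB r)).
Local Notation cC := (cartan_int (dynkin_of FamC r)).
Local Notation cD := (cartan_int (dynkin_of FamD r)).

(** The black tails of the B, C and D diagrams will amount to [zero_beyond], and alternating black
    vertices to [paired]. *)
Definition zero_beyond l x : Prop := forall k, (l < k <= r)%N -> x k = 0.
Definition paired l x : Prop :=
  (forall m, (0 < m <= l)%N -> x (2 * m - 1)%N = x (2 * m)%N) /\ zero_beyond (2 * l) x.

Lemma zero_beyondP l x :
  (forall k, (l < k < r)%N -> x k = x k.+1) -> ((l < r)%N -> x r = 0) -> zero_beyond l x.
Proof.
move=> xS xr k /andP[lk kr]; have lr := leq_trans lk kr.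
move: lk; rewrite -(subKn kr); elim: (r - k)%N => [|m IHm] lm.
  by rewrite subn0 xr.
rewrite xS; last by lia.
have [mr|mr] := leqP r m; first by lia.
by have -> : (r - m.+1).+1 = (r - m)%N by [lia]; apply: IHm; lia.
Qed.

(** In coordinates the simple coroots are differences x_k - x_{k+1}; only the last one depends on
    the type: 2 x_r, x_r and x_{r-1} + x_r for B, C and D. *)
Lemma pairingB_coord n k : vertex r k -> pairing r cB n k =
  if k == r then 2 * coordB r n r else coordB r n k - coordB r n k.+1.
Proof.
move=> rk; rewrite pairingB // /coordB; have [->|kr] := eqVneq k r.
  by rewrite (@ext0_out _ _ r.+1) ?/vertex ?ltnn ?andbF //; lia.
by rewrite /=; lia.
Qed.

Lemma pairingC_coord n k : vertex r k -> pairing r cC n k =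
  if k == r then coordC r n r else coordC r n k - coordC r n k.+1.
Proof.
move=> rk; rewrite pairingC // /coordC eqxx; have [->|kr] := eqVneq k r.
  by rewrite (@ext0_out _ _ r.+1) ?/vertex ?ltnn ?andbF //; lia.
by rewrite /=; lia.
Qed.

Lemma pairingD_coord n k : (2 < r)%N -> vertex r k -> pairing r cD n k =
  if k == r then coordD r n r.-1 + coordD r n r else coordD r n k - coordD r n k.+1.
Proof.
move=> r2 rk; rewrite pairingD_family // /coordD eqxx.
have -> : (r.-1 == r) = false by lia.
have -> : (r.-1.+1 == r) = true by lia.
have [->|kr] := eqVneq k r.
  rewrite (@ext0_out _ _ r.+1) ?/vertex ?ltnn ?andbF //.
  have -> : (r.+1 == r) = false by lia.
  by have -> : (r.+2 == r) = false by [lia]; rewrite /=; lia.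
have [<-|kr1] := eqVneq k.+1 r; last by have [<-|kr2] := eqVneq k.+2 r; rewrite /=; lia.
by have -> : (k.+2 == k.+1) = false by [lia]; rewrite /=; lia.
Qed.

Lemma pattern_beyond M l x : signed_pattern M r x -> zero_beyond l x -> (0 \notin M) ->
  (exists i j s t, [/\ (1 <= i)%N, (i < j)%N, (j <= l)%N & is_sign s /\ is_sign t /\
     forall k, vertex r k -> x k = s * (k == i)%:Z + t * (k == j)%:Z]) \/
  (exists i s m, [/\ (1 <= i <= l)%N, is_sign s, m \in M &
     forall k, vertex r k -> x k = s * m * (k == i)%:Z]).
Proof.
move=> xP x0 M0.
have small k : vertex r k -> x k != 0 -> (1 <= k <= l)%N.
  rewrite /vertex => rk xk; case/andP: (rk) => -> kr /=; rewrite leqNgt.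
  by apply: contraNN xk => lk; rewrite x0 // lk.
case: xP => [i j s t ri rj ij ss st xE|i s m ri ss mM xE]; last first.
  right; exists i, s, m; split=> //; apply: small => //.
  rewrite xE // eqxx mulr1; have : m != 0 by apply: contraNneq M0 => <-.
  by case: ss => -> m0; rewrite ?mul1r ?mulN1r ?oppr_eq0.
left; have il : (1 <= i <= l)%N.
  by apply: small; rewrite // xE // eqxx (negPf ij) mulr1 mulr0 addr0; case: ss => ->.
have jl : (1 <= j <= l)%N.
  by apply: small; rewrite // xE // eqxx [j == i]eq_sym (negPf ij) mulr1 mulr0 add0r; case: st => ->.
have [ij'|ij'] := ltnP i j; first by exists i, j, s, t; split=> //; lia.
exists j, i, t, s; split; [lia|by move: ij ij'; lia|lia|split=> //; split=> //].
by move=> k rk; rewrite xE // addrC.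
Qed.

(** Nonzero coordinates come in equal adjacent pairs, and a pattern has at most two of them: only
    +-(e_{2m-1} + e_{2m}) remains. *)
Lemma pattern_paired M l x : signed_pattern M r x -> paired l x -> (0 \notin M) ->
  (2 * l <= r)%N -> exists m s, [/\ (1 <= m <= l)%N, is_sign s &
     forall k, vertex r k -> x k = s * (k == 2 * m - 1)%N%:Z + s * (k == 2 * m)%N%:Z].
Proof.
move=> xP [xpair x0] M0 lr.
have partner i : (1 <= i <= 2 * l)%N -> exists m, [/\ (1 <= m <= l)%N,
    x (2 * m - 1)%N = x (2 * m)%N & (i = 2 * m - 1 \/ i = 2 * m)%N].
  (* [uphalf i] is the index m of the pair {2m - 1, 2m} containing i. *)
  move=> il; exists (uphalf i).
  by split; [lia|apply: xpair; lia|lia].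
case: (pattern_beyond xP x0 M0) => [[i [j [s [t [i0 ij jl [ss [st xE]]]]]]]|[i [s [m [il ss mM xE]]]]].
  have [|m [ml mE mi]] := partner i; first by lia.
  move: mE; rewrite !xE ?/vertex; try lia.
  move=> mE; have iE : i = (2 * m - 1)%N /\ j = (2 * m)%N.
    by move: mE; case: ss => ->; case: st => ->; move: mi ij; lia.
  have ts : t = s by move: mE; rewrite !(proj1 iE) !(proj2 iE) !eqxx; lia.
  exists m, s; split=> // k rk; rewrite xE // ts.
  by case: iE => -> ->.
have [|m' [ml mE mi]] := partner i; first by lia.
have m0 : m != 0 by apply: contraNneq M0 => <-.
move: mE; rewrite !xE ?/vertex; try lia.
by move: m0; case: ss => -> m0; case: mi => ->; rewrite eqxx; case: eqP; lia.
Qed.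

End RealCoefficients.

(** * Real roots of the classical types *)

Section ClassicalTables.
Variables (V : zmodType) (alpha : nat -> V) (r l : nat) (Rts : set V).
Variable P : (nat -> int) -> Prop.
Implicit Types (n : nat -> int).

Local Notation cA := (cartan_int (dynkin_of FamA r)).
Local Notation cB := (cartan_int (dynkin_of FamB r)).
Local Notation cC := (cartan_int (dynkin_of FamC r)).
Local Notation cD := (cartan_int (dynkin_of FamD r)).

Definition positive_pairing c : Prop := forall n, (forall k, vertex r k -> 0 <= n k) ->
  (exists2 k, vertex r k & n k != 0) ->
  exists k, [/\ vertex r k, 0 < n k & 0 < pairing r c n k].

Definition real_roots_are T (D := satake_of T r l) : Prop := forall x,
  (exists2 n, real_coef r (cartan_int (satake_dynkin D)) (black D) (arrow D) P n
            & x = lincombz alpha r n)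
  <-> real_root_table alpha T r l Rts x.

Lemma real_coef_opp c b (ar : rel nat) dbl : root_set r c dbl P ->
  forall n, real_coef r c b ar P n -> real_coef r c b ar P (fun k => - n k).
Proof.
move=> Pr n [Pn nb na]; split; first exact: rs_opp Pr _ Pn.
  by move=> k rk bk; rewrite pairingN nb ?oppr0.
by move=> i j ri rj aij; rewrite (na i j).
Qed.

Lemma beyondB b n :
  (forall k, vertex r k -> (b < k)%N -> pairing r cB n k = 0) <-> zero_beyond r b (coordB r n).
Proof.
split=> [n0|x0 k rk lk].
  have E k : vertex r k -> (b < k)%N -> _ := fun rk lk =>
    etrans (esym (pairingB_coord n rk)) (n0 k rk lk).
  apply: zero_beyondP => [k lkr|lr].
    have := E k; rewrite /vertex (_ : (k == r) = false); last by lia.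
    by move=> /(_ _ _)/eqP; rewrite subr_eq0 => h; apply/eqP/h; lia.
  by have := E r; rewrite eqxx /vertex => h; have : 2 * coordB r n r = 0 by [apply: h; lia]; lia.
rewrite pairingB_coord //; case: eqP => [kr|kr]; rewrite !x0 ?mulr0 ?subrr //;
  by move: rk lk kr; rewrite /vertex; lia.
Qed.

Lemma beyondC b n :
  (forall k, vertex r k -> (b < k)%N -> pairing r cC n k = 0) <-> zero_beyond r b (coordC r n).
Proof.
split=> [n0|x0 k rk lk].
  have E k : vertex r k -> (b < k)%N -> _ := fun rk lk =>
    etrans (esym (pairingC_coord n rk)) (n0 k rk lk).
  apply: zero_beyondP => [k lkr|lr].
    have := E k; rewrite /vertex (_ : (k == r) = false); last by lia.
    by move=> /(_ _ _)/eqP; rewrite subr_eq0 => h; apply/eqP/h; lia.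
  by have := E r; rewrite eqxx /vertex => h; apply: h; lia.
rewrite pairingC_coord //; case: eqP => [kr|kr]; rewrite !x0 ?subrr //;
  by move: rk lk kr; rewrite /vertex; lia.
Qed.

(** The assumption on b makes both r - 1 and r black, giving x_{r-1} = x_r and x_{r-1} + x_r = 0.
    This is why the diagram of type DI changes its form when r <= l + 1. *)
Lemma beyondD b n : (2 < r)%N -> (b.+1 < r)%N ->
  (forall k, vertex r k -> (b < k)%N -> pairing r cD n k = 0) <-> zero_beyond r b (coordD r n).
Proof.
move=> r2 lr; split=> [n0|x0 k rk lk].
  have E k : vertex r k -> (b < k)%N -> _ := fun rk lk =>
    etrans (esym (pairingD_coord n r2 rk)) (n0 k rk lk).
  have xS k : (b < k < r)%N -> coordD r n k = coordD r n k.+1.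
    move=> lkr; have := E k; rewrite /vertex (_ : (k == r) = false); last by lia.
    by move=> /(_ _ _)/eqP; rewrite subr_eq0 => h; apply/eqP/h; lia.
  apply: zero_beyondP => // _.
  have := E r; rewrite eqxx /vertex => h.
  have : coordD r n r.-1 + coordD r n r = 0 by apply: h; lia.
  have -> : coordD r n r.-1 = coordD r n r.
    by rewrite xS; [congr coordD|]; lia.
  lia.
rewrite pairingD_coord //; case: eqP => [kr|kr]; rewrite !x0 ?subrr //;
  by move: rk lk kr; rewrite /vertex; lia.
Qed.

Lemma coordB_diff i j k : (0 < i)%N -> (i < j <= r)%N -> vertex r k ->
  coordB r (segc i (j - 1)%N) k = 1 * (k == i)%:Z + -1 * (k == j)%:Z.
Proof. by move=> i0 ij; rewrite /vertex /coordB /ext0 /segc /vertex => rk; if_lia. Qed.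

Lemma coordB_sum i j k : (0 < i)%N -> (i < j <= r)%N -> vertex r k ->
  coordB r (fun m => segc i r m + segc j r m) k = 1 * (k == i)%:Z + 1 * (k == j)%:Z.
Proof. by move=> i0 ij; rewrite /vertex /coordB /ext0 /segc /vertex => rk; if_lia. Qed.

Lemma coordB_single i k : (0 < i <= r)%N -> vertex r k ->
  coordB r (segc i r) k = (k == i)%:Z.
Proof. by move=> i0; rewrite /vertex /coordB /ext0 /segc /vertex => rk; if_lia. Qed.

Lemma coordB_pair m k : (0 < m)%N -> (2 * m <= r)%N -> vertex r k ->
  coordB r (fun p => unitc (2 * m - 1)%N p + 2 * segc (2 * m)%N r p) k
    = 1 * (k == 2 * m - 1)%N%:Z + 1 * (k == 2 * m)%N%:Z.
Proof. by move=> m0 mr; rewrite /vertex /coordB /ext0 /segc /unitc /vertex => rk; if_lia. Qed.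

Lemma coordC_diff i j k : (0 < i)%N -> (i < j <= r)%N -> vertex r k ->
  coordC r (segc i (j - 1)%N) k = 1 * (k == i)%:Z + -1 * (k == j)%:Z.
Proof. by move=> i0 ij; rewrite /vertex /coordC /ext0 /segc /vertex => rk; if_lia. Qed.

Lemma coordC_sum i j k : (0 < i)%N -> (i < j <= r)%N -> vertex r k ->
  coordC r (fun m => segc i (j - 1)%N m + 2 * segc j (r - 1)%N m + unitc r m) k
    = 1 * (k == i)%:Z + 1 * (k == j)%:Z.
Proof.
move=> i0 ij; rewrite /vertex /coordC /ext0 /segc /vertex /unitc => rk.
have -> : (0 < k <= r)%N = true by lia.
have -> : (0 < k.-1 <= r)%N = (1 < k)%N by lia.
have -> : (k.-1 == r) = false by lia.
have [->|kr] := eqVneq k r; first by if_lia.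
by if_lia.
Qed.

Lemma coordC_single i k : (0 < i <= r)%N -> vertex r k ->
  coordC r (fun m => 2 * segc i (r - 1)%N m + unitc r m) k = 1 * 2 * (k == i)%:Z.
Proof.
by move=> i0; rewrite /vertex /coordC /ext0 /segc /vertex /unitc => rk; if_lia.
Qed.

Lemma coordC_pair m k : (0 < m)%N -> (2 * m <= r)%N -> vertex r k ->
  coordC r (fun p => unitc (2 * m - 1)%N p + 2 * segc (2 * m)%N (r - 1)%N p + unitc r p) k
    = 1 * (k == 2 * m - 1)%N%:Z + 1 * (k == 2 * m)%N%:Z.
Proof.
move=> m0 mr; rewrite /vertex /coordC /ext0 /segc /vertex /unitc => rk.
have -> : (0 < k <= r)%N = true by lia.
have -> : (0 < k.-1 <= r)%N = (1 < k)%N by lia.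
have -> : (k.-1 == r) = false by lia.
have [->|kr] := eqVneq k r; first by if_lia.
by if_lia.
Qed.

Lemma coordD_diff i j k : (0 < i)%N -> (i < j <= r)%N -> vertex r k ->
  coordD r (segc i (j - 1)%N) k = 1 * (k == i)%:Z + -1 * (k == j)%:Z.
Proof. by move=> i0 ij; rewrite /vertex /coordD /ext0 /segc /vertex => rk; if_lia. Qed.

Lemma coordD_sum i j k : (2 < r)%N -> (0 < i)%N -> (i < j <= r)%N -> vertex r k ->
  coordD r (fun m => segc i (r - 2)%N m + segc j r m) k = 1 * (k == i)%:Z + 1 * (k == j)%:Z.
Proof. by move=> r2 i0 ij; rewrite /vertex /coordD /ext0 /segc /vertex => rk; if_lia. Qed.

Let pair_pattern M x i j s t : (0 < i)%N -> (i < j <= l)%N -> (l <= r)%N ->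
  is_sign s -> is_sign t ->
  (forall k, vertex r k -> x k = s * (k == i)%:Z + t * (k == j)%:Z) ->
  signed_pattern M r x /\ zero_beyond r l x.
Proof.
move=> i0 ij lr ss st xE; split.
  by apply: (@SignedPair _ _ _ i j s t); rewrite /vertex //; lia.
by move=> k lk; rewrite xE ?/vertex; lia.
Qed.

Let paired_pattern M x m s : (0 < m <= l)%N -> (2 * l <= r)%N -> is_sign s ->
  (forall k, vertex r k -> x k = s * (k == 2 * m - 1)%N%:Z + s * (k == 2 * m)%N%:Z) ->
  signed_pattern M r x /\ paired r l x.
Proof.
move=> ml lr ss xE; split.
  by apply: (@SignedPair _ _ _ (2 * m - 1)%N (2 * m)%N s s); rewrite /vertex //; lia.
by split=> [m' ml'|k lk]; rewrite !xE ?/vertex; lia.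
Qed.

Let unit_pattern M x i s m : (0 < i <= l)%N -> (l <= r)%N -> is_sign s -> m \in M ->
  (forall k, vertex r k -> x k = s * m * (k == i)%:Z) ->
  signed_pattern M r x /\ zero_beyond r l x.
Proof.
move=> il lr ss mM xE; split.
  by apply: (@SignedUnit _ _ _ i s m); rewrite /vertex //; lia.
move=> k lk; rewrite xE ?/vertex; last by lia.
by have -> : (k == i) = false by [lia]; rewrite mulr0.
Qed.

Lemma beyond_table_B bc n : (l <= r)%N ->
  patternB r (unit_multiples bc) n -> zero_beyond r l (coordB r n) ->
  (exists i j, [/\ (0 < i)%N, (i < j)%N, (j <= l)%N &
     pm_eq r n (segc i (j - 1)%N) \/ pm_eq r n (fun k => segc i r k + segc j r k)]) \/
  (exists2 i, (0 < i <= l)%N &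
     pm_eq r n (segc i r) \/ bc /\ pm_eq r n (fun k => 2 * segc i r k)).
Proof.
move=> lr nP n0; have M0 : 0 \notin unit_multiples bc by case: bc {nP}.
case: (pattern_beyond nP n0 M0) => [[i [j [s [t [i0 ij jl [ss [st xE]]]]]]]|
    [i [s [m [il ss mM xE]]]]]; [left|right].
  have nE := patternB_coef _ _ xE; rewrite /vertex /psum in nE.
  have {}nE := nE _ _; exists i, j; split=> //.
  case: ss {xE} nE => ->; case: st => -> nE; [right; left|left; left|left; right|right; right] => k rk;
    rewrite nE //; move: rk; rewrite /vertex /segc; lia.
exists i => //; have nE k : vertex r k -> n k = s * m * (i <= k)%N%:Z.
  move=> rk; rewrite (@patternB_coef r n i i (s * m) 0) ?/psum ?mul0r ?addr0 //;
    rewrite ?/vertex; try lia.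
  by move=> k' rk'; rewrite xE // mul0r addr0.
have [mE|[bcT mE]] : m = 1 \/ bc /\ m = 2.
    by case: bc mM {nP M0}; rewrite !inE; [case/orP|] => /eqP ->; [left|right|left].
  left; rewrite mE in nE.
  by case: ss nE => -> nE; [left|right] => k rk; rewrite nE //; move: rk; rewrite /vertex /segc; lia.
right; split=> //; rewrite mE in nE.
by case: ss nE => -> nE; [left|right] => k rk; rewrite nE //; move: rk; rewrite /vertex /segc; lia.
Qed.

Hypothesis lr : (l <= r)%N.

(** Exchanges the unknown root set [P] for a standard model, where membership is explicit. *)
Let PE c dbl (S : (nat -> int) -> Prop) : (forall k, c k k = 2) ->
  root_set r c dbl P -> positive_pairing c -> root_set r c dbl S ->
  forall n, P n <-> S n.
Proof. by move=> c2 Pr c_pos Sr n; apply: root_set_unique Pr Sr. Qed.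

Let sign1 : is_sign 1. Proof. by left. Qed.
Let signN1 : is_sign (-1). Proof. by right. Qed.
Hint Resolve sign1 signN1 : core.

Lemma real_coef_B bc n (b := fun i => (l < i)%N) (ar := fun _ _ : nat => false) :
  root_set r cB (fun i => bc && (i == r)) P -> positive_pairing cB ->
  real_coef r cB b ar P n <->
    patternB r (unit_multiples bc) n /\ zero_beyond r l (coordB r n).
Proof.
move=> Pr c_pos; have PS := PE (@cartan_int_diag _) Pr c_pos (patternB_root_set r bc).
split=> [[/PS nP /(beyondB l) n0 _]|[/PS nP /(beyondB l) n0]]; first by split.
by split.
Qed.

Let member_B_diff M i j : (0 < i)%N -> (i < j <= l)%N ->
  patternB r M (segc i (j - 1)%N) /\ zero_beyond r l (coordB r (segc i (j - 1)%N)).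
Proof.
move=> i0 ij; apply: (@pair_pattern _ _ i j 1 (-1)) => // k.
by apply: coordB_diff => //; lia.
Qed.

Let member_B_sum M i j (F := fun k => segc i r k + segc j r k) :
  (0 < i)%N -> (i < j <= l)%N -> patternB r M F /\ zero_beyond r l (coordB r F).
Proof.
move=> i0 ij; apply: (@pair_pattern _ _ i j 1 1) => // k.
by apply: coordB_sum => //; lia.
Qed.

Let member_B_single bc i : (0 < i <= l)%N ->
  patternB r (unit_multiples bc) (segc i r) /\ zero_beyond r l (coordB r (segc i r)).
Proof.
move=> il; apply: (@unit_pattern _ _ i 1 1) => //; first by case: bc; rewrite !inE.
by move=> k rk; rewrite !mul1r coordB_single //; lia.
Qed.

Lemma table_BI : root_set r cB pred0 P -> positive_pairing cB -> real_roots_are BI.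
Proof.
move=> Pr c_pos x; have QE n := @real_coef_B false n Pr c_pos.
have Qopp := @real_coef_opp cB (fun i => (l < i)%N) (fun _ _ => false) pred0 Pr.
split=> [[n /QE[nP n0] ->]|].
  case: (beyond_table_B lr nP n0) => [[i [j [i0 ij jl [nE|nE]]]]|[i il [nE|[]//]]].
  - by left; left; apply: (pm_fam2 i0 ij jl nE); apply: lincombz_seg; lia.
  - left; right; apply: (pm_fam2 i0 ij jl nE); rewrite lincombzD.
    by rewrite !lincombz_seg //; lia.
  - by right; apply: (pm_fam1 il nE); apply: lincombz_seg; lia.
case=> [[]|].
- apply: (fam2_pm (F := fun i j => segc i (j - 1)%N) Qopp) => i j i0 ij jl; split.
    by apply/QE/member_B_diff; rewrite ?ij.
  by apply: lincombz_seg; lia.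
- apply: (fam2_pm (F := fun i j k => segc i r k + segc j r k) Qopp) => i j i0 ij jl.
  split; last by rewrite lincombzD !lincombz_seg //; lia.
  by apply/QE/member_B_sum; rewrite ?ij.
apply: (fam1_pm (F := fun i => segc i r) Qopp) => i il.
split; last by apply: lincombz_seg; lia.
by apply/QE/member_B_single.
Qed.

Lemma table_BCI : root_set r cB (fun i => i == r) P -> positive_pairing cB ->
  real_roots_are BCI.
Proof.
move=> Pr c_pos x; have QE n := @real_coef_B true n Pr c_pos.
have Qopp := @real_coef_opp cB (fun i => (l < i)%N) (fun _ _ => false) _ Pr.
split=> [[n /QE[nP n0] ->]|].
  case: (beyond_table_B lr nP n0) => [[i [j [i0 ij jl [nE|nE]]]]|[i il [nE|[_ nE]]]].
  - by left; left; left; apply: (pm_fam2 i0 ij jl nE); apply: lincombz_seg; lia.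
  - left; left; right; apply: (pm_fam2 i0 ij jl nE); rewrite lincombzD.
    by rewrite !lincombz_seg //; lia.
  - by left; right; apply: (pm_fam1 il nE); apply: lincombz_seg; lia.
  - by right; apply: (pm_fam1 il nE); rewrite lincombz_double lincombz_seg //; lia.
case=> [[[]|]|].
- apply: (fam2_pm (F := fun i j => segc i (j - 1)%N) Qopp) => i j i0 ij jl; split.
    by apply/QE/member_B_diff; rewrite ?ij.
  by apply: lincombz_seg; lia.
- apply: (fam2_pm (F := fun i j k => segc i r k + segc j r k) Qopp) => i j i0 ij jl.
  split; last by rewrite lincombzD !lincombz_seg //; lia.
  by apply/QE/member_B_sum; rewrite ?ij.
- apply: (fam1_pm (F := fun i => segc i r) Qopp) => i il.
  split; last by apply: lincombz_seg; lia.
  by apply/QE/member_B_single.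
apply: (fam1_pm (F := fun i k => 2 * segc i r k) Qopp) => i il.
split; last by rewrite lincombz_double lincombz_seg //; lia.
apply/QE; apply: (@unit_pattern _ _ i 1 2) => // k rk.
rewrite -(@coordB_single i k) //; last by lia.
by rewrite /coordB !ext0_scale mul1r mulrBr.
Qed.

(** A black vertex 2m - 1 forces x_{2m-1} = x_{2m}, and the black tail after 2l kills the other
    coordinates, so real roots are the paired patterns. *)
Lemma table_BCIII : root_set r cB (fun i => i == r) P -> positive_pairing cB ->
  (2 * l <= r)%N -> real_roots_are BCIII.
Proof.
move=> Pr c_pos lr2 x.
have PS := PE (@cartan_int_diag _) Pr c_pos (patternB_root_set r true).
pose b i := ~~ (~~ odd i && (i <= 2 * l)%N).
have QE n : real_coef r cB b (fun _ _ => false) P n <->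
    patternB r (unit_multiples true) n /\ paired r l (coordB r n).
  split=> [[/PS nP n0 _]|[/PS nP [npair /(beyondB (2 * l)%N) n0]]]; split=> //.
    split; last by apply/beyondB => k rk lk; apply: n0 => //; rewrite /b; lia.
    move=> m ml; have rm : vertex r (2 * m - 1)%N by rewrite /vertex; lia.
    have := n0 _ rm; rewrite /b pairingB_coord // => /(_ _)/eqP.
    have -> : (2 * m - 1 == r)%N = false by lia.
    rewrite subr_eq0 (_ : (2 * m - 1).+1 = 2 * m)%N; last by lia.
    by move=> h; apply/eqP/h; lia.
  move=> k rk bk; have [lk|kl] := ltnP (2 * l) k; first exact: n0.
  rewrite pairingB_coord // (_ : k == r = false); last by move: rk bk; rewrite /b /vertex; lia.
  have /npair : (0 < uphalf k <= l)%N by move: rk bk; rewrite /b /vertex; lia.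
  have -> : (2 * uphalf k - 1 = k)%N by move: bk; rewrite /b; lia.
  have -> : (2 * uphalf k = k.+1)%N by move: bk; rewrite /b; lia.
  by move=> ->; rewrite subrr.
have Qopp := @real_coef_opp cB b (fun _ _ => false) _ Pr.
split=> [[n /QE[nP npair] ->]|].
  have [|m [s [ml ss xE]]] := pattern_paired nP npair _ lr2; first by [].
  have nE k : vertex r k -> n k = psum (2 * m - 1)%N (2 * m)%N s s k.
    by apply: patternB_coef; rewrite ?/vertex //; lia.
  apply: (pm_fam1 (F := fun k => unitc (2 * m - 1)%N k + 2 * segc (2 * m)%N r k) ml).
    by case: ss nE {xE} => -> nE; [left|right] => k rk; rewrite nE //; move: rk;
       rewrite /vertex /psum /unitc /segc; lia.
  rewrite lincombzD lincombz_unit ?/vertex; last by lia.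
  by rewrite lincombz_double lincombz_seg //; lia.
apply: (fam1_pm (F := fun m k => unitc (2 * m - 1)%N k + 2 * segc (2 * m)%N r k) Qopp) => m ml.
split.
  apply/QE; apply: (@paired_pattern _ _ m 1) => // k rk.
  by apply: coordB_pair => //; lia.
rewrite lincombzD lincombz_unit ?/vertex; last by lia.
by rewrite lincombz_double lincombz_seg //; lia.
Qed.

Lemma table_CI : root_set r cC pred0 P -> positive_pairing cC -> real_roots_are CI.
Proof.
move=> Pr c_pos x; have PS := PE (@cartan_int_diag _) Pr c_pos (patternC_root_set r).
have QE n : real_coef r cC (fun i => l < i)%N (fun _ _ => false) P n <->
    patternC r n /\ zero_beyond r l (coordC r n).
  split=> [[/PS nP /(beyondC l) n0 _]|[/PS nP /(beyondC l) n0]]; first by split.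
  by split.
have Qopp := @real_coef_opp cC (fun i => (l < i)%N) (fun _ _ => false) _ Pr.
split=> [[n /QE[nP n0] ->]|].
  have [|[i [j [s [t [i0 ij jl [ss [st xE]]]]]]]|[i [s [m [il ss]]]]] :=
    pattern_beyond nP n0 _; first by [].
    have nE k : vertex r k -> (if k == r then 2 else 1) * n k = psum i j s t k.
      by apply: patternC_coef; rewrite ?/vertex //; lia.
    left; have pmE : pm_eq r n (segc i (j - 1)%N) \/
        pm_eq r n (fun k => segc i (j - 1)%N k + 2 * segc j (r - 1)%N k + unitc r k).
      case: ss nE {xE} => ->; case: st => -> nE; [right; left|left; left|left; right|right; right];
        by move=> k rk; have := nE k rk; move: rk; rewrite /vertex /psum /segc /unitc;
           case: eqP => [->|kr]; lia.
    case: pmE => {}nE.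
      by left; apply: (pm_fam2 i0 ij jl nE); apply: lincombz_seg; lia.
    right; apply: (pm_fam2 i0 ij jl nE); rewrite !lincombzD lincombz_double.
    by rewrite !lincombz_seg ?lincombz_unit ?/vertex //; lia.
  rewrite inE => /eqP -> xE; right.
  have nE k : vertex r k -> (if k == r then 2 else 1) * n k = psum i i (s * 2) 0 k.
    apply: patternC_coef; rewrite ?/vertex; try lia.
    by move=> k' rk'; rewrite xE // mul0r addr0.
  apply: (pm_fam1 (F := fun k => 2 * segc i (r - 1)%N k + unitc r k) il).
    by case: ss nE {xE} => -> nE; [left|right]; move=> k rk; have := nE k rk; move: rk;
      rewrite /vertex /psum /segc /unitc; case: eqP => [->|kr]; lia.
  by rewrite lincombzD lincombz_double lincombz_seg ?lincombz_unit ?/vertex //; lia.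
case=> [[]|].
- apply: (fam2_pm (F := fun i j => segc i (j - 1)%N) Qopp) => i j i0 ij jl; split.
    apply/QE; apply: (@pair_pattern _ _ i j 1 (-1)); rewrite ?ij // => k.
    by apply: coordC_diff => //; lia.
  by apply: lincombz_seg; lia.
- apply: (fam2_pm (F := fun i j k => segc i (j - 1)%N k + 2 * segc j (r - 1)%N k + unitc r k) Qopp)
    => i j i0 ij jl; split.
    apply/QE; apply: (@pair_pattern _ _ i j 1 1); rewrite ?ij // => k.
    by apply: coordC_sum => //; lia.
  rewrite !lincombzD lincombz_double.
  by rewrite !lincombz_seg ?lincombz_unit ?/vertex //; lia.
apply: (fam1_pm (F := fun i k => 2 * segc i (r - 1)%N k + unitc r k) Qopp) => i il.
split.
  apply/QE; apply: (@unit_pattern _ _ i 1 2) => // k.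
  by apply: coordC_single; lia.
by rewrite lincombzD lincombz_double lincombz_seg ?lincombz_unit ?/vertex //; lia.
Qed.

Lemma table_CIII : root_set r cC pred0 P -> positive_pairing cC ->
  (2 * l <= r)%N -> real_roots_are CIII.
Proof.
move=> Pr c_pos lr2 x; have PS := PE (@cartan_int_diag _) Pr c_pos (patternC_root_set r).
pose b i := ~~ (~~ odd i && (i <= 2 * l)%N).
have QE n : real_coef r cC b (fun _ _ => false) P n <->
    patternC r n /\ paired r l (coordC r n).
  split=> [[/PS nP n0 _]|[/PS nP [npair /(beyondC (2 * l)%N) n0]]]; split=> //.
    split; last by apply/beyondC => k rk lk; apply: n0 => //; rewrite /b; lia.
    move=> m ml; have rm : vertex r (2 * m - 1)%N by rewrite /vertex; lia.
    have := n0 _ rm; rewrite /b pairingC_coord // => /(_ _)/eqP.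
    have -> : (2 * m - 1 == r)%N = false by lia.
    rewrite subr_eq0 (_ : (2 * m - 1).+1 = 2 * m)%N; last by lia.
    by move=> h; apply/eqP/h; lia.
  move=> k rk bk; have [lk|kl] := ltnP (2 * l) k; first exact: n0.
  rewrite pairingC_coord // (_ : k == r = false); last by move: rk bk; rewrite /b /vertex; lia.
  have /npair : (0 < uphalf k <= l)%N by move: rk bk; rewrite /b /vertex; lia.
  have -> : (2 * uphalf k - 1 = k)%N by move: bk; rewrite /b; lia.
  have -> : (2 * uphalf k = k.+1)%N by move: bk; rewrite /b; lia.
  by move=> ->; rewrite subrr.
have Qopp := @real_coef_opp cC b (fun _ _ => false) _ Pr.
have FE m : (0 < m <= l)%N ->
    lincombz alpha r (fun k => unitc (2 * m - 1)%N k + 2 * segc (2 * m)%N (r - 1)%N k + unitc r k)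
    = alpha (2 * m - 1)%N + seg alpha (2 * m) (r - 1) *+ 2 + alpha r.
  move=> ml; rewrite !lincombzD !lincombz_unit ?/vertex; try lia.
  by rewrite lincombz_double lincombz_seg //; lia.
split=> [[n /QE[nP npair] ->]|].
  have [|m [s [ml ss xE]]] := pattern_paired nP npair _ lr2; first by [].
  have nE k : vertex r k ->
      (if k == r then 2 else 1) * n k = psum (2 * m - 1)%N (2 * m)%N s s k.
    by apply: patternC_coef; rewrite ?/vertex //; lia.
  apply: (pm_fam1 (F := fun k => unitc (2 * m - 1)%N k + 2 * segc (2 * m)%N (r - 1)%N k
    + unitc r k) ml); last exact: FE.
  by case: ss nE {xE} => -> nE; [left|right]; move=> k rk; have := nE k rk; move: rk;
      rewrite /vertex /psum /segc /unitc; case: eqP => [->|kr]; lia.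
apply: (fam1_pm (F := fun m k => unitc (2 * m - 1)%N k + 2 * segc (2 * m)%N (r - 1)%N k
    + unitc r k) Qopp) => m ml; split; last exact: FE.
apply/QE; apply: (@paired_pattern _ _ m 1) => // k rk.
by apply: coordC_pair => //; lia.
Qed.

Section TypeD.
Hypothesis r2 : (2 < r)%N.

Let coefD n i j s t : vertex r i -> vertex r j -> (i < j)%N -> is_sign s -> is_sign t ->
  (forall k, vertex r k -> coordD r n k = s * (k == i)%:Z + t * (k == j)%:Z) ->
  (t = - s /\ pm_eq r n (segc i (j - 1)%N)) \/
  (t = s /\ pm_eq r n (fun k => segc i (r - 2)%N k + segc j r k)).
Proof.
move=> ri rj ij ss st xE; have [nE nE1 nE2] := patternD_coef r2 ri rj xE.
move: ri rj nE1 nE2; rewrite /psum /vertex => ri rj nE1 nE2.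
have split3 (p : nat -> int) : (forall k, (k.+1 < r)%N -> (0 < k)%N -> psum i j s t k = p k) ->
    n r = p r -> n r.-1 = p r.-1 -> forall k, vertex r k -> n k = p k.
  move=> h hr hr1 k rk; have [->//|kr] := eqVneq k r.
  have [->//|kr1] := eqVneq k r.-1.
  have krr : (k.+1 < r)%N by move: rk kr kr1; rewrite /vertex; lia.
  by rewrite nE // h //; case/andP: rk.
case: ss nE nE1 nE2 split3 {xE} => ->; case: st => -> nE nE1 nE2 split3;
  [right; split=> //; left|left; split=> //; left|left; split=> //; right|right; split=> //; right];
  by apply: split3 => [k kr k0||]; rewrite /psum /segc; lia.
Qed.

(** For r <= l + 1 nothing is black; when r = l + 1 the arrow says n_{r-1} = n_r, which is x_r = 0.
    So in every case the condition is that the coordinates vanish beyond l. *)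
Lemma table_DI : root_set r cD pred0 P -> positive_pairing cD -> real_roots_are DI.
Proof.
move=> Pr c_pos x; have PS := PE (@cartan_int_diag _) Pr c_pos (patternD_root_set r2).
pose D := satake_of DI r l.
have QE n : real_coef r cD (black D) (arrow D) P n <->
    patternD r n /\ zero_beyond r l (coordD r n).
  rewrite /D /satake_of; case: ifP => lr1 /=; last first.
    have [bD Db] : _ <-> _ := @beyondD l n r2 (ltac:(lia)).
    by split=> [[/PS nP /bD n0 _]|[/PS nP /Db n0]].
  have rr : vertex r r by rewrite /vertex; lia.
  have rr1 : vertex r r.-1 by rewrite /vertex; lia.
  split=> [[/PS nP _ na]|[/PS nP n0]]; split=> //.
    move=> k lk; have kr : k = r by lia.
    rewrite kr /coordD eqxx !ext0E // (na r r.-1) ?subrr //.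
    by rewrite /edges !inE !xpair_eqE; lia.
  move=> i j ri rj /andP[/eqP rl]; have : coordD r n r = 0 by apply: n0; lia.
  rewrite /coordD eqxx !ext0E // => /eqP; rewrite subr_eq0 => /eqP nE.
  rewrite /edges !inE !xpair_eqE => /orP[] /andP[/eqP E1 /eqP E2]; rewrite ?E1 ?E2 subn1 //.
have Qopp := @real_coef_opp cD (black D) (arrow D) _ Pr.
have cDE : cartan_int (satake_dynkin D) = cD by rewrite /D /satake_of; case: ifP.
rewrite -/D cDE; split=> [[n /QE[nP n0] ->]|].
  have [|[i [j [s [t [i0 ij jl [ss [st xE]]]]]]]|[i [s [m [il ss]]]]] :=
    pattern_beyond nP n0 _; [by []| |by rewrite in_nil].
  have [||[_ nE]|[_ nE]] := coefD _ _ ij ss st xE; rewrite ?/vertex; try lia.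
    by left; apply: (pm_fam2 i0 ij jl nE); apply: lincombz_seg; lia.
  by right; apply: (pm_fam2 i0 ij jl nE); rewrite lincombzD !lincombz_seg //; lia.
case.
- apply: (fam2_pm (F := fun i j => segc i (j - 1)%N) Qopp) => i j i0 ij jl; split.
    apply/QE; apply: (@pair_pattern _ _ i j 1 (-1)); rewrite ?ij // => k.
    by apply: coordD_diff => //; lia.
  by apply: lincombz_seg; lia.
apply: (fam2_pm (F := fun i j k => segc i (r - 2)%N k + segc j r k) Qopp) => i j i0 ij jl.
split; last by rewrite lincombzD !lincombz_seg //; lia.
apply/QE; apply: (@pair_pattern _ _ i j 1 1); rewrite ?ij // => k.
by apply: coordD_sum => //; lia.
Qed.

(** Black odd vertices pair the coordinates. If r = 2l + 1 one coordinate is left over, and the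
    arrow between r - 1 and r makes it zero; if r = 2l there is none. *)
Lemma table_DIII : root_set r cD pred0 P -> positive_pairing cD ->
  (r == 2 * l)%N || (r == 2 * l + 1)%N -> real_roots_are DIII.
Proof.
move=> Pr c_pos rl x; have PS := PE (@cartan_int_diag _) Pr c_pos (patternD_root_set r2).
pose D := satake_of DIII r l.
have rr : vertex r r by rewrite /vertex; lia.
have rr1 : vertex r r.-1 by rewrite /vertex; lia.
have pairE n (b := black D) : (forall k, vertex r k -> b k -> pairing r cD n k = 0) <->
    (forall m, (0 < m <= l)%N -> coordD r n (2 * m - 1)%N = coordD r n (2 * m)%N).
  have bE k : vertex r k -> b k = odd k && (k < r)%N.
    by rewrite /vertex /b /D /satake_of => rk; case: ifP => /= rl2; lia.
  split=> [n0 m ml|n0 k rk].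
    have rm : vertex r (2 * m - 1)%N by rewrite /vertex; lia.
    have := n0 _ rm; rewrite bE // pairingD_coord // => /(_ _)/eqP.
    have -> : (2 * m - 1 == r)%N = false by lia.
    rewrite subr_eq0 (_ : (2 * m - 1).+1 = 2 * m)%N; last by lia.
    by move=> h; apply/eqP/h; lia.
  rewrite bE // pairingD_coord // => bk; rewrite (_ : k == r = false); last by lia.
  have /n0 : (0 < uphalf k <= l)%N by move: rk; rewrite /vertex; lia.
  have -> : (2 * uphalf k - 1 = k)%N by lia.
  have -> : (2 * uphalf k = k.+1)%N by lia.
  by move=> ->; rewrite subrr.
have arrE n : (forall i j, vertex r i -> vertex r j -> arrow D i j -> n i = n j) <->
    zero_beyond r (2 * l) (coordD r n).
  rewrite /D /satake_of; case: ifP => rl2 /=.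
    by split=> // _ k; lia.
  split=> [na k lk|n0 i j ri rj].
    have kr : k = r by lia.
    rewrite kr /coordD eqxx !ext0E // (na r r.-1) ?subrr //.
    by rewrite /edges !inE !xpair_eqE; lia.
  have : coordD r n r = 0 by apply: n0; lia.
  rewrite /coordD eqxx !ext0E // => /eqP; rewrite subr_eq0 => /eqP nE.
  by rewrite /edges !inE !xpair_eqE => /orP[] /andP[/eqP E1 /eqP E2]; rewrite ?E1 ?E2 subn1.
have QE n : real_coef r cD (black D) (arrow D) P n <->
    patternD r n /\ paired r l (coordD r n).
  by split=> [[/PS nP /pairE n0 /arrE na]|[/PS nP [/pairE n0 /arrE na]]]; split.
have Qopp := @real_coef_opp cD (black D) (arrow D) _ Pr.
have cDE : cartan_int (satake_dynkin D) = cD by rewrite /D /satake_of; case: ifP.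
rewrite -/D cDE; split=> [[n /QE[nP npair] ->]|].
  have [||m [s [ml ss xE]]] := pattern_paired nP npair; [by []|by lia|].
  have [|||[ts _]|[_ nE]] := coefD _ _ _ ss ss xE; rewrite ?/vertex; try lia.
    by move: ts; case: ss => ->.
  apply: (pm_fam1 ml nE); rewrite lincombzD !lincombz_seg //; lia.
apply: (fam1_pm (F := fun m k => segc (2 * m - 1)%N (r - 2)%N k + segc (2 * m)%N r k) Qopp) => m ml.
split; last by rewrite lincombzD !lincombz_seg //; lia.
apply/QE; apply: (@paired_pattern _ _ m 1) => //; first by lia.
by move=> k rk; apply: coordD_sum => //; lia.
Qed.
End TypeD.

Lemma coordA_diff i j k : (0 < i)%N -> (i < j <= r.+1)%N -> vertex r.+1 k ->
  coordB r (segc i (j - 1)%N) k = (k == i)%:Z - (k == j)%:Z.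
Proof. by move=> i0 ij; rewrite /coordB /ext0 /segc /vertex => rk; if_lia. Qed.

Let pairingA_coord n k : vertex r k -> pairing r cA n k = coordB r n k - coordB r n k.+1.
Proof. by move=> rk; rewrite pairingA // /coordB /=; lia. Qed.

(** A root e_i - e_j with i < j has as coefficients the indicator of [i, j - 1]. The arrows ask for
    symmetry under k -> r + 1 - k, and the black vertices forbid the interval to begin or end among
    them. *)
Lemma table_AIII : root_set r cA pred0 P -> positive_pairing cA ->
  (2 * l <= r + 1)%N -> real_roots_are AIII.
Proof.
move=> Pr c_pos lr2 x; have PS := PE (@cartan_int_diag _) Pr c_pos (patternA_root_set r).
pose D := satake_of AIII r l.
have Qopp := @real_coef_opp cA (black D) (arrow D) _ Pr.
have core n i j : real_coef r cA (black D) (arrow D) P n -> (0 < i)%N -> (i < j <= r.+1)%N ->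
    (forall k, vertex r.+1 k -> coordB r n k = (k == i)%:Z - (k == j)%:Z) ->
    [/\ (1 <= i <= l)%N, j = (r + 2 - i)%N & forall k, vertex r k -> n k = segc i (j - 1)%N k].
  move=> [_ nb na] i0 ij xE.
  have nE k : (0 < k <= r)%N -> n k = (i <= k <= j - 1)%N%:Z.
    by move=> rk; rewrite (patternA_coef _ _ xE) ?/vertex; lia.
  have h1 k : (l + 1 <= k <= r - l)%N ->
      (k == i)%:Z - (k == j)%:Z = (k.+1 == i)%:Z - (k.+1 == j)%:Z :> int.
    move=> lk; have rk : vertex r k by rewrite /vertex; lia.
    have /eqP := nb k rk lk; rewrite pairingA_coord // subr_eq0 => /eqP.
    by rewrite !xE ?/vertex; lia.
  have h2 k : (0 < k <= l)%N -> (i <= k <= j - 1)%N = (i <= r + 1 - k <= j - 1)%N.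
    move=> kl; have [kE|kE] := eqVneq k (r + 1 - k)%N; first by rewrite -kE.
    have : n k = n (r + 1 - k)%N by apply: na; rewrite /vertex /=; lia.
    by rewrite !nE; lia.
  (* If i > l, then either the mirror image of i is at most l, and symmetry puts it in the interval
     although it lies before i, or i is black, and the coordinates at i and i + 1 cannot agree. *)
  have il : (i <= l)%N.
    rewrite leqNgt; apply/negP => li; have [kl|lk] := leqP (r + 1 - i) l.
      have kl' : (0 < r + 1 - i <= l)%N by lia.
      have := h2 _ kl'; rewrite (_ : (r + 1 - (r + 1 - i))%N = i); last by lia.
      by clear -li kl ij i0; lia.
    have li' : (l + 1 <= i <= r - l)%N by lia.
    have := h1 _ li'; rewrite eqxx.
    have -> : (i == j) = false by lia.
    have -> : (i.+1 == i) = false by lia.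
    by case: (i.+1 == j).
  have il' : (0 < i <= l)%N by rewrite i0.
  (* Symmetry at i puts r + 1 - i in the interval; symmetry at i - 1 keeps r + 2 - i out of it.
     Hence j - 1 = r + 1 - i; for i = 1 the bound on j replaces the second fact. *)
  have := h2 _ il'; have e2 : (1 < i)%N -> (i <= r + 2 - i <= j - 1)%N = false.
    move=> i1; have il1 : (0 < i.-1 <= l)%N by lia.
    have := h2 _ il1; rewrite (_ : (r + 1 - i.-1)%N = (r + 2 - i)%N); last by lia.
    by move=> <-; lia.
  move=> e1; split; [by []| |exact: nE].
  by have [i1|i1] := ltnP 1 i; [have := e2 i1|]; clear -e1 ij il i0 i1; lia.
split=> [[n nQ ->]|].
  have [/PS[i [j [ri rj ij xE]]] _ _] := nQ.
  move: ri rj; rewrite /vertex => ri rj.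
  have segE i' : (1 <= i' <= l)%N ->
      lincombz alpha r (segc i' (r + 2 - i' - 1)%N) = seg alpha i' (r + 1 - i').
    by move=> il; rewrite lincombz_seg; [congr seg|..]; lia.
  have [ij'|ij'] := ltnP i j.
    have [il jE nE] := core n i j nQ (ltac:(lia)) (ltac:(lia)) xE.
    by rewrite jE in nE; apply: (pm_fam1 il (or_introl nE)); exact: segE.
  have [|||jl iE nE] := core _ j i (Qopp _ nQ); try lia.
    by move=> k rk; move: (xE k rk); rewrite /coordB !ext0_opp; lia.
  rewrite iE in nE; have nE' : pm_eq r n (segc j (r + 2 - j - 1)%N).
    by right=> k rk; rewrite -nE // opprK.
  by apply: (pm_fam1 jl nE'); exact: segE.
apply: (fam1_pm (F := fun i => segc i (r + 1 - i)%N) Qopp) => i il.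
split; last by apply: lincombz_seg; lia.
have -> : (r + 1 - i = (r + 2 - i) - 1)%N by lia.
have xE k : vertex r.+1 k ->
    coordB r (segc i (r + 2 - i - 1)%N) k = (k == i)%:Z - (k == (r + 2 - i)%N)%:Z.
  by move=> rk; apply: coordA_diff; lia.
split.
- by apply/PS; exists i, (r + 2 - i)%N; split; rewrite ?/vertex //; lia.
- move=> k; rewrite /vertex /= => rk bk; rewrite pairingA_coord // !xE ?/vertex; lia.
- by move=> i' j'; rewrite /vertex /segc /= => ri rj; lia.
Qed.

(** All odd vertices are black, which groups the r + 1 coordinates into equal pairs; the single
    coordinate 1 of e_i - e_j has no partner. *)
Lemma table_AII : root_set r cA pred0 P -> positive_pairing cA ->
  r = (2 * l + 1)%N -> real_roots_are AII.
Proof.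
move=> Pr c_pos rl x; have PS := PE (@cartan_int_diag _) Pr c_pos (patternA_root_set r).
split=> // -[n [/PS[i [j [ri rj ij xE]]] nb _] _].
have h k : (0 < k <= r)%N -> odd k ->
    (k == i)%:Z - (k == j)%:Z = (k.+1 == i)%:Z - (k.+1 == j)%:Z :> int.
  move=> rk ok; have /eqP := nb k rk ok; rewrite pairingA_coord // subr_eq0 => /eqP.
  by rewrite !xE ?/vertex; lia.
move: ri rj ij; rewrite /vertex => ri rj ij.
by have := h i; have := h i.-1; lia.
Qed.

End ClassicalTables.

(** * Root systems given by explicit lists of positive roots *)

Section FiniteRootLists.
Variables (r : nat) (c : nat -> nat -> int).
Implicit Types (s : seq int) (L : seq (seq int)).

Definition coef_of s : nat -> int := fun k => nth 0 s k.-1.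

Definition list_pairing s k : int :=
  foldr (fun j z => coef_of s j * c j k + z) 0 (iota 1 r).

Definition list_reflect k s : seq int :=
  [seq coef_of s j - list_pairing s k * (j == k)%:Z | j <- iota 1 r].

Definition list_unit k : seq int := [seq (j == k)%:Z | j <- iota 1 r].

(** A search by reflecting the newest roots and keeping the nonnegative ones. Nothing is proved
    about it or about the fuel: [closed_root_list] certifies the outcome. *)
Fixpoint generate_roots fuel (L new : seq (seq int)) : seq (seq int) :=
  if fuel is fuel'.+1 then
    let next := undup [seq s' <- [seq list_reflect k s | s <- new, k <- iota 1 r]
                      | all (fun z => 0 <= z) s' & s' \notin L] in
    generate_roots fuel' (L ++ next) next
  else L.

Definition positive_root_list fuel : seq (seq int) :=
  let units := [seq list_unit k | k <- iota 1 r] in generate_roots fuel units units.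

(** Decides that the list together with its negatives is a root set. The last conjunct is [rs_mult]
    for a reduced system: an element supported at one vertex has coefficient 1 there. *)
Definition closed_root_list L : bool :=
  [&& all (fun k => list_unit k \in L) (iota 1 r),
      all (fun s => all (fun k => (list_reflect k s \in L)
        || ([seq - z | z <- list_reflect k s] \in L)) (iota 1 r)) L,
      all (fun s => all (fun k => 0 <= coef_of s k) (iota 1 r)) L,
      all (fun s => has (fun k => coef_of s k != 0) (iota 1 r)) L &
      all (fun s => all (fun k => all (fun j => (j == k) || (coef_of s j == 0)) (iota 1 r)
        ==> (coef_of s k == 1)) (iota 1 r)) L].

Lemma list_pairingE s k : pairing r c (coef_of s) k = list_pairing s k.
Proof.
rewrite /pairing /list_pairing /index_iota subSS subn0.
by elim: (iota 1 r) => [|j t IH]; rewrite ?big_nil ?big_cons //= IH.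
Qed.

Lemma mem_vertices k : (k \in iota 1 r) = vertex r k.
Proof. by rewrite mem_iota add1n. Qed.

Lemma coef_of_map (f : nat -> int) k : vertex r k -> coef_of [seq f j | j <- iota 1 r] k = f k.
Proof.
case/andP=> k0 kr; rewrite /coef_of (nth_map 0%N) ?size_iota ?nth_iota; try lia.
by rewrite add1n prednK.
Qed.

Lemma coef_reflect s k j : vertex r j ->
  coef_of (list_reflect k s) j = reflect_coef r c k (coef_of s) j.
Proof. by move=> rj; rewrite coef_of_map // /reflect_coef list_pairingE. Qed.

Lemma pm_eq_opp n f : pm_eq r n f -> pm_eq r (fun k => - n k) f.
Proof. by move=> [] nE; [right|left] => k rk; rewrite nE // opprK. Qed.

Lemma list_root_set L : closed_root_list L ->
  root_set r c pred0 (fun n => exists2 s, s \in L & pm_eq r n (coef_of s)).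
Proof.
case/and5P=> /allP units /allP refls /allP nneg /allP nz /allP mult; split=> //.
- move=> n n' E [s sL nE]; exists s => //.
  by case: nE => nE; [left|right] => k rk; rewrite -E // nE.
- move=> n k rk [s sL nE].
  have nrE : pm_eq r (reflect_coef r c k n) (coef_of (list_reflect k s)).
    case: nE => nE; [left|right] => j rj; rewrite coef_reflect // /reflect_coef nE //.
      by rewrite (pairing_ext _ _ nE).
    by rewrite (pairing_ext _ _ nE) pairingN opprD mulNr opprK.
  have /allP/(_ k) := refls s sL; rewrite mem_vertices => /(_ rk)/orP[] rL.
    by exists (list_reflect k s).
  exists [seq - z | z <- list_reflect k s] => //.
  have E j : vertex r j -> coef_of [seq - z | z <- list_reflect k s] j
      = - coef_of (list_reflect k s) j.
    by move=> rj; rewrite -map_comp !coef_of_map.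
  by case: nrE => nrE; [right|left] => j rj; rewrite nrE // E // opprK.
- by move=> n [s sL nE]; exists s => //; apply: pm_eq_opp.
- move=> i ri; exists (list_unit i); first by apply: units; rewrite mem_vertices.
  by left=> k rk; rewrite coef_of_map.
- move=> n [s sL nE]; have /allP s0 := nneg s sL.
  by case: nE => nE; [left|right] => k rk; rewrite nE ?oppr_le0 ?s0 ?mem_vertices.
- move=> n [s sL nE]; have /hasP[k] := nz s sL; rewrite mem_vertices => rk sk.
  by exists k => //; case: nE => ->; rewrite ?oppr_eq0.
- move=> i m ri [s sL nE] m0; left.
  have sE k : vertex r k -> k != i -> coef_of s k = 0.
    move=> rk /negPf ki; case: nE => /(_ k rk); rewrite /unitc ki mulr0; first by move=> <-.
    by move=> /eqP; rewrite eq_sym oppr_eq0 => /eqP.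
  have /allP/(_ i) := mult s sL; rewrite mem_vertices => /(_ ri)/implyP h.
  have /eqP s1 : coef_of s i == 1.
    apply: h; apply/allP => j; rewrite mem_vertices => rj.
    by case: eqP => //= /eqP ji; rewrite sE.
  by case: nE => /(_ i ri); rewrite /unitc eqxx s1; lia.
Qed.

Section Tables.
Variables (b : pred nat) (ar : rel nat).

Definition list_real s : bool :=
  all (fun k => b k ==> (list_pairing s k == 0)) (iota 1 r) &&
  all (fun i => all (fun j => ar i j ==> (coef_of s i == coef_of s j)) (iota 1 r)) (iota 1 r).

Definition real_list_matches L (cs : seq (seq nat)) : bool :=
  let zs := [seq map Posz c' | c' <- cs] in
  [&& all (fun c' => size c' == r) cs,
      all (fun s => list_real s ==> (s \in zs)) L &
      all (fun s => (s \in L) && list_real s) zs].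

Lemma list_realP P s : P (coef_of s) -> reflect (real_coef r c b ar P (coef_of s)) (list_real s).
Proof.
move=> Ps; apply: (iffP andP) => [[/allP sb /allP sa]|[_ sb sa]]; split=> //.
- move=> k rk bk; rewrite list_pairingE; apply/eqP.
  by have := sb k; rewrite mem_vertices rk bk => /(_ isT).
- move=> i j ri rj aij; have := sa i; rewrite mem_vertices ri => /(_ isT)/allP/(_ j).
  by rewrite mem_vertices rj aij => /(_ isT)/eqP.
- apply/allP => k; rewrite mem_vertices => rk; apply/implyP => bk.
  by rewrite -list_pairingE sb.
apply/allP => i; rewrite mem_vertices => ri; apply/allP => j; rewrite mem_vertices => rj.
by apply/implyP => aij; rewrite (sa i j).
Qed.

Lemma list_real_table (V : zmodType) (alpha : nat -> V) P L cs :
  root_set r c pred0 P -> positive_pairing r c -> (forall k, c k k = 2) ->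
  closed_root_list L -> real_list_matches L cs ->
  forall x, (exists2 n, real_coef r c b ar P n & x = lincombz alpha r n) <->
            pm (lincombs alpha cs) x.
Proof.
move=> Pr c_pos c2 Lc /and3P[/allP csr /allP Lcs /allP csL] x.
have PS n := @root_set_unique _ _ _ (fun k _ => c2 k) c_pos _ _ n Pr (list_root_set Lc).
have Qopp := @real_coef_opp r P c b ar _ Pr.
have Qext n n' : (forall k, vertex r k -> n k = n' k) ->
    real_coef r c b ar P n -> real_coef r c b ar P n'.
  move=> E [Pn nb na]; split=> [|k rk bk|i j ri rj aij].
  - exact: (rs_ext Pr) E Pn.
  - by rewrite -(pairing_ext _ _ E) nb.
  - by rewrite -!E // (na i j).
have csE c' : c' \in cs -> lincomb alpha c' = lincombz alpha r (coef_of (map Posz c')).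
  move=> /csr/eqP sc; rewrite /lincomb /lincombz big_add1 /= big_mkord sc.
  apply: eq_bigr => k _; by rewrite /coef_of /= (nth_map 0%N) ?sc ?ltn_ord.
have csQ c' : c' \in cs -> real_coef r c b ar P (coef_of (map Posz c')).
  move=> cc; have /csL/andP[sL sr] : map Posz c' \in [seq map Posz c' | c' <- cs].
    exact: map_f.
  by apply/list_realP => //; apply/PS; exists (map Posz c') => //; left.
split=> [[n nQ ->]|[] [c' cc xE]].
- have [/PS[s sL nE] _ _] := nQ.
  have sQ : real_coef r c b ar P (coef_of s).
    case: nE => nE; first exact: Qext nQ.
    by apply: Qext (Qopp _ nQ) => k rk; rewrite nE // opprK.
  have /mapP[c' cc sE] : s \in [seq map Posz c' | c' <- cs].
    have [Ps _ _] := sQ.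
    by have /implyP := Lcs s sL; apply; exact: introT (list_realP Ps) sQ.
  by rewrite sE in nE; case: (pm_lincombz alpha nE) => E; [left|right]; exists c';
     rewrite // csE // E.
- by exists (coef_of (map Posz c')); [exact: csQ|rewrite xE csE].
- exists (fun k => - coef_of (map Posz c') k); first exact/Qopp/csQ.
  by rewrite lincombzN -csE // -xE opprK.
Qed.
End Tables.
End FiniteRootLists.

(** * Real roots of the exceptional types, by computation *)

Section ExceptionalTables.
Variables (V : zmodType) (alpha : nat -> V) (r l : nat) (Rts : set V).
Variable P : (nat -> int) -> Prop.

Lemma exceptional_table T cs fuel (D := satake_of T r l) (c := cartan_int (satake_dynkin D)) :
  real_root_table alpha T r l Rts = pm (lincombs alpha cs) ->
  root_set r c pred0 P -> positive_pairing r c ->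
  let L := positive_root_list r c fuel in
  closed_root_list r c L && real_list_matches r c (black D) (arrow D) L cs ->
  real_roots_are alpha r l Rts P T.
Proof.
move=> tabE Pr c_pos L /andP[Lc csL] x; rewrite tabE.
exact: (list_real_table alpha Pr c_pos (@cartan_int_diag _) Lc csL).
Qed.

End ExceptionalTables.

Section ExceptionalChecks.
Variables (V : zmodType) (alpha : nat -> V) (l : nat) (Rts : set V).
Variable P : (nat -> int) -> Prop.

Let exceptional T r (c := cartan_int (satake_dynkin (satake_of T r l))) : Prop :=
  root_set r c pred0 P -> positive_pairing r c -> real_roots_are alpha r l Rts P T.

Lemma table_EII : exceptional EII 6.
Proof.
(* The list of coefficient vectors is read off the table by [erefl]. The fuel 12 exceeds 11, the
   height of the highest root of E6 (and of F4 below). *)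
move=> Pr c_pos; refine (@exceptional_table V alpha 6 l Rts P EII _ 12 erefl Pr c_pos _).
by vm_compute.
Qed.

Lemma table_EIII : exceptional EIII 6.
Proof.
move=> Pr c_pos; refine (@exceptional_table V alpha 6 l Rts P EIII _ 12 erefl Pr c_pos _).
by vm_compute.
Qed.

Lemma table_EVI : exceptional EVI 7.
Proof.
(* The highest root of E7 has height 17. *)
move=> Pr c_pos; refine (@exceptional_table V alpha 7 l Rts P EVI _ 20 erefl Pr c_pos _).
by vm_compute.
Qed.

Lemma table_EVII : exceptional EVII 7.
Proof.
move=> Pr c_pos; refine (@exceptional_table V alpha 7 l Rts P EVII _ 20 erefl Pr c_pos _).
by vm_compute.
Qed.

Lemma table_EIX : exceptional EIX 8.
Proof.
(* The highest root of E8 has height 29. *)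
move=> Pr c_pos; refine (@exceptional_table V alpha 8 l Rts P EIX _ 30 erefl Pr c_pos _).
by vm_compute.
Qed.

Lemma table_FII : exceptional FII 4.
Proof.
move=> Pr c_pos; refine (@exceptional_table V alpha 4 l Rts P FII _ 12 erefl Pr c_pos _).
by vm_compute.
Qed.

Lemma table_FIII : exceptional FIII 4.
Proof.
move=> Pr c_pos; refine (@exceptional_table V alpha 4 l Rts P FIII _ 12 erefl Pr c_pos _).
by vm_compute.
Qed.

(** The table is the empty set, not a family up to sign, so the computation is run with an empty
    list of vectors. *)
Lemma table_EIV : exceptional EIV 6.
Proof.
move=> Pr c_pos D x; have [||QE _] := @list_real_table 6 _ (black (satake_of EIV 6 l))
  (arrow (satake_of EIV 6 l)) V alpha P
  (positive_root_list 6 (cartan_int (satake_dynkin (satake_of EIV 6 l))) 12) [::] Pr c_pos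
  (@cartan_int_diag _) _ _ x.
- by vm_compute.
- by vm_compute.
by split=> // /QE[] [].
Qed.

End ExceptionalChecks.

(** * Two components exchanged by the arrows *)

Section TwiceTables.
Variables (V : zmodType) (alpha : nat -> V) (r l : nat) (Rts : set V).
Variable P : (nat -> int) -> Prop.

(** By induction along the reflections every root is supported on one of the two copies. An arrow
    equates each coefficient with one on the other copy, so a root satisfying the arrow conditions
    would be zero. *)
Lemma table_Twice X (D := satake_of (Twice X) r l) (c := cartan_int (satake_dynkin D)) :
  root_set r c (doubled (satake_dynkin D)) P -> positive_pairing r c -> ~~ odd r ->
  real_roots_are alpha r l Rts P (Twice X).
Proof.
move=> Pr c_pos r_even D' x; split=> // -[n [Pn _ na] _].
set m := r./2; pose low k := (k <= m)%N.
have c0 j k : low j != low k -> c j k = 0.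
  move=> jk; rewrite /c /cartan_int /D /= -/m -/(low j) -/(low k) (negPf jk).
  by case: eqP => // jkE; rewrite jkE eqxx in jk.
pose S (n1 : nat -> int) := exists side, forall k, vertex r k -> low k != side -> n1 k = 0.
have Sunit i : S (unitc i).
  by exists (low i) => k _; rewrite /unitc; have [->|//] := eqVneq k i; rewrite eqxx.
have [side nS] : S n.
  apply: (root_set_ind _ c_pos Pr) Pn => // [k _|n1 n2 E [side nS]|n1 k rk [side nS]|n1 [side nS]|i ri _].
  - exact: cartan_int_diag.
  - by exists side => k rk ks; rewrite -E // nS.
  - exists side => j rj js; rewrite /reflect_coef nS // sub0r /unitc.
    case: eqP => [jk|_]; last by rewrite mulr0 oppr0.
    rewrite /pairing big_nat big1 ?mul0r ?oppr0 // => i ri.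
    have [is_|is_] := eqVneq (low i) side; last by rewrite nS ?mul0r.
    by rewrite c0 ?mulr0 // is_ -jk eq_sym.
  - by exists side => k rk ks; rewrite nS // oppr0.
  - by have [side iS] := Sunit i; exists side => k rk ks; rewrite iS // mulr0.
have [k rk nk] := rs_neq0 Pr Pn; move/eqP: nk; apply.
have [ks|ks] := eqVneq (low k) side; last exact: nS.
pose k' := if low k then (k + m)%N else (k - m)%N.
have rm : r = (2 * m)%N by rewrite /m; lia.
have rk' : vertex r k' by move: rk; rewrite /k' /low /vertex; case: ifP; lia.
have -> : n k = n k'.
  by apply: na => //; rewrite /D /= -/m /k' /low; move: rk; rewrite /vertex; case: ifP; lia.
apply: nS => //; rewrite -ks /k' /low; move: rk; rewrite /vertex.
by case: (leqP k m) => km; lia.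
Qed.

End TwiceTables.

(** * The Satake permutation and the criterion for real roots *)

(** Since 1, 2 and 3 factor only trivially, bond number and direction determine both Cartan
    integers. The same fact bounds the multiples of a root. *)
Lemma small_factors (a b : int) m : a <= 0 -> b <= 0 -> a * b = m.+1%:Z -> (m <= 2)%N ->
  (a = -1 /\ b = - m.+1%:Z) \/ (a = - m.+1%:Z /\ b = -1).
Proof.
move=> a0 b0 + m1; have -> : a = - `|a|%N%:Z by lia.
have -> : b = - `|b|%N%:Z by lia.
move: `|a|%N `|b|%N => x y; rewrite mulrNN => /eqP; rewrite -PoszM eqz_nat => /eqP xy.
have [|] : (x = 1 /\ y = m.+1) \/ (x = m.+1 /\ y = 1)%N; last first.
- by move=> [-> ->]; right.
- by move=> [-> ->]; left.
by case: m m1 xy => [|[|[|//]]] _; case: x => [|[|[|[|x]]]] xy; lia.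
Qed.

Section SimpleRoots.
Variables (C : numFieldType) (V : vectType C) (Rts : set V) (form : V -> V -> C).
(** The form is complex bilinear, hence positive only on a real subspace: [rational] will be the
    functionals real on a_R, and [pos] the lexicographic order. *)
Variables (rational : set V) (pos : V -> bool) (theta : V -> V).
Variables (alpha : nat -> V) (r : nat).

Let pos_root b : Prop := Rts b /\ pos b.
Let simple b : Prop := pos_root b /\
  ~ (exists c d, [/\ pos_root c, pos_root d & b = c + d]).

Hypothesis Rts_finite : exists s : seq V, forall b, Rts b -> b \in s.
Hypothesis Rts_neq0 : forall b, Rts b -> b != 0.
Hypothesis Rts_opp : forall b, Rts b -> Rts (- b).
Hypothesis Rts_span : forall U : {vspace V}, (forall b, Rts b -> b \in U) -> U = fullv.
Hypothesis Rts_rational : forall b, Rts b -> rational b.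
Hypothesis rationalD : forall b c, rational b -> rational c -> rational (b + c).
Hypothesis rationalN : forall b, rational b -> rational (- b).
Hypothesis rational0 : rational 0.

Hypothesis pos0 : ~~ pos 0.
Hypothesis posD : forall b c, pos b -> pos c -> pos (b + c).
Hypothesis pos_total : forall b, Rts b -> pos b || pos (- b).

Hypothesis formC' : forall b c, form b c = form c b.
Hypothesis formD : forall b c d, form b (c + d) = form b c + form b d.
Hypothesis formZ : forall k b c, form b (k *: c) = k * form b c.
Hypothesis form_gt0' : forall b, rational b -> b != 0 -> 0 < form b b.
Hypothesis reflection : forall b c, Rts b -> Rts c ->
  exists2 m : int, 2 * form b c = m%:~R * form b b & Rts (c - b *~ m).

Hypothesis alpha_simple : forall b, simple b <-> exists2 i, vertex r i & b = alpha i.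
Hypothesis dimV : \dim {:V} = r.

Hypothesis thetaD : forall b c, theta (b + c) = theta b + theta c.
Hypothesis thetaK : forall b, theta (theta b) = b.
Hypothesis theta_Rts : forall b, Rts b -> Rts (theta b).
Hypothesis theta_form : forall b c, form (theta b) (theta c) = form b c.
Hypothesis theta_pos : forall b, Rts b -> pos b -> theta b != b -> pos (- theta b).

Local Notation ev := (lincombz alpha r).
Implicit Types (n : nat -> int).

Lemma count_lt (T : eqType) (p q : pred T) s x : (forall y, p y -> q y) ->
  x \in s -> q x -> ~~ p x -> (count p s < count q s)%N.
Proof.
move=> pq + qx px; elim: s => // y s IHs; rewrite inE /= => /orP[/eqP <-|/IHs].
  by rewrite qx (negPf px) add0n add1n ltnS sub_count.
have : (p y <= q y)%N by case: (boolP (p y)) => // /pq ->.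
by lia.
Qed.

Lemma positive_combination b : pos_root b ->
  exists2 n, (forall k, vertex r k -> 0 <= n k) & b = ev n.
Proof.
have [s sP] := Rts_finite.
pose below b x := `[< pos_root x >] && pos (b - x).
have below_lt c d : pos_root c -> pos d -> (count (below c) s < count (below (c + d)%R) s)%N.
  move=> cP dP; apply: (@count_lt _ _ _ _ c).
  - move=> y /andP[yP ycP]; rewrite /below yP /=.
    by rewrite addrAC posD.
  - by apply: sP; case: cP.
  - by rewrite /below; apply/andP; split; [apply/asboolP|rewrite addrC addKr].
  - by rewrite /below subrr negb_and pos0 orbT.
move: {2}(count _ _).+1 (ltnSn (count (below b) s)) => N.
elim: N b => // N IHN b bN bP.
have [bs|] := pselect (simple b).
  have [i ri ->] := (alpha_simple b).1 bs.
  by exists (unitc i); rewrite ?lincombz_unit // => k _; rewrite /unitc; case: eqP.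
move=> /not_andP[//|/contrapT[c [d [cP dP bE]]]].
have cb := below_lt c d cP (proj2 dP); have db := below_lt d c dP (proj2 cP).
rewrite [d + c]addrC -bE in db; rewrite -bE in cb.
have [n n0 cE] := IHN c (leq_trans cb bN) cP.
have [m m0 dE] := IHN d (leq_trans db bN) dP.
exists (fun k => n k + m k); first by move=> k rk; rewrite addr_ge0 ?n0 ?m0.
by rewrite bE cE dE lincombzD.
Qed.

Lemma root_combination b : Rts b -> exists2 n, b = ev n &
  (forall k, vertex r k -> 0 <= n k) \/ (forall k, vertex r k -> n k <= 0).
Proof.
move=> bR; have /orP[bp|bn] := pos_total bR.
  by have [n n0 bE] := positive_combination (conj bR bp); exists n; [|left].
have [n n0 bE] := positive_combination (conj (Rts_opp bR) bn).
exists (fun k => - n k); first by rewrite lincombzN -bE opprK.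
by right=> k rk; rewrite oppr_le0 n0.
Qed.

Lemma lincombzE n : ev n = \sum_(i < r) (n i.+1)%:~R *: alpha i.+1.
Proof.
rewrite /lincombz big_add1 /= big_mkord; apply: eq_bigr => i _.
by rewrite scaler_int.
Qed.

(** Independence comes from counting: the simple roots span, because all roots do, and there are as
    many of them as the dimension. *)
Lemma lincombz_eq0 n : ev n = 0 -> forall k, vertex r k -> n k = 0.
Proof.
pose b := [seq alpha i.+1 | i <- iota 0 r].
have sb : size b = r by rewrite size_map size_iota.
have bE (i : 'I_r) : b`_i = alpha i.+1.
  by rewrite (nth_map 0%N) ?size_iota ?nth_iota.
have bB : basis_of fullv b.
  rewrite basisEdim sb dimV leqnn andbT; rewrite (@Rts_span <<b>>%VS) ?subvv // => c cR.
  have [m -> _] := root_combination cR; rewrite lincombzE.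
  by apply: memv_suml => i _; rewrite memvZ // -bE memv_span // mem_nth ?sb.
move=> n0; have bt : size b == r by rewrite sb.
have bF : free (Tuple bt) := basis_free bB.
have /(elimT (@freeP _ _ _ (Tuple bt))) F := bF.
have := F (fun i => (n i.+1)%:~R); have -> : \sum_(i < r) (n i.+1)%:~R *: (Tuple bt)`_i = ev n.
  by rewrite lincombzE; apply: eq_bigr => i _; rewrite bE.
move=> /(_ n0) nz k /andP[k0 kr]; have kr' : (k.-1 < r)%N by lia.
by have /eqP := nz (Ordinal kr'); rewrite /= prednK // intr_eq0 => /eqP.
Qed.

Lemma lincombz_inj n m : ev n = ev m -> forall k, vertex r k -> n k = m k.
Proof.
move=> E k rk; apply/eqP; rewrite -subr_eq0; apply/eqP.
apply: (@lincombz_eq0 (fun j => n j - m j)) => //.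
by rewrite lincombzD lincombzN E subrr.
Qed.

Lemma alpha_root i : vertex r i -> Rts (alpha i).
Proof. by move=> ri; have [[]] := (alpha_simple (alpha i)).2 (ex_intro2 _ _ i ri erefl). Qed.

Lemma alpha_pos i : vertex r i -> pos (alpha i).
Proof. by move=> ri; have [[]] := (alpha_simple (alpha i)).2 (ex_intro2 _ _ i ri erefl). Qed.

Lemma root_sign n : Rts (ev n) ->
  (forall k, vertex r k -> 0 <= n k) \/ (forall k, vertex r k -> n k <= 0).
Proof.
move=> /root_combination[m /lincombz_inj E [] m0]; [left|right] => k rk;
  by rewrite E ?m0.
Qed.

Lemma rational_lincombz n : rational (ev n).
Proof.
rewrite /lincombz big_nat; elim/big_ind: _ => // i ri.
have ai := Rts_rational (alpha_root ri).
have natP m : rational (alpha i *+ m).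
  by elim: m => [|m IHm]; rewrite ?mulr0n // mulrS; apply: rationalD.
by case: (n i) => m; rewrite ?NegzE ?mulrNz -pmulrn //; apply: rationalN.
Qed.

Lemma formN b c : form b (- c) = - form b c.
Proof. by rewrite -scaleN1r formZ mulN1r. Qed.

Lemma form_lincombz b n : form b (ev n) = \sum_(1 <= k < r.+1) (n k)%:~R * form b (alpha k).
Proof.
rewrite /lincombz; elim/big_rec2: _ => [|k y z _ <-].
  by rewrite -(scale0r (0 : V)) formZ mul0r.
by rewrite formD -scaler_int formZ.
Qed.

Lemma form_alpha_gt0 i : vertex r i -> 0 < form (alpha i) (alpha i).
Proof.
by move=> ri; apply: form_gt0'; [apply/Rts_rational/alpha_root|apply/Rts_neq0/alpha_root].
Qed.

(** * The Cartan matrix recovered from the diagram *)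

Section DynkinDiagram.
Variable d : dynkin.
Let c := cartan_int d.
Hypothesis bond_le3 : forall i j, vertex r i -> vertex r j -> (bond d i j <= 3)%N.
Hypothesis bondP : forall i j, vertex r i -> vertex r j -> i != j ->
  4 * form (alpha i) (alpha j) ^+ 2
    / (form (alpha i) (alpha i) * form (alpha j) (alpha j)) = (bond d i j)%:R.
Hypothesis longerP : forall i j, vertex r i -> vertex r j -> (1 < bond d i j)%N ->
  (form (alpha j) (alpha j) < form (alpha i) (alpha i)) = longer d i j.
Hypothesis doubledP : forall i, vertex r i -> Rts (alpha i *+ 2) <-> doubled d i.

Let P n := Rts (ev n).

(** The two Cartan integers are nonpositive and their product is the bond number; the comparison of
    lengths decides which of them is -1. *)
Lemma cartan_intE i j : vertex r i -> vertex r j ->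
  2 * form (alpha j) (alpha i) = (c i j)%:~R * form (alpha j) (alpha j).
Proof.
move=> ri rj; have fi := form_alpha_gt0 ri; have fj := form_alpha_gt0 rj.
rewrite /c /cartan_int; have [->//|ij] := eqVneq i j.
(* A positive integer a would make alpha_k - a alpha_l a root with coefficients of both signs. *)
have neg k l : vertex r k -> vertex r l -> k != l -> exists2 a : int,
    2 * form (alpha l) (alpha k) = a%:~R * form (alpha l) (alpha l) & a <= 0.
  move=> rk rl kl; have [a aE aR] := reflection (alpha_root rl) (alpha_root rk).
  exists a => //; rewrite leNgt; apply/negP => a0.
  have E : alpha k - alpha l *~ a = ev (fun m => unitc k m - a * unitc l m).
    by rewrite lincombzD lincombzN lincombzMz !lincombz_unit.
  rewrite E in aR; case: (root_sign aR) => [/(_ l rl)|/(_ k rk)];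
    rewrite /unitc eqxx ?(negPf kl) ?[l == k]eq_sym ?(negPf kl); lia.
have [a aE a0] := neg i j ri rj ij.
have [b bE b0] := neg j i rj ri (contra_neq esym ij).
rewrite aE; congr (_%:~R * _).
have sym : (a%:~R * form (alpha j) (alpha j) = b%:~R * form (alpha i) (alpha i) :> C).
  by rewrite -aE -bE formC'.
have abE : a * b = (bond d i j)%:Z.
  apply: (@intr_inj C); rewrite rmorphM -[RHS]/((bond d i j)%:R) -(bondP ri rj ij).
  rewrite -[4]/((2 * 2)%:R) natrM.
  apply: (mulIf (mulf_neq0 (lt0r_neq0 fi) (lt0r_neq0 fj))).
  rewrite divfK ?mulf_neq0 ?lt0r_neq0 //.
  transitivity ((a%:~R * form (alpha j) (alpha j)) * (b%:~R * form (alpha i) (alpha i))).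
    by ring.
  by rewrite -aE -bE (formC' (alpha j)); ring.
have b3 := bond_le3 ri rj; have lo := longerP ri rj.
move: sym abE b3 lo; case: (bond d i j) => [|[|m]] sym abE b3 lo /=.
- have : (a == 0) || (b == 0) by rewrite -mulf_eq0 abE.
  case/orP=> [/eqP->|/eqP b00]; first by rewrite oppr0.
  move: sym; rewrite b00 mul0r => /eqP; rewrite mulf_eq0 (gt_eqF fj) orbF intr_eq0.
  by move=> /eqP ->; rewrite oppr0.
- by case: (small_factors a0 b0 abE isT) => -[->].
have m1 : (m.+1 <= 2)%N by lia.
have {}lo := lo isT; have [[a1 b1]|[a1 b1]] := small_factors a0 b0 abE m1.
  have -> : longer d i j = false.
    rewrite -lo; apply/negP => fji; have := lt_trans fji.
    move/(_ (form (alpha j) (alpha j))); rewrite ltxx => h.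
    suff /h : form (alpha i) (alpha i) < form (alpha j) (alpha j) by [].
    have -> : form (alpha j) (alpha j) = m.+2%:R * form (alpha i) (alpha i).
      by apply: oppr_inj; move: sym; rewrite a1 b1 mulN1r => ->; rewrite -mulNr rmorphN.
    by rewrite ltr_pMl // ltr1n.
  by rewrite a1.
have -> : longer d i j = true.
  rewrite -lo; have -> : form (alpha i) (alpha i) = m.+2%:R * form (alpha j) (alpha j).
    by apply: oppr_inj; move: sym; rewrite a1 b1 mulN1r => <-; rewrite -mulNr rmorphN.
  by rewrite ltr_pMl // ltr1n.
by rewrite a1.
Qed.

Lemma form_pairing n k : vertex r k ->
  2 * form (alpha k) (ev n) = (pairing r c n k)%:~R * form (alpha k) (alpha k).
Proof.
move=> rk; rewrite form_lincombz mulr_sumr /pairing rmorph_sum mulr_suml !big_nat.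
apply: eq_bigr => j rj; rewrite mulrCA cartan_intE // rmorphM /=; ring.
Qed.

Lemma simple_root_set : root_set r c (doubled d) P.
Proof.
split.
- by move=> n n' E; rewrite /P (eq_lincombz _ E).
- move=> n k rk Pn; have [m mE mR] := reflection (alpha_root rk) Pn.
  have pm : pairing r c n k = m.
    apply: (@intr_inj C); apply: (mulIf (lt0r_neq0 (form_alpha_gt0 rk))).
    by rewrite -form_pairing // mE.
  rewrite /P /reflect_coef lincombzD lincombzN lincombzMz lincombz_unit // pm.
  exact: mR.
- by move=> n Pn; rewrite /P lincombzN; apply: Rts_opp.
- by move=> i ri; rewrite /P lincombz_unit //; apply: alpha_root.
- by move=> i ri di; rewrite /P lincombz_double lincombz_unit //; apply/doubledP.
- by move=> n; apply: root_sign.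
- move=> n Pn; apply: contrapT => none; have /eqP := Rts_neq0 Pn; apply.
  rewrite (@eq_lincombz _ _ _ _ (fun=> 0)) ?lincombz0 // => k rk.
  by apply/eqP; apply: contrapT => /negP nk; apply: none; exists k.
- move=> i m ri Pm m0; have ai := alpha_root ri.
  move: Pm; rewrite /P lincombzMz lincombz_unit // => Pm.
  have [z zE _] := reflection Pm ai; have fi := form_alpha_gt0 ri.
  (* The Cartan integer z of alpha_i against its multiple m alpha_i equals 2 / m, so m divides 2. *)
  have mz : 2 * m = z * (m * m).
    apply: (@intr_inj C); apply: (mulIf (lt0r_neq0 fi)); rewrite !rmorphM /=.
    move: zE; rewrite -scaler_int formC' !formZ (formC' _ (alpha i)) formZ.
    by rewrite !mulrA => ->.
  have mn0 : m != 0 by apply: contraNneq (Rts_neq0 Pm) => ->; rewrite mulr0z.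
  have [->|m1] := eqVneq m 1; first by left.
  right; have m2 : m = 2.
    have zm : 2 = z * m by apply: (mulfI mn0); move: mz; lia.
    have z0 : - z <= 0 by move: m0 mn0 zm; nia.
    have m0' : - m <= 0 by rewrite oppr_le0.
    have zm' : - z * - m = 2%:Z by rewrite mulrNN -zm.
    by case: (small_factors z0 m0' zm' isT) => -[_]; move: m1; lia.
  by rewrite m2 in Pm *; split=> //; apply/doubledP.
Qed.

(** The square norm of x = sum n_k alpha_k is the sum of the n_k (x, alpha_k); being positive, it
    has a positive term. *)
Lemma simple_positive_pairing : positive_pairing r c.
Proof.
move=> n n0 [k0 rk0 nk0]; have b0 : ev n != 0.
  by apply: contraNneq nk0 => /lincombz_eq0 ->.
have : 0 < 2 * form (ev n) (ev n).
  by rewrite mulr_gt0 ?ltr0n //; apply: form_gt0' => //; apply: rational_lincombz.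
rewrite form_lincombz mulr_sumr => sum_gt0.
apply: contrapT => none; move: sum_gt0; rewrite lt_def => /andP[s0 sge].
move/negP: s0; apply; rewrite eq_le sge andbT big_nat sumr_le0 // => k rk.
rewrite mulrCA formC' form_pairing // mulrA -rmorphM /= mulr_le0_ge0 //.
  rewrite -[0]/(0%:~R) ler_int leNgt; apply/negP => np; apply: none; exists k.
  have nk : 0 < n k.
    by rewrite lt_def n0 // andbT; apply: contraTneq np => ->; rewrite mul0r ltxx.
  by split=> //; rewrite -(pmulr_rgt0 _ nk).
exact/ltW/form_alpha_gt0.
Qed.

(** * The action of theta on the simple roots *)

Variables (bl : pred nat) (ar : rel nat).
Hypothesis blackP : forall i, vertex r i -> theta (alpha i) = alpha i <-> bl i.
Hypothesis arrowP : forall i j, vertex r i -> vertex r j -> ar i j <->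
  [/\ i != j, ~~ bl i, ~~ bl j & exists2 n, (forall k, vertex r k -> ~~ bl k -> n k = 0)
                                          & - theta (alpha i) - alpha j = ev n].

Let white i : bool := vertex r i && ~~ bl i.

Lemma theta0 : theta 0 = 0.
Proof. by apply: (addrI (theta 0)); rewrite -thetaD !addr0. Qed.

Lemma thetaN b : theta (- b) = - theta b.
Proof. by apply/eqP; rewrite -addr_eq0 -thetaD addNr theta0. Qed.

Lemma thetaMz b (m : int) : theta (b *~ m) = theta b *~ m.
Proof.
have natP k : theta (b *+ k) = theta b *+ k.
  by elim: k => [|k IHk]; rewrite ?mulr0n ?theta0 // !mulrS thetaD IHk.
by case: m => k; [exact: natP|rewrite !NegzE !mulrNz thetaN natP].
Qed.

(** [M] is the matrix of -theta on the simple roots. White rows are nonnegative because -theta of a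
    white simple root is a positive root; black rows are minus the identity. *)
Lemma theta_coefficients : exists M : nat -> nat -> int,
  [/\ forall i, vertex r i -> ev (M i) = - theta (alpha i),
      forall i k, white i -> vertex r k -> 0 <= M i k &
      forall i k, vertex r i -> vertex r k -> bl i -> M i k = - unitc i k].
Proof.
have ex i : exists n, vertex r i -> ev n = - theta (alpha i) /\
    (~~ bl i -> forall k, vertex r k -> 0 <= n k).
  have [ri|nri] := boolP (vertex r i); last by exists (fun=> 0).
  have tR : Rts (- theta (alpha i)) by apply/Rts_opp/theta_Rts/alpha_root.
  have [/(blackP ri) tE|bi] := boolP (bl i).
    exists (fun k => - unitc i k) => _; split=> //.
    by rewrite lincombzN lincombz_unit // tE.
  have tpos : pos (- theta (alpha i)).
    apply: theta_pos; [exact: alpha_root|exact: alpha_pos|].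
    by apply: contra bi => /eqP /(blackP ri).
  have [n n0 nE] := positive_combination (conj tR tpos).
  by exists n => _; split.
have [M MP] := choice ex; exists M; split=> [i ri|i k /andP[ri bi] rk|i k ri rk bi].
- by case: (MP i ri).
- by case: (MP i ri) => _; apply.
have E : ev (M i) = ev (fun k => - unitc i k).
  by rewrite lincombzN lincombz_unit // (proj1 (MP i ri)) (proj2 (blackP ri)).
exact: lincombz_inj E k rk.
Qed.

Lemma ev_sum (I : Type) (s : seq I) (n : I -> nat -> int) :
  ev (fun k => \sum_(i <- s) n i k) = \sum_(i <- s) ev (n i).
Proof.
elim: s => [|i s IHs].
  by rewrite big_nil -(lincombz0 alpha r); apply: eq_lincombz => k _; rewrite big_nil.
rewrite big_cons -IHs -lincombzD; apply: eq_lincombz => k _.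
by rewrite big_cons.
Qed.

Section Permutation.
Variable M : nat -> nat -> int.
Hypothesis ME : forall i, vertex r i -> ev (M i) = - theta (alpha i).
Hypothesis M0 : forall i k, white i -> vertex r k -> 0 <= M i k.
Hypothesis Mbl : forall i k, vertex r i -> vertex r k -> bl i -> M i k = - unitc i k.

Lemma theta_lincombz n :
  - theta (ev n) = ev (fun j => \sum_(1 <= k < r.+1) n k * M k j).
Proof.
rewrite ev_sum [in LHS]/lincombz (big_morph _ thetaD theta0) -sumrN !big_nat.
by apply: eq_bigr => k rk; rewrite thetaMz -mulNrz -(ME rk) -lincombzMz.
Qed.

Lemma column_black k j : vertex r k -> bl k -> white j -> M k j = 0.
Proof.
move=> rk bk /andP[rj bj]; rewrite Mbl // /unitc.
by case: eqP => [jk|_]; rewrite ?oppr0 //; rewrite jk bk in bj.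
Qed.

(** The sum runs over all vertices, but black ones contribute nothing by [column_black], so the
    white block of [M] has square 1. *)
Lemma theta_square k l : white k -> white l ->
  \sum_(1 <= j < r.+1) M k j * M j l = unitc k l.
Proof.
move=> /andP[rk bk] /andP[rl _].
have E : ev (fun j => \sum_(1 <= i < r.+1) M k i * M i j) = ev (unitc k).
  by rewrite -theta_lincombz ME // thetaN thetaK opprK lincombz_unit.
exact: lincombz_inj E l rl.
Qed.

Let term_ge0 k l j : white k -> white l -> vertex r j -> 0 <= M k j * M j l.
Proof.
move=> wk wl rj; have [bj|bj] := boolP (bl j); first by rewrite (column_black rj bj wl) mulr0.
have [rl _] := andP wl; have wj : white j by rewrite /white rj.
by rewrite mulr_ge0 ?M0.
Qed.

Let term_le k l j : white k -> white l -> vertex r j -> M k j * M j l <= unitc k l.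
Proof.
move=> wk wl rj; rewrite -theta_square //.
rewrite (bigD1_seq j) ?iota_uniq ?mem_index_iota //=.
rewrite lerDl big_nat_cond sumr_ge0 // => m /andP[rm _].
exact: term_ge0.
Qed.

Let term_le2 k l j j' : white k -> white l -> vertex r j -> vertex r j' -> j' != j ->
  M k j * M j l + M k j' * M j' l <= unitc k l.
Proof.
move=> wk wl rj rj' jj'; rewrite -theta_square //.
rewrite (bigD1_seq j) ?iota_uniq ?mem_index_iota //= lerD2l.
rewrite big_mkcond (bigD1_seq j') ?iota_uniq ?mem_index_iota //= jj'.
rewrite lerDl big_nat_cond sumr_ge0 // => m /andP[rm _].
by case: ifP => // _; apply: term_ge0.
Qed.

Let row_nonzero k : white k -> exists2 l, white l & M k l != 0 /\ M l k != 0.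
Proof.
move=> wk; apply: contrapT => none; have := theta_square wk wk.
rewrite big_nat big1 ?/unitc ?eqxx // => j rj.
have [bj|bj] := boolP (bl j); first by rewrite (column_black rj bj wk) mulr0.
apply/eqP; apply: contrapT => /negP; rewrite mulf_eq0 negb_or => /andP[kj jk].
by apply: none; exists j; rewrite // /white bj andbT.
Qed.

(** The diagonal entry 1 of the square is a sum of nonnegative integers, so some M i j = M j i = 1.
    A second nonzero entry M i k, followed by a nonzero M k l, would make an off-diagonal entry of
    the square positive, or a diagonal one at least 2. *)
Let row_partner i : white i ->
  exists2 j, white j & (forall k, white k -> M i k = unitc j k) /\ M j i = 1.
Proof.
move=> wi; have [j wj [ij ji]] := row_nonzero wi; exists j => //.
have [[ri _] [rj _]] := (andP wi, andP wj).
have t1 := term_le wi wi rj; rewrite /unitc eqxx in t1.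
have p1 : 0 < M i j by rewrite lt_def ij M0.
have p2 : 0 < M j i by rewrite lt_def ji M0.
have E1 : M i j = 1 by move: t1 p1 p2; nia.
have E2 : M j i = 1 by move: t1 p1 p2; nia.
split=> // k wk; rewrite /unitc; have [->//|kj] := eqVneq k j.
apply/eqP; apply: contrapT => /negP ik; have [rk _] := andP wk.
have p3 : 0 < M i k by rewrite lt_def ik M0.
have [l wl [kl _]] := row_nonzero wk; have [rl _] := andP wl.
have p4 : 0 < M k l by rewrite lt_def kl M0.
have [li|li] := eqVneq l i.
  have := term_le2 wi wi rj rk kj.
  by rewrite E1 E2 /unitc eqxx; move: p3 p4; rewrite li; nia.
have := term_le wi wl rk; rewrite /unitc (negPf li).
by move: p3 p4; nia.
Qed.

(** [row_partner] governs rows only. Columns follow because the white block is a symmetric matrix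
    with entries 0 and 1. *)
Lemma theta_permutation i : white i -> exists2 j, white j & forall k, white k ->
  [/\ M i k = unitc j k, M j k = unitc i k, M k j = unitc i k & M k i = unitc j k].
Proof.
have unitP (p q : nat) : unitc p q = 1 -> q = p by rewrite /unitc; case: eqP.
have row k l : white k -> white l -> M k l = 1 \/ M k l = 0.
  by move=> wk wl; have [k' _ [-> //]] := row_partner wk; rewrite /unitc; case: eqP; [left|right].
have sym k l : white k -> white l -> M k l = 1 -> M l k = 1.
  move=> wk wl; have [k' _ [kE k'k]] := row_partner wk.
  by rewrite kE // => /unitP ->.
have uniq k l l' : white k -> white l -> white l' -> M k l = 1 -> M k l' = unitc l l'.
  move=> wk wl wl'; have [k' _ [kE _]] := row_partner wk.
  by rewrite !kE // => /unitP ->.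
move=> wi; have [j wj [iE ji]] := row_partner wi; exists j => // k wk.
have ij : M i j = 1 by rewrite sym.
split; [exact: iE|exact: uniq|..].
  case: (row k j wk wj) => E; rewrite E; last first.
    apply/esym; rewrite /unitc; case: eqP => // ki.
    by rewrite ki ij in E.
  by have := sym _ _ wk wj E; rewrite (uniq j i k).
case: (row k i wk wi) => E; rewrite E; last first.
  apply/esym; rewrite /unitc; case: eqP => // kj.
  by rewrite kj ji in E.
by have := sym _ _ wk wi E; rewrite (uniq i j k).
Qed.
End Permutation.

(** If theta(x) = -x, invariance of the form gives orthogonality to the roots fixed by theta, and
    comparing coefficients of -theta(x) and x along [M] gives the arrow condition. *)
Theorem real_root_criterion n : Rts (ev n) ->
  theta (ev n) = - ev n <->
  (forall k, vertex r k -> bl k -> pairing r c n k = 0) /\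
  (forall i j, vertex r i -> vertex r j -> ar i j -> n i = n j).
Proof.
have [M [ME M0 Mbl]] := theta_coefficients => nR.
have perm := theta_permutation ME M0 Mbl.
have lin := theta_lincombz ME n.
have column i j : white i -> white j -> (forall k, white k -> M k j = unitc i k) ->
    \sum_(1 <= k < r.+1) n k * M k j = n i.
  move=> wi wj Mj; have [ri _] := andP wi.
  rewrite (bigD1_seq i) ?iota_uniq ?mem_index_iota //=.
  rewrite Mj // /unitc eqxx mulr1 big_nat_cond big1 ?addr0 // => k /andP[rk ki].
  have [bk|bk] := boolP (bl k); first by rewrite (column_black Mbl rk bk wj) mulr0.
  by rewrite Mj /white ?bk ?andbT // /unitc (negPf ki) mulr0.
split=> [nreal|[nb na]].
  split=> [k rk bk|i j ri rj /(arrowP ri rj)[ij bi bj [m m0 mE]]].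
    have f0 : form (alpha k) (ev n) = 0.
      have := theta_form (alpha k) (ev n); rewrite (proj2 (blackP rk)) // nreal formN.
      by move/esym/eqP; rewrite -addr_eq0 -mulr2n mulrn_eq0 => /eqP.
    have := form_pairing n rk; rewrite f0 mulr0 => /esym/eqP.
    by rewrite mulf_eq0 intr_eq0 (gt_eqF (form_alpha_gt0 rk)) orbF => /eqP.
  have wi : white i by rewrite /white ri.
  have wj : white j by rewrite /white rj.
  have MiE k : white k -> M i k = unitc j k.
    move=> /andP[rk bk]; have E : ev (M i) = ev (fun k => unitc j k + m k).
      by rewrite ME // lincombzD lincombz_unit // -mE addrC subrK.
    by rewrite (lincombz_inj E rk) m0 // addr0.
  have [j' wj' pE] := perm i wi; have jE : j' = j.
    have [] := pE j' wj'; rewrite MiE // /unitc eqxx.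
    by case: eqP.
  rewrite jE in pE; rewrite nreal opprK in lin.
  rewrite (lincombz_inj lin rj) -(column i j) // => k wk.
  by case: (pE k wk).
(* [dl] holds the coefficients of -theta(x) - x. At a white j this is n_{p(j)} - n_j, zero by the
   arrow condition or because p fixes j. *)
pose dl j := \sum_(1 <= k < r.+1) n k * M k j - n j.
have dE : ev dl = - theta (ev n) - ev n by rewrite lincombzD lincombzN lin.
have dw j : white j -> dl j = 0.
  move=> wj; have [i wi pE] := perm j wj; rewrite /dl (column i j) //; last first.
    by move=> k /pE[].
  have [->|ij] := eqVneq i j; first by rewrite subrr.
  have [[ri bi] [rj bj]] := (andP wi, andP wj).
  rewrite (na i j) ?subrr //; apply/(arrowP ri rj); split=> //.
  exists (fun k => M i k - unitc j k).
    move=> k rk bk; have [_ -> _ _] := pE k (introT andP (conj rk bk)).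
    by rewrite subrr.
  by rewrite lincombzD lincombzN lincombz_unit // ME.
(* The defect is a combination of black simple roots, and its product with a black alpha_k is -2
   (alpha_k, x) = 0; so it is orthogonal to itself. *)
have d0 : ev dl = 0.
  apply: contrapT => /eqP dn0; have := form_gt0' (rational_lincombz dl) dn0.
  rewrite form_lincombz big_nat big1 ?ltxx // => k rk.
  have [bk|bk] := boolP (bl k); last by rewrite (dw k (introT andP (conj rk bk))) mulr0z mul0r.
  have tE : form (alpha k) (theta (ev n)) = form (alpha k) (ev n).
    by rewrite -[in LHS](proj2 (blackP rk) bk) theta_form.
  rewrite formC' dE formD !formN tE -opprD -mulr2n.
  by rewrite -mulr_natl form_pairing // nb // mul0r oppr0 mulr0.
by move: dE; rewrite d0 => /esym/eqP; rewrite subr_eq0 => /eqP E; rewrite -[in RHS]E opprK.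
Qed.

End DynkinDiagram.
End SimpleRoots.

Lemma bond_satake_le3 T r l i j : (bond (satake_dynkin (satake_of T r l)) i j <= 3)%N.
Proof.
have b1 (b : bool) : (b <= 3)%N by case: b.
have b2 (b b' : bool) : (b * (if b' then 2 else 1) <= 3)%N by case: b b' => [] [].
have b3 (b b' : bool) : (b + 2 * b' <= 3)%N by case: b b' => [] [].
have b4 (b : bool) : (3 * b <= 3)%N by case: b.
have bond_le X s k m : (bond (dynkin_of X s) k m <= 3)%N.
  by case: X; [exact: b1|exact: b2|exact: b2|rewrite /=; case: ifP => _; exact: b1|exact: b2
    |exact: b1|exact: b1|exact: b1|exact: b3|exact: b4].
have -> : satake_dynkin (satake_of T r l) =
    if T is Twice X then dynkin_twice r./2 (dynkin_of X r./2) else dynkin_of (Defs.family T) r.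
  by case: T => //=; case: ifP.
by case: T => [||||||||||||||||||||||| X] //=; case: ifP.
Qed.

(** * All types together *)

Lemma real_root_tables (V : zmodType) (alpha : nat -> V) (T : satake_type) (r l : nat) (Rts : set V)
    (P := fun n => Rts (lincombz alpha r n))
    (d := satake_dynkin (satake_of T r l)) :
  type_ok T r l -> (l <= r)%N -> root_set r (cartan_int d) (doubled d) P ->
  positive_pairing r (cartan_int d) ->
  (forall b, Rts b -> exists n, b = lincombz alpha r n) ->
  real_roots_are alpha r l Rts P T.
Proof.
move=> ok lr Pr c_pos Rts_ev.
have split_case : real_root_table alpha T r l Rts = Rts ->
    (forall i, ~~ black (satake_of T r l) i) -> (forall i j, ~~ arrow (satake_of T r l) i j) ->
    real_roots_are alpha r l Rts P T.
  move=> tE nb na D x; rewrite tE; split=> [[n [Pn _ _] ->] //|xR].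
  have [n xE] := Rts_ev x xR; exists n => //; split.
  - by rewrite /P -xE.
  - by move=> k _ bk; have := nb k; rewrite bk.
  - by move=> i j _ _ aij; have := na i j; rewrite aij.
case: T @d ok Pr c_pos split_case => [||||||||||||||||||||||| X] d ok Pr c_pos split_case;
  try by [apply: split_case].
- by move: ok => /andP[_ /eqP ok]; apply: table_AII.
- by move: ok => /andP[_ ok]; apply: table_AIII.
- exact: table_BI.
- exact: table_BCI.
- by move: ok => /andP[_ ok]; apply: table_BCIII.
- exact: table_CI.
- by move: ok => /andP[_ ok]; apply: table_CIII.
- by apply: table_DI => //; move: Pr c_pos; rewrite /d /=; case: ifP.
- by move: ok => /andP[r2 ok]; apply: table_DIII => //; move: Pr c_pos; rewrite /d /=; case: ifP.
- by move: ok => /eqP rE; subst r; apply: table_EII.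
- by move: ok => /eqP rE; subst r; apply: table_EIII.
- by move: ok => /eqP rE; subst r; apply: table_EIV.
- by move: ok => /eqP rE; subst r; apply: table_EVI.
- by move: ok => /eqP rE; subst r; apply: table_EVII.
- by move: ok => /eqP rE; subst r; apply: table_EIX.
- by move: ok => /eqP rE; subst r; apply: table_FII.
- by move: ok => /eqP rE; subst r; apply: table_FIII.
by move: ok => /andP[_ ok]; apply: table_Twice.
Qed.

(** * Lexicographic positivity of functionals *)

Section LexicographicOrder.
Variables (R : realType) (W : vectType R[i]).
Implicit Types (s : seq W) (b c : 'Hom(W, R[i]^o)) (u : seq R[i]).

Lemma lex_pos0 s : ~~ lex_pos [seq (0 : 'Hom(W, R[i]^o)) e | e <- s].
Proof. by elim: s => //= e s; rewrite zero_lfunE ltxx eqxx. Qed.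

Lemma lex_posD s b c : lex_pos [seq b e | e <- s] -> lex_pos [seq c e | e <- s] ->
  lex_pos [seq (b + c) e | e <- s].
Proof.
elim: s => //= e s IHs; rewrite add_lfunE.
case/orP=> [be|/andP[/eqP -> bs]]; case/orP=> [ce|/andP[/eqP -> cs]].
- by rewrite addr_gt0.
- by rewrite addr0 be.
- by rewrite add0r ce.
- by rewrite addr0 eqxx IHs ?orbT.
Qed.

Lemma lex_pos_cat u v : lex_pos (u ++ v) = lex_pos u || all (eq_op^~ 0) u && lex_pos v.
Proof. by elim: u => //= x u ->; case: (0 < x); case: (x == 0). Qed.

Lemma lex_pos_total s b : (forall e, e \in s -> complex.Im (b e) = 0) ->
  (exists2 e, e \in s & b e != 0) ->
  lex_pos [seq b e | e <- s] || lex_pos [seq (- b) e | e <- s].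
Proof.
elim: s => [_ [] //|e s IHs] real nz /=; rewrite opp_lfunE oppr_gt0 oppr_eq0.
have [be0|be] := eqVneq (b e : R[i]) 0.
  rewrite be0 ltxx /=; apply: IHs => [e' es|]; first by rewrite real // inE es orbT.
  case: nz => e'; rewrite inE => /orP[/eqP ->|]; last by exists e'.
  by rewrite be0 eqxx.
suff : (b e : R[i]) \is Num.real.
  by rewrite realE !le_eqVlt eq_sym (negPf be) /= => /orP[] ->; rewrite ?orbT.
have := real e (mem_head _ _); case: (b e : R[i]) => x y /= ->.
by rewrite realE !lecE /= eqxx le_total.
Qed.

(** Evaluation on a basis of [U] embeds W in a space of dimension dim U. *)
Lemma separating_span (U : {vspace 'Hom(W, R[i]^o)}) :
  (forall A, (forall b, b \in U -> b A = 0) -> A = 0) -> (\dim {:W} <= \dim U)%N.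
Proof.
move=> sep; pose f A : 'rV[R[i]]_(\dim U) := \row_i (vbasis U)`_i A.
have fL : linear f by move=> k A B; apply/rowP => i; rewrite !mxE linearP.
have fE : linfun f =1 f by exact: linfunE.
rewrite -(limg_ker_dim (linfun f) fullv) capfv.
have -> : lker (linfun f) = 0%VS.
  apply/eqP; rewrite -subv0; apply/subvP => A; rewrite memv_ker fE memv0 => /eqP fA.
  apply/eqP/sep => b /coord_vbasis ->; rewrite sum_lfunE big1 // => i _.
  have /rowP/(_ i) := fA; rewrite !mxE => bA.
  by rewrite scale_lfunE bA scaler0.
rewrite dimv0 add0n (leq_trans (dimvS (subvf _))) // dimvf /=.
by rewrite /dim /= mul1n.
Qed.

End LexicographicOrder.

(** * The order on restricted roots and its compatibility with theta *)

Section RestrictedRootOrder.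
Variables (R : realType) (g : lieAlgType R) (sigma theta : 'End(g)).
Variables (a : {vspace g}) (bp bk : seq g).
Hypothesis sigma_inv : lie_involution sigma.
Hypothesis theta_cartan : cartan_involution theta.
Hypothesis sigma_theta : (sigma \o theta)%VF = (theta \o sigma)%VF.
Hypothesis a_cartan : cartan_subspace sigma a.
Hypothesis theta_a : (theta @: a)%VS = a.
Hypothesis bpP : basis_of (minus_space theta :&: a)%VS bp.
Hypothesis bkP : basis_of (plus_space theta :&: a)%VS bk.

Local Notation dual := (cplx_dual R a).
Local Notation Roots := (restricted_roots sigma a).
Local Notation tact := (theta_act theta).
Implicit Types (b c : dual) (X : subvs_of a).

Definition lex_positive b : bool := lex_pos [seq b e | e <- aR_basis a bp bk].

Let theta_inv : lie_involution theta := proj1 theta_cartan.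

Lemma th_bp x : x \in bp -> th theta (vsproj a x) = - vsproj a x.
Proof.
move=> xb; have := basis_mem bpP xb; rewrite memv_cap mem_minus => /andP[/eqP xt xa].
by apply: val_inj; rewrite [RHS](linearN vsval) [LHS](vsval_th theta_a) /= vsprojK // xt.
Qed.

Lemma th_bk x : x \in bk -> th theta (vsproj a x) = vsproj a x.
Proof.
move=> xb; have := basis_mem bkP xb; rewrite memv_cap mem_plus => /andP[/eqP xt xa].
by apply: val_inj; rewrite [LHS](vsval_th theta_a) [RHS]vsprojK // vsprojK.
Qed.

Lemma aR_basis_real b e : aR_real theta b -> e \in aR_basis a bp bk -> complex.Im (b e) = 0.
Proof.
move=> br; rewrite mem_cat => /orP[] /mapP[x xb ->].
  have [_] := br (vsproj a x); rewrite th_bp // to_cplxN linearN raddfN /= => E; lra.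
have [+ _] := br (vsproj a x); rewrite th_bk // linearZ /=.
by case: (b _ : R[i]) => u v /= E; lra.
Qed.

Lemma aR_basis_separates b : (forall e, e \in aR_basis a bp bk -> b e = 0) -> b = 0.
Proof.
move=> b0; pose f x : R[i] := b (to_cplx (vsproj a x)).
have fD x y : f (x + y) = f x + f y by rewrite /f linearD to_cplxD linearD.
have fZ k x : f (k *: x) = (k%:C)%C * f x by rewrite /f linearZ to_cplxZ linearZ.
have f_span (s : seq g) x : (forall y, y \in s -> f y = 0) -> x \in <<s>>%VS -> f x = 0.
  move=> s0 /(@coord_span _ _ _ (in_tuple s)) ->.
  elim/big_ind: _ => [|y z yE zE|i _]; first by rewrite /f !linear0.
    by rewrite fD yE zE addr0.
  by rewrite fZ s0 ?mulr0 ?mem_nth.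
apply: dual_eq => X; rewrite zero_lfunE.
have i0 : ('i)%C != 0 :> R[i] by rewrite eq_complex /= oner_eq0 andbF.
have Xa := subvsP X; set x := vsval X in Xa.
have tx : theta x \in a by rewrite -theta_a memv_img.
have xE : x = 2^-1 *: (x - theta x) + 2^-1 *: (x + theta x).
  by rewrite -scalerDr addrACA addNr addr0 -mulr2n -scaler_nat scalerA mulVf ?scale1r ?pnatr_eq0.
have -> : b (to_cplx X) = f x by rewrite /f /x vsvalK.
rewrite xE fD !fZ (f_span bp) ?(f_span bk) ?mulr0 ?addr0 //.
- move=> y yb; have := b0 (('i)%C *: to_cplx (vsproj a y)).
  rewrite mem_cat (map_f (fun x => 'i%C *: to_cplx (vsproj a x)) yb) orbT linearZ.
  by move=> /(_ isT)/eqP; rewrite mulf_eq0 (negPf i0) => /eqP.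
- rewrite (span_basis bkP) memv_cap (rpredD Xa tx) andbT mem_plus.
  by rewrite linearD /= (involK theta_inv) addrC.
- move=> y yb; apply: b0.
  by rewrite mem_cat (map_f (fun x => to_cplx (vsproj a x)) yb).
rewrite (span_basis bpP) memv_cap (rpredB Xa tx) andbT mem_minus.
by rewrite linearB /= (involK theta_inv) opprB.
Qed.

Lemma lex_positive_total b : Roots b -> lex_positive b || lex_positive (- b).
Proof.
move=> bR; have br := root_aR_real sigma_inv theta_cartan a_cartan theta_a bR.
apply: lex_pos_total => [e|]; first exact: aR_basis_real.
apply: contrapT => none; case: bR => /eqP bn0 _; apply: bn0.
apply: aR_basis_separates => e es; apply/eqP; apply: contrapT => /negP be.
by apply: none; exists e.
Qed.

(** This is why the p-part comes first in the basis: b and -theta(b) agree there, so a nonzero value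
    there decides the sign of both. If b vanishes on the p-part, then theta(b) = b. *)
Lemma lex_positive_theta b : lex_positive b -> tact b != b -> lex_positive (- tact b).
Proof.
rewrite /lex_positive /aR_basis !map_cat !lex_pos_cat.
set sp := [seq _ | x <- bp]; set sk := [seq _ | x <- bk] => bpos tb.
have bE e : e \in sp -> (- tact b) e = b e.
  move=> /mapP[x xb ->]; rewrite opp_lfunE theta_actE /cplx_map /= th_bp //.
  rewrite (_ : (_, _) = - to_cplx (vsproj a x)) ?linearN ?opprK //.
  by rewrite -to_cplxN /to_cplx linear0.
have spE : [seq (- tact b) e | e <- sp] = [seq b e | e <- sp].
  by apply/eq_in_map.
rewrite spE; case/orP: bpos => [->//|/andP[/allP b0 _]].
case/eqP: tb; apply/eqP; rewrite -subr_eq0; apply/eqP.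
apply: aR_basis_separates => e; rewrite mem_cat => /orP[es|/mapP[x xb ->]].
  have be : b e = 0 by apply/eqP/b0/map_f.
  have := bE e es; rewrite !add_lfunE !opp_lfunE be => /eqP.
  by rewrite oppr_eq0 => /eqP ->; rewrite subr0.
have iE X : ('i)%C *: to_cplx X = (0, X) :> cplx (subvs_of a).
  by congr pair; rewrite /= ?scaler0 ?scale0r ?scale1r ?subr0 ?add0r.
by rewrite add_lfunE opp_lfunE theta_actE iE /cplx_map /= linear0 th_bk // subrr.
Qed.

Lemma dim_dual : \dim {:dual} = \dim {:cplx (subvs_of a)}.
Proof. by rewrite !dimvf; apply: muln1. Qed.

Lemma rank_dual : \dim {:dual} = \dim a.
Proof. by rewrite dim_dual dimvf; apply: (dimvf (subvs_of a)). Qed.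

Lemma roots_span (U : {vspace dual}) : (forall b, Roots b -> b \in U) -> U = fullv.
Proof.
move=> RU; apply/eqP; rewrite eqEdim subvf /=.
rewrite dim_dual; apply: separating_span => A A0.
apply: (restricted_roots_separate sigma_inv theta_cartan a_cartan theta_a) => b /RU.
exact: A0.
Qed.

End RestrictedRootOrder.

(** * The Satake diagram in terms of coefficients *)

Section SatakeData.
Variables (R : realType) (g : lieAlgType R) (sigma theta : 'End(g)).
Variables (a : {vspace g}) (bp bk : seq g) (r : nat) (D : satake) (alpha : nat -> cplx_dual R a).
Hypothesis satD : has_satake sigma theta bp bk r D alpha.

Lemma black_vertexP i : vertex r i -> theta_act theta (alpha i) = alpha i <-> black D i.
Proof.
have [[_ simp _ _ _] blackP _] := satD => ri; split=> [tE|/(blackP i ri)[] //].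
by apply/(blackP i ri); split=> //; apply/simp; exists i.
Qed.

(** Turns the congruence defining the Satake permutation into a condition on coefficient functions:
    they vanish at white vertices. *)
Lemma int_span_black b : int_span (black_simple sigma theta bp bk) b <->
  exists2 n, (forall k, vertex r k -> ~~ black D k -> n k = 0) & b = lincombz alpha r n.
Proof.
have [[_ simp _ _ _] blackP _] := satD.
split=> [[s [sB ->]]|[n n0 ->]].
  elim: s sB => [_|[m c] s IHs sB].
    by exists (fun=> 0); rewrite // big_nil lincombz0.
  have [n n0 nE] := IHs (fun x xs => sB x (@mem_behead _ (_ :: _) x xs)).
  have cB := sB (m, c) (mem_head _ _); have [/simp[i ri /= cE] _] := cB.
  exists (fun k => m * unitc i k + n k).
    move=> k rk kb; rewrite n0 // addr0 /unitc; case: eqP => [ki|]; rewrite ?mulr0 //.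
    by case/negP: kb; rewrite ki; apply/(blackP i ri); rewrite -cE.
  by rewrite big_cons nE lincombzD lincombzMz (lincombz_unit alpha ri) -cE.
exists [seq (n k, alpha k) | k <- index_iota 1 r.+1 & black D k]; split.
  move=> x /mapP[k]; rewrite mem_filter mem_index_iota => /andP[kb rk] -> /=.
  exact/(blackP k rk).
rewrite big_map big_filter [RHS]big_mkcond /= /lincombz !big_nat.
by apply: eq_bigr => k rk; case: ifPn => // kb; rewrite n0 // mulr0z.
Qed.

Lemma arrow_vertexP i j : vertex r i -> vertex r j -> arrow D i j <->
  [/\ i != j, ~~ black D i, ~~ black D j &
      exists2 n, (forall k, vertex r k -> ~~ black D k -> n k = 0) &
                 - theta_act theta (alpha i) - alpha j = lincombz alpha r n].
Proof.
have [[inj simp _ _ _] blackP arrowP] := satD => ri rj.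
have white k : vertex r k -> white_simple sigma theta bp bk (alpha k) <-> ~~ black D k.
  move=> rk; split=> [[_ nb]|nb]; first by apply/negP => /(blackP k rk).
  by split; [apply/simp; exists k|move=> /(blackP k rk); apply/negP].
split=> [/(arrowP i j ri rj)[ij [/(white i ri) wi /(white j rj) wj /int_span_black sp]]|].
  by split=> //; apply/eqP => E; apply: ij; rewrite E.
move=> [/eqP ij wi wj /int_span_black sp]; apply/(arrowP i j ri rj); split=> [E|].
  by apply: ij; apply: inj.
by split; [apply/white|apply/white|].
Qed.

End SatakeData.

Theorem theorem3p10 (R : realType) (g : lieAlgType R)
  (sigma theta : 'End(g)) (a : {vspace g}) (bp bk : seq g)
  (T : satake_type) (alpha : nat -> cplx_dual R a)
  (r : nat := (\dim a)%N) (l : nat := (\dim (minus_space theta :&: a))%N) :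
  lie_semisimple g ->
  ~ lie_compact g ->
  lie_involution sigma ->
  cartan_involution theta ->
  (sigma \o theta)%VF = (theta \o sigma)%VF ->
  cartan_subspace sigma a ->
  (theta @: a)%VS = a ->
  maximally_split sigma theta a ->
  basis_of (minus_space theta :&: a)%VS bp ->
  basis_of (plus_space theta :&: a)%VS bk ->
  type_ok T r l ->
  has_satake sigma theta bp bk r (satake_of T r l) alpha ->
  restricted_roots sigma a `&` [set beta | real_valued beta]
    = real_root_table alpha T r l (restricted_roots sigma a).
Proof.
move=> _ _ sigma_inv theta_cartan sigma_theta a_cartan theta_a _ bpP bkP ok satD.
have lr : (l <= r)%N := dimvS (capvSr _ _).
set Rts := restricted_roots sigma a; set ev := lincombz alpha r.
have aRr := root_aR_real sigma_inv theta_cartan a_cartan theta_a.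
have finite := restricted_roots_finite sigma_inv a_cartan.
have neq0 b : Rts b -> b != 0 by case.
have opp b : Rts b -> Rts (- b) := @root_opp R g sigma a b.
have span := roots_span sigma_inv theta_cartan a_cartan theta_a.
have aRD (b c : cplx_dual R a) : aR_real theta b -> aR_real theta c -> aR_real theta (b + c).
  move=> br cr X; rewrite !add_lfunE; have [] := br X; have [] := cr X.
  by do 4 case: (_ (to_cplx _) : R[i]) => ? ? /=; move=> -> -> -> ->; rewrite opprD.
have aRN (b : cplx_dual R a) : aR_real theta b -> aR_real theta (- b).
  by move=> br X; rewrite !opp_lfunE !raddfN /=; have [-> ->] := br X.
have aR0 : aR_real theta (0 : cplx_dual R a).
  by move=> X; rewrite !zero_lfunE /= oppr0.
have pos0 := lex_pos0 (aR_basis a bp bk).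
have posD := @lex_posD R _ (aR_basis a bp bk).
have total := lex_positive_total sigma_inv theta_cartan a_cartan theta_a bpP bkP.
have sym := formC theta_cartan theta_a.
have addr := @formDr R g a.
have scal := @formZr R g a.
have gt0 := form_gt0 theta_cartan theta_a.
have refl := root_reflection sigma_inv theta_cartan sigma_theta a_cartan theta_a.
have rank : \dim {:cplx_dual R a} = r := rank_dual a.
have tD := @theta_actD R g theta a.
have tK := theta_actK theta_cartan theta_a.
have tR := root_theta sigma_inv theta_cartan a_cartan theta_a.
have tF := form_theta theta_cartan theta_a.
have tP b (_ : Rts b) := @lex_positive_theta _ _ _ _ _ _ theta_cartan theta_a bpP bkP b.
have [[inj simp bondP longP dblP] _ _] := satD.
have bond3 i j (_ : vertex r i) (_ : vertex r j) := bond_satake_le3 T r l i j.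
have Pr := simple_root_set finite neq0 opp span aRr pos0 posD total sym addr scal gt0 refl
  simp rank bond3 bondP longP dblP.
have c_pos := simple_positive_pairing finite neq0 opp span aRr aRD aRN aR0 pos0 posD total
  sym addr scal gt0 refl simp rank bond3 bondP longP.
have crit := real_root_criterion finite neq0 opp span aRr aRD aRN aR0 pos0 posD total
  sym addr scal gt0 refl simp rank tD tK tR tF tP bond3 bondP longP
  (black_vertexP satD) (arrow_vertexP satD).
have comb b (bR : Rts b) : exists n, b = ev n.
  by have [n bE _] := root_combination finite opp pos0 posD total simp rank bR; exists n.
have tables := real_root_tables ok lr Pr c_pos comb.
apply/seteqP; split=> x.
  move=> [xR xreal]; apply/tables; have [n xE] := comb x xR; exists n => //.
  rewrite xE in xR xreal; have /(crit n xR)[nb na] := (real_valuedP (aRr _ xR)).1 xreal.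
  by split.
move=> /tables[n [nR nb na] ->]; split=> //.
by apply/(real_valuedP (aRr _ nR))/(crit n nR).
Qed.
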